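(* Let $\Omega\subset\mathbb{R}^2$ be an open rectangle, let $\Omega_-$ be an open rectangle with $\overline{\Omega_-}\subset\Omega$, and let $\Omega_+=\Omega\setminus\overline{\Omega_-}$. Let $a_+,a_-\in\mathbb{R}$ with $a_-a_+<0$ and $a_+/a_-\neq -1$, and let $a$ be the function equal to $a_+$ on $\Omega_+$ and to $a_-$ on $\Omega_-$. Let $\Omega_1\subset\mathbb{R}^2$ be an open set such that $\overline{\Omega_1}$ contains none of the four corners of $\Omega_-$, and let $\Omega_2\subset\mathbb{R}^2$ be an open set with $\overline{\Omega_1}\subset\Omega_2$. Put $\Omega_{1,\pm}=\Omega_\pm\cap\Omega_1$. Then there is a constant $C$ such that for every $f\in L^2(\Omega)$ and every $u\in H^1_0(\Omega)$ satisfying $$\forall v\in H^1_0(\Omega),\qquad \int_\Omega \bigl(a\,\nabla u\cdot\nabla v-f\,v\bigr)=0,$$ one has, with $u_\pm=u|_{\Omega_\pm}$, $u_-\in H^2(\Omega_{1,-})$ and $u_+\in H^2(\Omega_{1,+})$, together with the estimates $$\|u_\pm\|_{H^2(\Omega_{1,\pm})}\le C\,\bigl(\|f\|_{L^2(\Omega_2\cap\Omega)}+\|u\|_{H^1(\Omega_2\cap\Omega)}\bigr).$$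
   Context: $H^s$ denotes the usual $L^2$-based Sobolev spaces, and $H^1_0(\Omega)$ the subspace of $H^1(\Omega)$ of functions with zero trace on $\partial\Omega$. The constant $C$ may depend on $\Omega,\Omega_-,a_\pm,\Omega_1,\Omega_2$ but not on $u$ or $f$. *)

(* Defs.v *)
From HB Require Import structures.
From mathcomp Require Import all_boot all_order all_algebra.
From mathcomp Require Import all_classical all_reals all_analysis.

Set Implicit Arguments.
Unset Strict Implicit.
Unset Printing Implicit Defensive.

Import Order.TTheory GRing.Theory Num.Theory.
Import numFieldNormedType.Exports.

Local Open Scope classical_set_scope.
Local Open Scope ring_scope.

(* Functions on a subset U of the plane are represented by functions
   [f : R * R -> R], of which only the values on U matter. *)

(* The two copies of [measurableTypeR R] only fix the Borel sigma-algebra: as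
   topological spaces and as normed modules they are convertible to R. *)
Definition lebesgue2 (R : realType) :
    {measure set (measurableTypeR R * measurableTypeR R) -> \bar R} :=
  (@lebesgue_measure R \x @lebesgue_measure R)%E.

Section Sobolev.
Context {R : realType}.
Implicit Types (U : set (R * R)) (f g u phi : R * R -> R).

Definition L2 U f : Prop := f \_ U \in Lfun (lebesgue2 R) 2%:E.

Definition L2norm U f : \bar R := ('N[lebesgue2 R]_2[EFin \o (f \_ U)])%E.

Definition dx f : R * R -> R := fun x => 'D_((1, 0) : R * R) f x.
Definition dy f : R * R -> R := fun x => 'D_((0, 1) : R * R) f x.

Definition partial (i j : nat) f : R * R -> R := iter i dx (iter j dy f).

Fixpoint Ck (k : nat) f : Prop :=
  continuous f /\
  if k is m.+1 then
    [/\ forall x, derivable f x ((1, 0) : R * R),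
        forall x, derivable f x ((0, 1) : R * R),
        Ck m (dx f) & Ck m (dy f)]
  else True.

Definition smooth f : Prop := forall k, Ck k f.

Definition test_function U phi : Prop :=
  [/\ smooth phi, compact (closure [set x | phi x != 0]) &
      closure [set x | phi x != 0] `<=` U].

Definition is_weak_deriv U (i j : nat) u g : Prop :=
  L2 U g /\
  forall phi, test_function U phi ->
    \int[lebesgue2 R]_(x in U) (u x * partial i j phi x) =
    (-1) ^+ (i + j) * \int[lebesgue2 R]_(x in U) (g x * phi x).

(* A weak derivative is determined almost everywhere on U; this picks a
   representative of it (and the zero function if there is none). *)
Definition weakD U (i j : nat) u : R * R -> R :=
  xget (cst 0) [set g | is_weak_deriv U i j u g].

Definition Sobolev (k : nat) U u : Prop :=
  L2 U u /\
  forall i j : nat, (i + j <= k)%N -> exists g, is_weak_deriv U i j u g.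

Definition Sobolev_norm (k : nat) U u : \bar R :=
  sqrte (\sum_(i < k.+1) \sum_(j < k.+1 | (i + j <= k)%N)
           (L2norm U (weakD U i j u)) ^+ 2)%E.

End Sobolev.

(* The rectangle with vertex [rect_vertex], sides of lengths [rect_len1] and
   [rect_len2], the first one along the unit vector [rect_dir]; it need not be
   parallel to the coordinate axes. *)
Record rectangle (R : realType) := Rectangle {
  rect_vertex : R * R;
  rect_dir : R * R;
  rect_len1 : R;
  rect_len2 : R;
  rect_dir_unit : rect_dir.1 ^+ 2 + rect_dir.2 ^+ 2 = 1;
  rect_len1_gt0 : 0 < rect_len1;
  rect_len2_gt0 : 0 < rect_len2 }.

Section Rectangle.
Context {R : realType}.
Implicit Types (Q : rectangle R) (u g : R * R -> R).

Definition rect_point Q (s t : R) : R * R :=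
  let p := rect_vertex Q in
  let e := rect_dir Q in
  (p.1 + s * e.1 - t * e.2, p.2 + s * e.2 + t * e.1).

Definition open_rect Q : set (R * R) :=
  [set rect_point Q s t | s in `]0, rect_len1 Q[ & t in `]0, rect_len2 Q[ ].

Definition corners Q : set (R * R) :=
  [set rect_point Q s t | s in [set 0; rect_len1 Q] & t in [set 0; rect_len2 Q]].

(* The four sides are parametrized by arc length. *)
Definition bnd_L2norm Q g : \bar R :=
  let side1 t :=
    (\int[@lebesgue_measure R]_(s in `[0%R, rect_len1 Q])
       (g (rect_point Q s t) ^+ 2)%:E)%E in
  let side2 s :=
    (\int[@lebesgue_measure R]_(t in `[0%R, rect_len2 Q])
       (g (rect_point Q s t) ^+ 2)%:E)%E in
  sqrte (side1 0%R + side1 (rect_len2 Q) +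
         side2 0%R + side2 (rect_len1 Q))%E.

(* Graph of the trace operator from H^1(Q) to L^2 of the boundary, which is the
   continuous extension of the restriction to the boundary of functions that
   are smooth up to the boundary. *)
Definition has_trace Q u g : Prop :=
  measurable_fun [set: measurableTypeR R * measurableTypeR R] g /\
  exists phi : nat -> R * R -> R,
    [/\ forall n, smooth (phi n),
        Sobolev_norm 1 (open_rect Q) (u \- phi n) @[n --> \oo] --> 0%E &
        bnd_L2norm Q (g \- phi n) @[n --> \oo] --> 0%E].

Definition H10 Q u : Prop := Sobolev 1 (open_rect Q) u /\ has_trace Q u (cst 0).

(* The value on the boundary of Qm, a null set, is irrelevant. *)
Definition coef Qm (ap am : R) (x : R * R) : R :=
  if x \in open_rect Qm then am else ap.

Definition weak_solution Q (a f u : R * R -> R) : Prop :=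
  let D i j w := weakD (open_rect Q) i j w in
  forall v, H10 Q v ->
    \int[lebesgue2 R]_(x in open_rect Q)
      (a x * (D 1 0 u x * D 1 0 v x + D 0 1 u x * D 0 1 v x) - f x * v x) = 0.

End Rectangle.

(* Main.v *)
Require Import Defs.
From HB Require Import structures.
From mathcomp Require Import all_boot all_order all_algebra.
From mathcomp Require Import all_classical all_reals all_analysis.
From mathcomp Require Import measurable_realfun.
From mathcomp Require Import ring lra.
Import Order.TTheory GRing.Theory Num.Theory.
Import numFieldNormedType.Exports.
Local Open Scope classical_set_scope.
Local Open Scope ring_scope.
Set Implicit Arguments.
Unset Strict Implicit.
Unset Printing Implicit Defensive.

(** Away from the corners of the inner rectangle the coefficient is, up to a
    rigid motion, either constant or a function of the sign of one coordinate.
    In both cases reflections reduce the problem to the Poisson equation with a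
    square integrable right-hand side, for which interior H2 regularity is
    elementary ([regularity]): mollifying a weak solution, the Dirichlet integrals
    of the two components of its gradient add up to the integral of its squared
    Laplacian, because mixed derivatives commute, so that the second derivatives
    of the mollified solutions form a Cauchy sequence in L2. Multiplying
    by a cut-off function makes this local ([localisation]).

    The reductions are the following, for a solution [u] extended by zero.
    Near a point of the closure of the outer rectangle off the inner one
    ([patch_outer]), [u] is replaced by the sum of its odd reflections across the
    two nearest sides; corners of the outer rectangle need no special treatment,
    since reflecting a point of the rectangle across a side moves it away from the
    other points ([reflect_away]).
    Near an interior point of a side of the inner rectangle ([patch_interface]),
    let [sg] be the reflection across this side, [m] and [d] the half sum and the
    half difference of the two coefficients, and [s] the function equal to 1
    outside the inner rectangle and to -1 inside, so that the coefficient is [m + d s].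
    The odd part [S = u - u o sg] solves a Poisson equation: to see this, test the
    equation of [u] with [psi / (m + d s)], where [psi] is an odd test function, which is
    admissible because [psi] vanishes on the interface. The function
    [D = m (u + u o sg) + d s S] solves one as well, since its gradient is the even
    part of the flux; here [s S] is weakly differentiable because [S] vanishes on the
    interface. Finally [(ap + am) u] is [D + am S] outside and [D + ap S] inside,
    and [ap + am] is nonzero by the hypothesis on the contrast. No such
    reflection is available at a corner, where the inner rectangle fills a quarter
    of a neighbourhood and cannot be exchanged with its complement.

    A finite number of these local representations covers the compact set
    where regularity is claimed ([local_to_global]), and the weak derivatives of
    the resulting functions in H2 of the plane are those of [u].

    Functions are square integrable with bounded support throughout, and a
    function on an open set [U] is represented by its extension by zero, [cut U f];
    traces enter only through [zero_extension] and through the smooth functions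
    vanishing on the boundary ([H10_smooth]). *)

(** * Lebesgue measure and affine maps of the plane *)
Section AffineInvariance.
Context {R : realType}.
Local Notation leb := (@lebesgue_measure R).
Local Notation RR := (measurableTypeR R * measurableTypeR R)%type.
Local Notation mu := (lebesgue2 R).

Lemma measurable_aff1 (a b : R) :
  measurable_fun [set: measurableTypeR R] (fun x : measurableTypeR R => a * x + b : measurableTypeR R).
Proof.
apply: measurable_funD; last exact: measurable_cst.
exact: mulrl_measurable.
Qed.

Definition pushaff (a b : R) : {measure set (measurableTypeR R) -> \bar R} :=
  measure_function_pushforward__canonical__measure_function_Measure leb (measurable_aff1 a b).

(** Both sides are measures, so that it suffices to compare them on half-open
    intervals, whose preimages are again intervals. *)
Lemma lebesgue_aff1 (a b : R) (A : set (measurableTypeR R)) : a != 0 -> measurable A ->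
  (leb A = `|a|%:E * leb ((fun x : measurableTypeR R => a * x + b)%R @^-1` A))%E.
Proof.
move=> a0 mA.
pose m : {measure set (measurableTypeR R) -> \bar R} := measure_function_mscale__canonical__measure_function_Measure (NngNum (normr_ge0 a)) (pushaff a b).
suff H X : ocitv X -> leb X = m X by exact: (lebesgue_measure_unique H mA).
move=> [[c d] _ <-] /=.

have [cd|dc] := ltP c d; last first.
  have -> : `]c, d]%classic = set0 by rewrite set_itv_ge // bnd_simp -leNgt.
  by rewrite !measure0.
rewrite lebesgue_measure_itv /= lte_fin cd.
transitivity (`|a|%:E * leb ((fun x : measurableTypeR R => a * x + b)%R @^-1` `]c, d]%classic))%E; last by [].
have [ap|an|] := ltrgtP a 0; last by move/eqP; rewrite (negbTE a0).
- transitivity (`|a|%:E * leb `[((d - b) / a)%R, ((c - b) / a)%R[%classic)%E; last first.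
    congr (_ * leb _)%E; symmetry.
    apply/seteqP; split=> x /=; rewrite !in_itv /=.
      by rewrite ler_ndivrMr // ltr_ndivlMr //; move=> /andP[? ?]; apply/andP; split; lra.
    by rewrite ler_ndivrMr // ltr_ndivlMr //; move=> /andP[? ?]; apply/andP; split; lra.
  rewrite lebesgue_measure_itv /= lte_fin ltr_nM2r ?invr_lt0 // ltrD2r cd.
  rewrite -!EFinD -EFinM; congr EFin; rewrite ltr0_norm //; field; exact: a0.
- transitivity (`|a|%:E * leb `](((c - b) / a)%R), ((d - b) / a)%R]%classic)%E; last first.
    congr (_ * leb _)%E; symmetry.
    apply/seteqP; split=> x /=; rewrite !in_itv /=.
      by rewrite ler_pdivlMr // ltr_pdivrMr //; move=> /andP[? ?]; apply/andP; split; lra.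
    by rewrite ler_pdivlMr // ltr_pdivrMr //; move=> /andP[? ?]; apply/andP; split; lra.
  rewrite lebesgue_measure_itv /= lte_fin ltr_pM2r ?invr_gt0 // ltrD2r cd.
  rewrite -!EFinD -EFinM; congr EFin; rewrite gtr0_norm //; field; exact: a0.
Qed.

Lemma integral_aff1 (a b : R) (f : measurableTypeR R -> \bar R) : a != 0 ->
  measurable_fun setT f -> (forall x, 0 <= f x)%E ->
  (\int[leb]_x f x = `|a|%:E * \int[leb]_x f (a * x + b)%R)%E.
Proof.
move=> a0 mf f0.
rewrite (@eq_measure_integral _ _ _ setT (mscale (NngNum (normr_ge0 a)) (pushaff a b))).
  rewrite ge0_integral_mscale //=; congr (_ * _)%E.
  rewrite (ge0_integral_pushforward (measurable_aff1 a b)) //.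
by move=> A mA _; exact: lebesgue_aff1.
Qed.

Definition aff (p : R * R) (a b c d : R) (x : R * R) : R * R :=
  (p.1 + a * x.1 + b * x.2, p.2 + c * x.1 + d * x.2).

Lemma measurable_aff p a b c d : measurable_fun [set: RR] (aff p a b c d : RR -> RR).
Proof.
apply/measurable_fun_pairP; split => /=.
  apply: measurable_funD; first apply: measurable_funD => //.
    by apply: measurable_funM => //; exact: measurable_fst.
  by apply: measurable_funM => //; exact: measurable_snd.
apply: measurable_funD; first apply: measurable_funD => //.
  by apply: measurable_funM => //; exact: measurable_fst.
by apply: measurable_funM => //; exact: measurable_snd.
Qed.

Lemma tonelli12 (f : RR -> \bar R) : measurable_fun setT f -> (forall x, 0 <= f x)%E ->
  (\int[mu]_x f x = \int[leb]_x \int[leb]_y f (x, y))%E.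
Proof. by move=> mf f0; rewrite fubini_tonelli1. Qed.

Lemma tonelli21 (f : RR -> \bar R) : measurable_fun setT f -> (forall x, 0 <= f x)%E ->
  (\int[mu]_x f x = \int[leb]_y \int[leb]_x f (x, y))%E.
Proof. by move=> mf f0; rewrite fubini_tonelli2. Qed.

Lemma mE_aff p a b c d (f : RR -> \bar R) : measurable_fun setT f ->
  measurable_fun setT (fun x : RR => f (aff p a b c d x : RR)).
Proof. by move=> mf; apply: (measurableT_comp mf); exact: measurable_aff. Qed.

(** By Tonelli's theorem, integrating first in the coordinate that the map changes. *)
Lemma integral_shear1 e a b (f : RR -> \bar R) : a != 0 ->
  measurable_fun setT f -> (forall x, 0 <= f x)%E ->
  (\int[mu]_x f x = `|a|%:E * \int[mu]_x f (aff (e, 0%R) a b 0%R 1%R x))%E.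
Proof.
move=> a0 mf f0; rewrite tonelli21 // tonelli21 //; last exact: mE_aff.
rewrite -ge0_integralZl //=; last 2 first.
- by have := measurable_fun_fubini_tonelli_G (m1 := leb) _ (mE_aff (e, 0) a b 0 1 mf) (fun=> f0 _).
- by move=> y _; exact: integral_ge0.
apply: eq_integral => y _.
rewrite (integral_aff1 (b * y + e) a0) //; last exact: (measurableT_comp mf (pair2_measurable y)).
congr (_ * _)%E; apply: eq_integral => x _; congr f.
by rewrite /aff /= add0r mul0r mul1r add0r; congr pair; ring.
Qed.

Lemma integral_shear2 e c d (f : RR -> \bar R) : d != 0 ->
  measurable_fun setT f -> (forall x, 0 <= f x)%E ->
  (\int[mu]_x f x = `|d|%:E * \int[mu]_x f (aff (0%R, e) 1%R 0%R c d x))%E.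
Proof.
move=> a0 mf f0; rewrite tonelli12 // tonelli12 //; last exact: mE_aff.
rewrite -ge0_integralZl //=; last 2 first.
- by have := measurable_fun_fubini_tonelli_F (m2 := leb) _ (mE_aff (0, e) 1 0 c d mf) (fun=> f0 _).
- by move=> y _; exact: integral_ge0.
apply: eq_integral => x _.
rewrite (integral_aff1 (c * x + e) a0) //; last exact: (measurableT_comp mf (pair1_measurable x)).
congr (_ * _)%E; apply: eq_integral => y _; congr f.
by rewrite /aff /= add0r mul0r mul1r addr0; congr pair; ring.
Qed.

Lemma integral_swap (f : RR -> \bar R) :
  measurable_fun setT f -> (forall x, 0 <= f x)%E ->
  (\int[mu]_x f x = \int[mu]_x f (aff (0%R, 0%R) 0%R 1%R 1%R 0%R x))%E.
Proof.
move=> mf f0; rewrite tonelli12 // tonelli21 //; last exact: mE_aff.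
apply: eq_integral => x _; apply: eq_integral => y _; congr f.
by rewrite /aff /=; congr pair; ring.
Qed.

(** Composition of a map changing only the first coordinate with one changing
    only the second. *)
Lemma integral_aff_ne p a b c d (f : RR -> \bar R) : a != 0 -> `|a * d - b * c| = 1 ->
  measurable_fun setT f -> (forall x, 0 <= f x)%E ->
  (\int[mu]_x f (aff p a b c d x) = \int[mu]_x f x)%E.
Proof.
move=> a0 D mf f0; have D0 : d - b * c / a != 0.
  apply/eqP => E; move/eqP: D; suff -> : a * d - b * c = a * (d - b * c / a) by rewrite E mulr0 normr0 eq_sym oner_eq0.
  by field.
rewrite (integral_shear2 (p.2 - c * p.1 / a) (c / a) D0 mf f0).
rewrite (@integral_shear1 p.1 a b (fun x => f (aff (0, p.2 - c * p.1 / a) 1 0 (c / a) (d - b * c / a) x))) //; last exact: mE_aff.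
rewrite muleA -EFinM -normrM.
have -> : (d - b * c / a) * a = a * d - b * c by field.
rewrite D mul1e; apply: eq_integral => x _; congr f.
by rewrite /aff /=; congr pair; field.
Qed.

(** A linear map with determinant +-1 is a product of shears, dilations of one
    coordinate and possibly the exchange of the coordinates. *)
Lemma integral_aff p a b c d (f : RR -> \bar R) : `|a * d - b * c| = 1 ->
  measurable_fun setT f -> (forall x, 0 <= f x)%E ->
  (\int[mu]_x f (aff p a b c d x) = \int[mu]_x f x)%E.
Proof.
move=> D mf f0; have [a0|] := eqVneq a 0; last by move=> a0; exact: (integral_aff_ne p a0 D mf f0).
have b0 : b != 0 by apply: contra_eq_neq D => ->; rewrite a0 !mul0r subr0 normr0 eq_sym oner_eq0.
rewrite -(@integral_aff_ne p b a d c f) //; last by rewrite -normrN -D; congr `| _ |; ring.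
rewrite [RHS]integral_swap //; last exact: mE_aff.
apply: eq_integral => x _; congr f.
by rewrite /aff /=; congr pair; ring.
Qed.

End AffineInvariance.

(** * Square integrable functions of bounded support *)

(** Sealed: unification must not unfold the integral. *)
HB.lock Definition I (R : realType) (f : R * R -> R) : R := \int[lebesgue2 R]_x f x.

Section SquareIntegrable.
Context {R : realType}.
Local Notation leb := (@lebesgue_measure R).
Local Notation RR := (measurableTypeR R * measurableTypeR R)%type.
Local Notation mu := (lebesgue2 R).
Implicit Types (f g h : R * R -> R).

Lemma sqr_le_norm (u v K : R) : `|u| <= K * `|v| -> u ^+ 2 <= K ^+ 2 * v ^+ 2.
Proof.
move=> h; rewrite -(real_normK (num_real u)) -(real_normK (num_real v)) -exprMn.
by rewrite ler_sqr ?nnegrE // (le_trans _ h).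
Qed.

Definition mf f := measurable_fun [set: RR] (f : RR -> R).
Definition itg f := mu.-integrable [set: RR] (EFin \o f).
Lemma I_E f : I f = \int[mu]_x f x. Proof. by rewrite unlock. Qed.

Lemma mf_cst c : mf (fun=> c). Proof. exact: measurable_cst. Qed.
Lemma mfD f g : mf f -> mf g -> mf (fun x => f x + g x).
Proof. exact: measurable_funD. Qed.
Lemma mfB f g : mf f -> mf g -> mf (fun x => f x - g x).
Proof. exact: measurable_funB. Qed.
Lemma mfN f : mf f -> mf (fun x => - f x).
Proof. exact: measurable_funN. Qed.
Lemma mfM f g : mf f -> mf g -> mf (fun x => f x * g x).
Proof. exact: measurable_funM. Qed.
Lemma mf_sqr f : mf f -> mf (fun x => f x ^+ 2).
Proof. by move=> h; apply: measurable_funX. Qed.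
Lemma mf_aff p a b c d f : mf f -> mf (f \o aff p a b c d).
Proof. by move=> h; apply: (measurableT_comp h); exact: measurable_aff. Qed.
Lemma mfE f : mf f -> measurable_fun [set: RR] (EFin \o f).
Proof. by move=> h; apply/measurable_EFinP. Qed.

Lemma itg_mf f : itg f -> mf f.
Proof. by move=> /integrableP[] /measurable_EFinP. Qed.

Lemma itg_le f g : mf f -> itg g -> (forall x, `|f x| <= g x) -> itg f.
Proof.
move=> hf hg fg; apply: (@le_integrable _ _ _ mu setT measurableT _ (EFin \o g)) => //.
  exact: mfE.
by move=> x _ /=; rewrite lee_fin (le_trans (fg x)) // ler_norm.
Qed.

Lemma itgD f g : itg f -> itg g -> itg (fun x => f x + g x).
Proof. by move=> hf hg; have := integrableD measurableT hf hg; apply: eq_integrable. Qed.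
Lemma itgB f g : itg f -> itg g -> itg (fun x => f x - g x).
Proof. by move=> hf hg; have := integrableB measurableT hf hg; apply: eq_integrable. Qed.
Lemma itgZ c f : itg f -> itg (fun x => c * f x).
Proof. by move=> hf; have := integrableZl measurableT c hf; apply: eq_integrable. Qed.
Lemma itg_norm f : itg f -> itg (fun x => `|f x|).
Proof. by move=> hf; have := integrable_abse hf; apply: eq_integrable. Qed.
Lemma itg0 : itg (fun=> 0).
Proof. exact: integrable0. Qed.

Lemma eq_I f g : (forall x, f x = g x) -> I f = I g.
Proof. by move=> fg; congr I; apply/funext. Qed.
Lemma ID f g : itg f -> itg g -> I (fun x => f x + g x) = I f + I g.
Proof. by move=> hf hg; rewrite !I_E; exact: RintegralD. Qed.
Lemma IB f g : itg f -> itg g -> I (fun x => f x - g x) = I f - I g.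
Proof. by move=> hf hg; rewrite !I_E; exact: RintegralB. Qed.
Lemma IZ c f : itg f -> I (fun x => c * f x) = c * I f.
Proof. by move=> hf; rewrite !I_E; exact: RintegralZl. Qed.
Lemma IN f : itg f -> I (fun x => - f x) = - I f.
Proof. by move=> hf; rewrite -mulN1r -IZ //; apply: eq_I => x; rewrite mulN1r. Qed.
Lemma I0 : I (fun=> 0 : R) = 0.
Proof. by rewrite ?I_E /Rintegral integral0. Qed.
Lemma I_ge0 f : (forall x, 0 <= f x) -> 0 <= I f.
Proof. by move=> f0; rewrite I_E; apply: Rintegral_ge0 => x _. Qed.
Lemma le_I f g : itg f -> itg g -> (forall x, f x <= g x) -> I f <= I g.
Proof. by move=> hf hg fg; rewrite !I_E; apply: le_Rintegral => // x _. Qed.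
Lemma norm_I f : itg f -> `|I f| <= I (fun x => `|f x|).
Proof. by move=> hf; rewrite !I_E; apply: le_normr_Rintegral. Qed.
Lemma IE f : itg f -> ((I f)%:E = \int[mu]_x (f x)%:E)%E.
Proof. by move=> hf; rewrite ?I_E /Rintegral fineK //; exact: integrable_fin_num. Qed.

Lemma itg_ge0 f : mf f -> (forall x, 0 <= f x) -> (\int[mu]_x (f x)%:E < +oo)%E -> itg f.
Proof.
move=> hf f0 h; apply/integrableP; split; first exact: mfE.
by under eq_integral => x _ do rewrite /= ger0_norm //.
Qed.

Section AffineChange.
Variables (p : R * R) (a b c d : R).
Hypothesis D : `|a * d - b * c| = 1.
Let T := aff p a b c d.

Lemma itg_aff f : itg f -> itg (f \o T).
Proof.
move=> hf; have mf_ := itg_mf hf.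
apply/integrableP; split; first by apply: mfE; exact: mf_aff.
rewrite (@integral_aff R p a b c d (fun x => `|(f x)%:E|)%E) //.
  by move/integrableP: hf => [].
by apply: measurableT_comp => //; exact: mfE.
Qed.

Lemma I_aff f : itg f -> I (f \o T) = I f.
Proof.
move=> hf; have mf_ := mfE (itg_mf hf).
rewrite ?I_E /Rintegral; congr fine; rewrite integralE [RHS]integralE.
congr (_ - _)%E.
  transitivity (\int[mu]_x (EFin \o f)^\+ (aff p a b c d x))%E.
    apply: eq_integral => x _. by rewrite ?funeposE ?funenegE.
  by rewrite (integral_aff p D (measurable_funepos mf_)) // => x; exact: funepos_ge0.
transitivity (\int[mu]_x (EFin \o f)^\- (aff p a b c d x))%E.
    apply: eq_integral => x _. by rewrite ?funeposE ?funenegE.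
  by rewrite (integral_aff p D (measurable_funeneg mf_)) // => x; exact: funeneg_ge0.
Qed.

(** The coordinates of [x] are combinations of those of [T x], by Cramer's rule. *)
Lemma aff_bounded (M : R) : exists N, forall x, N < `|x| -> M < `|T x|.
Proof.
exists ((`|a| + `|b| + `|c| + `|d|) * (M + `|p.1| + `|p.2|)) => x.
rewrite ltNge [M < _]ltNge; apply: contra => h.
have [h1 h2] : `|(T x).1| <= M /\ `|(T x).2| <= M.
  by move: h; rewrite prod_normE ge_max => /andP[].
have E1 : `|x.1| = `|d * ((T x).1 - p.1) - b * ((T x).2 - p.2)|.
  rewrite -[LHS]mul1r -D -normrM; congr `| _ |; rewrite /T /aff /=; ring.
have E2 : `|x.2| = `|a * ((T x).2 - p.2) - c * ((T x).1 - p.1)|.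
  rewrite -[LHS]mul1r -D -normrM; congr `| _ |; rewrite /T /aff /=; ring.
have K (u v : R) : `|u| <= `|a| + `|b| + `|c| + `|d| -> True by [].
have M1 : `|(T x).1 - p.1| <= M + `|p.1| + `|p.2|.
  by rewrite (le_trans (ler_normB _ _)) //; have := normr_ge0 p.2; lra.
have M2 : `|(T x).2 - p.2| <= M + `|p.1| + `|p.2|.
  by rewrite (le_trans (ler_normB _ _)) //; have := normr_ge0 p.1; lra.
rewrite prod_normE ge_max E1 E2; apply/andP; split; apply: (le_trans (ler_normB _ _)); rewrite !normrM.
  have := ler_wpM2l (normr_ge0 d) M1; have := ler_wpM2l (normr_ge0 b) M2.
  have q := le_trans (normr_ge0 _) M1.
  have := mulr_ge0 (normr_ge0 a) q; have := mulr_ge0 (normr_ge0 c) q; rewrite !mulrDl; lra.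
have := ler_wpM2l (normr_ge0 a) M2; have := ler_wpM2l (normr_ge0 c) M1.
have q := le_trans (normr_ge0 _) M1.
have := mulr_ge0 (normr_ge0 b) q; have := mulr_ge0 (normr_ge0 d) q; rewrite !mulrDl; lra.
Qed.
End AffineChange.

Definition bsupp f := exists M, forall x, M < `|x| -> f x = 0.
(** The class of functions used for all solutions, gradients and data. It is
    stable under the operations needed below, and contained in L1. *)
Definition bL2 f := [/\ mf f, bsupp f & itg (fun x => f x ^+ 2)].

Lemma bL2_mf f : bL2 f -> mf f. Proof. by case. Qed.
Lemma bL2_itg2 f : bL2 f -> itg (fun x => f x ^+ 2). Proof. by case. Qed.

Lemma itgM f g : bL2 f -> bL2 g -> itg (fun x => f x * g x).
Proof.
move=> [mf1 _ f2] [mg _ g2]; apply: (itg_le (g := fun x => f x ^+ 2 + g x ^+ 2)).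
- exact: mfM.
- exact: itgD.
- move=> x; rewrite normrM -(real_normK (num_real (f x))) -(real_normK (num_real (g x))).
  by have := sqr_ge0 (`|f x| - `|g x|); have := sqr_ge0 (`|f x| + `|g x|); rewrite !expr2; lra.
Qed.

Lemma bsupp_le f g : bsupp f -> (forall x, f x = 0 -> g x = 0) -> bsupp g.
Proof. by move=> [M h] fg; exists M => x /h/fg. Qed.

Lemma bsuppU f g h : bsupp f -> bsupp g -> (forall x, f x = 0 -> g x = 0 -> h x = 0) -> bsupp h.
Proof.
move=> [M hf] [N hg] H; exists (Num.max M N) => x; rewrite gt_max => /andP[? ?].
by apply: H; [exact: hf|exact: hg].
Qed.

Lemma bL2_le K f g : bL2 f -> mf g -> (forall x, `|g x| <= K * `|f x|) -> bL2 g.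
Proof.
move=> [mf1 bf f2] mg h; split => //.
  by apply: (bsupp_le bf) => x fx; apply/eqP; move: (h x); rewrite fx normr0 mulr0 normr_le0.
apply: (itg_le (g := fun x => K ^+ 2 * f x ^+ 2)); first exact: mf_sqr.
  exact: itgZ.
by move=> x; rewrite ger0_norm ?sqr_ge0 //; exact: sqr_le_norm.
Qed.

Lemma bL2D f g : bL2 f -> bL2 g -> bL2 (fun x => f x + g x).
Proof.
move=> hf hg; have [mf1 bf f2] := hf; have [mg bg g2] := hg; split; first exact: mfD.
  by apply: (bsuppU bf bg) => x -> ->; rewrite addr0.
apply: (itg_le (g := fun x => 2 * f x ^+ 2 + 2 * g x ^+ 2)); first by apply: mf_sqr; exact: mfD.
  by apply: itgD; exact: itgZ.
by move=> x; rewrite ger0_norm ?sqr_ge0 //; have := sqr_ge0 (f x - g x); rewrite !expr2; lra.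
Qed.
Lemma bL2Z c f : bL2 f -> bL2 (fun x => c * f x).
Proof.
move=> h; apply: (@bL2_le `|c| f) => //; first by apply: mfM; [exact: mf_cst|exact: bL2_mf].
by move=> x; rewrite normrM.
Qed.
Lemma bL2N f : bL2 f -> bL2 (fun x => - f x).
Proof. by move=> /(bL2Z (-1)); under eq_fun do rewrite mulN1r. Qed.
Lemma bL2B f g : bL2 f -> bL2 g -> bL2 (fun x => f x - g x).
Proof. by move=> hf /bL2N; apply: bL2D. Qed.
Lemma bL2_0 : bL2 (fun=> 0).
Proof.
split; [exact: mf_cst | by exists 0 | ].
by under eq_fun do rewrite expr2 mulr0; exact: itg0.
Qed.

(** Bounded measurable multipliers. *)
Definition bm f := mf f /\ exists M, forall x, `|f x| <= M.

Lemma bmM m f : bm m -> bL2 f -> bL2 (fun x => m x * f x).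
Proof.
move=> [mm [M hM]] hf; apply: (@bL2_le M f) => //; first by apply: mfM => //; exact: bL2_mf.
by move=> x; rewrite normrM ler_wpM2r.
Qed.
Lemma bm_cst c : bm (fun=> c).
Proof. by split; [exact: mf_cst| exists `|c|]. Qed.
Lemma bmm m n : bm m -> bm n -> bm (fun x => m x * n x).
Proof.
move=> [m1 [M hM]] [n1 [N hN]]; split; first exact: mfM.
by exists (M * N) => x; rewrite normrM ler_pM.
Qed.
Lemma bmD m n : bm m -> bm n -> bm (fun x => m x + n x).
Proof.
move=> [m1 [M hM]] [n1 [N hN]]; split; first exact: mfD.
by exists (M + N) => x; rewrite (le_trans (ler_normD _ _)) // lerD.
Qed.
Lemma bmN m : bm m -> bm (fun x => - m x).
Proof.
by move=> [m1 [M hM]]; split; [exact: mfN|exists M => x; rewrite normrN].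
Qed.
Lemma bm_indic (A : set RR) : measurable A -> bm (\1_A : R * R -> R).
Proof.
move=> mA; split; first exact: measurable_indic.
by exists 1 => x; rewrite indicE; case: (_ \in _); rewrite ?normr1 ?normr0.
Qed.

Lemma bL2_aff p a b c d f : `|a * d - b * c| = 1 -> bL2 f -> bL2 (fun x => f (aff p a b c d x)).
Proof.
move=> D [mf1 [M hM] f2]; split; first exact: mf_aff.
  by have [N hN] := aff_bounded p D M; exists N => x /hN /hM.
exact: (itg_aff p D f2).
Qed.

Lemma mu_setX (X Y : set (measurableTypeR R)) : measurable X -> measurable Y ->
  mu (X `*` Y) = (leb X * leb Y)%E.
Proof. exact: product_measure1E. Qed.

Lemma itg_box (M : R) : itg (\1_(`[-M, M] `*` `[-M, M] : set RR) : R * R -> R).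
Proof.
apply: itg_ge0 => //.
- by apply: measurable_indic; apply: measurableX.
- rewrite integral_indic ?setIT //; last exact: measurableX.
  rewrite mu_setX // lebesgue_measure_itv /=.
  by case: ifPn => _; rewrite ?mule0 // -EFinM ltry.
Qed.

Lemma bL2_bounded f : mf f -> bsupp f -> (exists K, forall x, `|f x| <= K) -> bL2 f.
Proof.
move=> mf1 [M hM] [K hK]; split => //; first by exists M.
apply: (itg_le (g := fun x => K ^+ 2 * (\1_(`[-M, M] `*` `[-M, M] : set RR) x))).
- exact: mf_sqr.
- exact/itgZ/itg_box.
move=> x; rewrite normrX; have [Mx|xM] := ltP M `|x|.
  by rewrite hM // normr0 expr0n /= mulr_ge0 ?sqr_ge0 // indicE; case: (_ \in _).
rewrite indicE mem_set ?mulr1; last first.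
  by move: xM; rewrite prod_normE ge_max !ler_norml => /andP[h1 h2]; split; rewrite /= in_itv.
by rewrite ler_sqr ?nnegrE // (le_trans _ (hK x)).
Qed.

(** [f] is the product of itself with the indicator of a box. *)
Lemma bL2_itg f : bL2 f -> itg f.
Proof.
move=> [mf1 [M hM] f2]; apply: (itg_le (g := fun x => f x ^+ 2 + \1_(`[-M, M] `*` `[-M, M] : set RR) x)) => //.
  by apply: itgD => //; exact: itg_box.
move=> x; have [Mx|xM] := ltP M `|x|.
  by rewrite hM // normr0 expr0n /= add0r indicE; case: (_ \in _).
rewrite indicE mem_set; last first.
  by move: xM; rewrite prod_normE ge_max !ler_norml => /andP[h1 h2]; split; rewrite /= in_itv.
by rewrite /= -[f x ^+ 2]ger0_norm ?sqr_ge0 // normrX; have := sqr_ge0 (`|f x| - 1); rewrite !expr2; have := normr_ge0 (f x); nra.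
Qed.

Definition ip f g := I (fun x => f x * g x).
Definition n2 f := ip f f.

Lemma ipC f g : ip f g = ip g f.
Proof. by apply: eq_I => x; rewrite mulrC. Qed.
Lemma n2_ge0 f : 0 <= n2 f.
Proof. by apply: I_ge0 => x; rewrite -expr2 sqr_ge0. Qed.
Lemma ipDl f g h : bL2 f -> bL2 g -> bL2 h -> ip (fun x => f x + g x) h = ip f h + ip g h.
Proof. by move=> ? ? ?; rewrite -ID; try exact: itgM; apply: eq_I => x; rewrite mulrDl. Qed.
Lemma ipBl f g h : bL2 f -> bL2 g -> bL2 h -> ip (fun x => f x - g x) h = ip f h - ip g h.
Proof. by move=> ? ? ?; rewrite -IB; try exact: itgM; apply: eq_I => x; rewrite mulrBl. Qed.
Lemma ipZl c f h : bL2 f -> bL2 h -> ip (fun x => c * f x) h = c * ip f h.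
Proof. by move=> ? ?; rewrite -IZ; try exact: itgM; apply: eq_I => x; rewrite mulrA. Qed.

Lemma n2_le K f g : bL2 f -> bL2 g -> (forall x, `|g x| <= K * `|f x|) -> n2 g <= K ^+ 2 * n2 f.
Proof.
move=> hf hg h; rewrite -IZ; last exact: itgM.
apply: le_I; [exact: itgM| apply: itgZ; exact: itgM|] => x.
by rewrite -!expr2; exact: sqr_le_norm.
Qed.

Lemma n2D f g : bL2 f -> bL2 g -> n2 (fun x => f x + g x) <= 2 * n2 f + 2 * n2 g.
Proof.
move=> hf hg; rewrite -!IZ; try exact: itgM.
rewrite -ID; try (apply: itgZ; exact: itgM).
apply: le_I; [apply: itgM; exact: bL2D| apply: itgD; apply: itgZ; exact: itgM|] => x.
by have := sqr_ge0 (f x - g x); rewrite expr2; lra.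
Qed.
Lemma n2N f : n2 (fun x => - f x) = n2 f.
Proof. by apply: eq_I => x; rewrite mulrNN. Qed.
Lemma n2B f g : bL2 f -> bL2 g -> n2 (fun x => f x - g x) <= 2 * n2 f + 2 * n2 g.
Proof. by move=> hf hg; rewrite -[n2 g]n2N; apply: n2D => //; exact: bL2N. Qed.
Lemma n2Z c f : bL2 f -> n2 (fun x => c * f x) = c ^+ 2 * n2 f.
Proof.
by move=> hf; rewrite -IZ; [apply: eq_I => x; ring|exact: itgM].
Qed.

Lemma n2_lin t f g : bL2 f -> bL2 g ->
  n2 (fun x => f x + t * g x) = n2 f + 2 * t * ip f g + t ^+ 2 * n2 g.
Proof.
move=> hf hg; rewrite -!IZ; try exact: itgM.
rewrite -!ID; first by apply: eq_I => x; ring.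
all: do ?apply: itgD; do ?apply: itgZ; exact: itgM.
Qed.

(** The quadratic polynomial [n2 (f + t g)] in [t] is nonnegative. *)
Lemma CS f g : bL2 f -> bL2 g -> ip f g ^+ 2 <= n2 f * n2 g.
Proof.
move=> hf hg; have H t : 0 <= n2 f + 2 * t * ip f g + t ^+ 2 * n2 g.
  by rewrite -n2_lin //; exact: n2_ge0.
have [g0|g0] := eqVneq (n2 g) 0.
  have [->|i0] := eqVneq (ip f g) 0; first by rewrite expr0n /= g0 mulr0.
  have := H (- (n2 f + 1) / (2 * ip f g)); rewrite g0 mulr0 addr0.
  have -> : 2 * (- (n2 f + 1) / (2 * ip f g)) * ip f g = - (n2 f + 1) by field.
  by lra.
have gp : 0 < n2 g by rewrite lt_neqAle eq_sym g0 n2_ge0.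
have := H (- ip f g / n2 g).
have -> : n2 f + 2 * (- ip f g / n2 g) * ip f g + (- ip f g / n2 g) ^+ 2 * n2 g =
   (n2 f * n2 g - ip f g ^+ 2) / n2 g by field.
by rewrite pmulr_lge0 ?invr_gt0 // subr_ge0.
Qed.

Lemma ip_n2_0 f g : bL2 f -> bL2 g -> n2 f = 0 -> ip f g = 0.
Proof.
move=> hf hg f0; apply/eqP; rewrite -sqrf_eq0; apply/eqP/le_anti.
by rewrite sqr_ge0 andbT (le_trans (CS hf hg)) // f0 mul0r.
Qed.

Lemma n2_eq f g : bL2 f -> bL2 g -> n2 (fun x => f x - g x) = 0 -> n2 f = n2 g.
Proof.
move=> hf hg h0; have hd := bL2B hf hg.
have E1 := ip_n2_0 hd hf h0; have E2 := ip_n2_0 hd hg h0.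
move: E1 E2; rewrite !ipBl // => E1 E2.
by rewrite /n2 (subr0_eq E1) ipC; apply: subr0_eq.
Qed.

Lemma ip_aff p a b c d f g : `|a * d - b * c| = 1 -> bL2 f -> bL2 g ->
  ip (fun x => f (aff p a b c d x)) (fun x => g (aff p a b c d x)) = ip f g.
Proof. by move=> D hf hg; rewrite /ip -[RHS](I_aff p D) //; exact: itgM. Qed.

End SquareIntegrable.

(** * Smooth functions and test functions *)

(** Sealed: unification must not unfold the partial derivatives. *)
HB.lock Definition px (R : realType) (f : R * R -> R) : R * R -> R := dx f.
HB.lock Definition py (R : realType) (f : R * R -> R) : R * R -> R := dy f.

Section Calculus.
Context {R : realType}.
Implicit Types (f g : R * R -> R) (x : R * R).
Local Notation e1 := ((1, 0) : R * R).
Local Notation e2 := ((0, 1) : R * R).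

Lemma Ck_cont k f : Ck k f -> continuous f.
Proof. by case: k => [|k] []. Qed.

Lemma Ck_intro k f g h : continuous f -> (forall x, is_derive x e1 f (g x)) ->
  (forall x, is_derive x e2 f (h x)) -> Ck k g -> Ck k h -> Ck k.+1 f.
Proof.
move=> cf fg fh Cg Ch; split => //.
have -> : dx f = g by apply/funext => x; exact: derive_val.
have -> : dy f = h by apply/funext => x; exact: derive_val.
by split => // x; have [] := (fg x, fh x).
Qed.

Lemma Ck_isdx k f : Ck k.+1 f -> forall x, is_derive x e1 f (dx f x).
Proof. by move=> [_ [h _ _ _]] x; exact: derivableP. Qed.
Lemma Ck_isdy k f : Ck k.+1 f -> forall x, is_derive x e2 f (dy f x).
Proof. by move=> [_ [_ h _ _]] x; exact: derivableP. Qed.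
Lemma Ck_dx k f : Ck k.+1 f -> Ck k (dx f). Proof. by move=> [_ []]. Qed.
Lemma Ck_dy k f : Ck k.+1 f -> Ck k (dy f). Proof. by move=> [_ []]. Qed.

Lemma CkS k f : Ck k.+1 f -> Ck k f.
Proof.
elim: k f => [|k IH] f H; first by split=> //; exact: Ck_cont H.
apply: (Ck_intro (Ck_cont H) (Ck_isdx H) (Ck_isdy H)); apply: IH.
  exact: Ck_dx.
exact: Ck_dy.
Qed.

Lemma Ck_cst k (c : R) : Ck k (fun=> c).
Proof.
have cc (d : R) : continuous ((fun=> d) : R * R -> R) by move=> x; exact: cvg_cst.
elim: k c => [|k IH] c; first by split.
by apply: (@Ck_intro _ _ (fun=> 0) (fun=> 0)) => // x; exact: is_derive_cst.
Qed.

Lemma CkD k f g : Ck k f -> Ck k g -> Ck k (fun x => f x + g x).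
Proof.
elim: k f g => [|k IH] f g Hf Hg.
  by split => // x; apply: cvgD; [exact: (Ck_cont Hf)|exact: (Ck_cont Hg)].
apply: (@Ck_intro _ _ (fun x => dx f x + dx g x) (fun x => dy f x + dy g x)).
- by move=> x; apply: cvgD; [exact: (Ck_cont Hf)|exact: (Ck_cont Hg)].
- by move=> x; apply: is_deriveD; [exact: (Ck_isdx Hf)|exact: (Ck_isdx Hg)].
- by move=> x; apply: is_deriveD; [exact: (Ck_isdy Hf)|exact: (Ck_isdy Hg)].
- by apply: IH; exact: Ck_dx.
- by apply: IH; exact: Ck_dy.
Qed.

Lemma is_dM f g x v df dg : is_derive x v f df -> is_derive x v g dg ->
  is_derive x v (fun y => f y * g y) (df * g x + f x * dg).
Proof.
move=> hf hg; apply: (is_derive_eq (is_deriveM hf hg)).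
by rewrite addrC; congr (_ + _); rewrite /GRing.scale /= mulrC.
Qed.

Lemma CkM k f g : Ck k f -> Ck k g -> Ck k (fun x => f x * g x).
Proof.
elim: k f g => [|k IH] f g Hf Hg.
  by split => // x; apply: cvgM; [exact: (Ck_cont Hf)|exact: (Ck_cont Hg)].
apply: (@Ck_intro _ _ (fun x => dx f x * g x + f x * dx g x)
   (fun x => dy f x * g x + f x * dy g x)).
- by move=> x; apply: cvgM; [exact: (Ck_cont Hf)|exact: (Ck_cont Hg)].
- by move=> x; apply: is_dM; [exact: (Ck_isdx Hf)|exact: (Ck_isdx Hg)].
- by move=> x; apply: is_dM; [exact: (Ck_isdy Hf)|exact: (Ck_isdy Hg)].
- by apply: CkD; apply: IH; try exact: CkS; exact: Ck_dx.
- by apply: CkD; apply: IH; try exact: CkS; exact: Ck_dy.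
Qed.

Lemma pxE f : px f = dx f. Proof. by rewrite unlock. Qed.
Lemma pyE f : py f = dy f. Proof. by rewrite unlock. Qed.
Lemma smooth_cont f : smooth f -> continuous f. Proof. by move=> /(_ 0%N) []. Qed.
Lemma smooth_isdx f : smooth f -> forall x, is_derive x e1 f (px f x).
Proof. rewrite ?pxE ?pyE; by move=> /(_ 1%N); exact: Ck_isdx. Qed.
Lemma smooth_isdy f : smooth f -> forall x, is_derive x e2 f (py f x).
Proof. rewrite ?pxE ?pyE; by move=> /(_ 1%N); exact: Ck_isdy. Qed.
Lemma smooth_dx f : smooth f -> smooth (px f).
Proof. rewrite ?pxE ?pyE; by move=> h k; apply: Ck_dx; exact: h. Qed.
Lemma smooth_dy f : smooth f -> smooth (py f).
Proof. rewrite ?pxE ?pyE; by move=> h k; apply: Ck_dy; exact: h. Qed.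
Lemma smooth_cst c : smooth (fun=> c : R). Proof. by move=> k; exact: Ck_cst. Qed.
Lemma smoothD f g : smooth f -> smooth g -> smooth (fun x => f x + g x).
Proof. by move=> hf hg k; exact: CkD. Qed.
Lemma smoothM f g : smooth f -> smooth g -> smooth (fun x => f x * g x).
Proof. by move=> hf hg k; exact: CkM. Qed.
Lemma smoothZ c f : smooth f -> smooth (fun x => c * f x).
Proof. by move=> hf; apply: smoothM => //; exact: smooth_cst. Qed.
Lemma smoothN f : smooth f -> smooth (fun x => - f x).
Proof. by move=> /(smoothZ (-1)); under eq_fun do rewrite mulN1r. Qed.
Lemma smoothB f g : smooth f -> smooth g -> smooth (fun x => f x - g x).
Proof. by move=> hf /smoothN; exact: smoothD. Qed.

Lemma dxE f g : (forall x, is_derive x e1 f (g x)) -> forall x, px f x = g x.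
Proof. rewrite ?pxE ?pyE; by move=> h x; exact: derive_val. Qed.
Lemma dyE f g : (forall x, is_derive x e2 f (g x)) -> forall x, py f x = g x.
Proof. rewrite ?pxE ?pyE; by move=> h x; exact: derive_val. Qed.

Lemma dxD f g : smooth f -> smooth g -> forall x, px (fun x => f x + g x) x = px f x + px g x.
Proof. by move=> hf hg; apply: dxE => x; apply: is_deriveD; exact: smooth_isdx. Qed.
Lemma dyD f g : smooth f -> smooth g -> forall x, py (fun x => f x + g x) x = py f x + py g x.
Proof. by move=> hf hg; apply: dyE => x; apply: is_deriveD; exact: smooth_isdy. Qed.
Lemma dxM f g : smooth f -> smooth g ->
  forall x, px (fun x => f x * g x) x = px f x * g x + f x * px g x.
Proof. by move=> hf hg; apply: dxE => x; apply: is_dM; exact: smooth_isdx. Qed.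
Lemma dyM f g : smooth f -> smooth g ->
  forall x, py (fun x => f x * g x) x = py f x * g x + f x * py g x.
Proof. by move=> hf hg; apply: dyE => x; apply: is_dM; exact: smooth_isdy. Qed.
Lemma dx_cst c x : px (fun=> c : R) x = 0. Proof. rewrite pxE; exact: derive_cst. Qed.
Lemma dy_cst c x : py (fun=> c : R) x = 0. Proof. rewrite pyE; exact: derive_cst. Qed.
Lemma dxZ c f : smooth f -> forall x, px (fun x => c * f x) x = c * px f x.
Proof. by move=> hf x; rewrite (dxM (smooth_cst c) hf) dx_cst mul0r add0r. Qed.
Lemma dyZ c f : smooth f -> forall x, py (fun x => c * f x) x = c * py f x.
Proof. by move=> hf x; rewrite (dyM (smooth_cst c) hf) dy_cst mul0r add0r. Qed.
Lemma dxN f : smooth f -> forall x, px (fun x => - f x) x = - px f x.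
Proof. by move=> hf; apply: dxE => x; apply: is_deriveN; exact: smooth_isdx. Qed.
Lemma dyN f : smooth f -> forall x, py (fun x => - f x) x = - py f x.
Proof. by move=> hf; apply: dyE => x; apply: is_deriveN; exact: smooth_isdy. Qed.
Lemma dxB f g : smooth f -> smooth g -> forall x, px (fun x => f x - g x) x = px f x - px g x.
Proof. by move=> hf hg x; rewrite (dxD hf (smoothN hg)) dxN. Qed.
Lemma dyB f g : smooth f -> smooth g -> forall x, py (fun x => f x - g x) x = py f x - py g x.
Proof. by move=> hf hg x; rewrite (dyD hf (smoothN hg)) dyN. Qed.

Lemma mvt (f df : R -> R) (a b : R) : (forall t : R, is_derive t 1 f (df t)) ->
  exists2 c, `|c - a| <= `|b - a| & f b - f a = df c * (b - a).
Proof.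
move=> h.
have cf A : {within A, continuous f}.
  apply: continuous_subspaceT => t; apply: differentiable_continuous.
  by apply/derivable1_diffP; have [] := h t.
have [ab|ba] := leP a b.
  have [c] := MVT_segment ab (fun t _ => h t) (cf _).
  rewrite in_itv /= => /andP[ac cb] E; exists c => //.
  by rewrite !ger0_norm ?subr_ge0 // lerD2r.
have [c] := MVT_segment (ltW ba) (fun t _ => h t) (cf _).
rewrite in_itv /= => /andP[bc ca] E; exists c.
  by rewrite !ler0_norm ?subr_le0 // ?(ltW ba) // lerN2 lerD2r.
by rewrite -opprB E -mulrN opprB.
Qed.

Lemma is_derive_line f x (v : R * R) (df : R) :
  is_derive x v f df <-> is_derive (0 : R) (1 : R) (fun t : R => f (t *: v + x)) df.
Proof.
have E : (fun h : R => h^-1 *: ((f \o shift x) (h *: v) - f x)) =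
  (fun h : R => h^-1 *: (((fun t : R => f (t *: v + x)) \o shift 0) (h *: (1 : R)) - f (0 *: v + x))).
  by apply/funext => h /=; rewrite addr0 scale0r add0r; congr (_ *: (f (_ *: _ + _) - _)); rewrite /GRing.scale /= mulr1.
split=> -[h1 h2]; split; move: h1 h2; rewrite /derivable /derive E //.
Qed.

Lemma is_derive_line_at f x (v : R * R) (df t : R) :
  is_derive (t *: v + x) v f df <-> is_derive t (1 : R) (fun t : R => f (t *: v + x)) df.
Proof.
rewrite is_derive_line.
have E : (fun h : R => h^-1 *: (((fun t0 : R => f (t0 *: v + (t *: v + x))) \o shift 0) (h *: (1 : R)) - f (0 *: v + (t *: v + x)))) =
  (fun h => h^-1 *: (((fun t0 : R => f (t0 *: v + x)) \o shift t) (h *: (1 : R)) - f (t *: v + x))).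
  by apply/funext => h /=; rewrite addr0 scale0r add0r addrA -scalerDl.
by split=> -[h1 h2]; split; move: h1 h2; rewrite /derivable /derive E //.
Qed.

Lemma isdx1 f x (d : R) : is_derive x e1 f d <-> is_derive (x.1 : R) (1 : R) (fun t : R => f (t, x.2)) d.
Proof.
rewrite -{1}(_ : x.1 *: e1 + (0, x.2) = x); last by rewrite [RHS]surjective_pairing /GRing.scale /GRing.add /=; congr pair; rewrite /= /GRing.scale /=; ring.
rewrite is_derive_line_at; have -> // : (fun t : R => f (t *: e1 + (0, x.2))) = (fun t : R => f (t, x.2)).
by apply/funext => t; congr f; congr pair; rewrite /= /GRing.scale /=; ring.
Qed.

Lemma isdy1 f x (d : R) : is_derive x e2 f d <-> is_derive (x.2 : R) (1 : R) (fun t : R => f (x.1, t)) d.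
Proof.
rewrite -{1}(_ : x.2 *: e2 + (x.1, 0) = x); last by rewrite [RHS]surjective_pairing /GRing.scale /GRing.add /=; congr pair; rewrite /= /GRing.scale /=; ring.
rewrite is_derive_line_at; have -> // : (fun t : R => f (t *: e2 + (x.1, 0))) = (fun t : R => f (x.1, t)).
by apply/funext => t; congr f; congr pair; rewrite /= /GRing.scale /=; ring.
Qed.

(** By the mean value theorem along the two sides of a rectangle with diagonal
    in the direction [v], and continuity of the partial derivatives. *)
Lemma Ck_is_derive f x v : Ck 1 f -> is_derive x v f (v.1 * dx f x + v.2 * dy f x).
Proof.
move=> Cf; suff H : (h : R)^-1 *: ((f \o shift x) (h *: v) - f x) @[h --> 0^'] --> v.1 * dx f x + v.2 * dy f x.
  by split; [apply/cvg_ex; eexists; exact: H|exact: cvg_lim].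
apply/cvgrPdist_le => /= e e0.
have e'0 : 0 < e / (`|v.1| + `|v.2| + 1).
  by rewrite divr_gt0 // ltr_wpDl // addr_ge0.
have cx : continuous (dx f) by exact: Ck_cont (Ck_dx Cf).
have cy : continuous (dy f) by exact: Ck_cont (Ck_dy Cf).
have /cvgrPdist_le/(_ _ e'0)/nbhs_ballP[r1 /= r10 H1] := cx x.
have /cvgrPdist_le/(_ _ e'0)/nbhs_ballP[r2 /= r20 H2] := cy x.
pose r := Num.min r1 r2 / (`|v.1| + `|v.2| + 1).
have r0 : 0 < r by rewrite divr_gt0 ?lt_min ?r10 // ltr_wpDl // addr_ge0.
near=> h.
have h0 : h != 0 by near: h; exact: nbhs_dnbhs_neq.
have hr : `|h| < r by near: h; apply: dnbhs0_lt.
have [c1 c1b E1] := @mvt (fun t => f (t, x.2 + h * v.2)) (fun t => dx f (t, x.2 + h * v.2)) x.1 (x.1 + h * v.1)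
   (fun t => (isdx1 f (t, x.2 + h * v.2) _).1 (Ck_isdx Cf _)).
have [c2 c2b E2] := @mvt (fun t => f (x.1, t)) (fun t => dy f (x.1, t)) x.2 (x.2 + h * v.2)
   (fun t => (isdy1 f (x.1, t) _).1 (Ck_isdy Cf _)).
have hv1 : `|h * v.1| < Num.min r1 r2.
  rewrite normrM; move: hr; rewrite /r ltr_pdivlMr; last by rewrite ltr_wpDl // addr_ge0.
  apply: le_lt_trans; rewrite ler_wpM2l //; have := normr_ge0 v.2; lra.
have hv2 : `|h * v.2| < Num.min r1 r2.
  rewrite normrM; move: hr; rewrite /r ltr_pdivlMr; last by rewrite ltr_wpDl // addr_ge0.
  apply: le_lt_trans; rewrite ler_wpM2l //; have := normr_ge0 v.1; lra.
have B1 : `|dx f x - dx f (c1, x.2 + h * v.2)| <= e / (`|v.1| + `|v.2| + 1).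
  apply: H1; rewrite /ball /= /prod_ball /=; rewrite /ball /= distrC; split.
    by rewrite (le_lt_trans c1b) // addrAC subrr add0r (lt_le_trans hv1) // ge_min lexx.
  by rewrite opprD addrA subrr sub0r normrN (lt_le_trans hv2) // ge_min lexx.
have B2 : `|dy f x - dy f (x.1, c2)| <= e / (`|v.1| + `|v.2| + 1).
  apply: H2; rewrite /ball /= /prod_ball /=; rewrite /ball /=; split; first by rewrite subrr normr0.
  by rewrite distrC (le_lt_trans c2b) // addrAC subrr add0r (lt_le_trans hv2) // ge_min lexx orbT.
have -> : v.1 * dx f x + v.2 * dy f x - h^-1 *: ((f \o shift x) (h *: v) - f x) =
   v.1 * (dx f x - dx f (c1, x.2 + h * v.2)) + v.2 * (dy f x - dy f (x.1, c2)).
  have -> : (f \o shift x) (h *: v) = f (x.1 + h * v.1, x.2 + h * v.2).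
    by rewrite /= ; congr f; rewrite [LHS]addrC.
  have -> : f (x.1 + h * v.1, x.2 + h * v.2) - f x =
     (f (x.1 + h * v.1, x.2 + h * v.2) - f (x.1, x.2 + h * v.2)) + (f (x.1, x.2 + h * v.2) - f (x.1, x.2)).
    by rewrite -surjective_pairing; ring.
  by rewrite E1 E2 /GRing.scale /=; field.
rewrite (le_trans (ler_normD _ _)) // !normrM.
apply: (@le_trans _ _ ((`|v.1| + `|v.2|) * (e / (`|v.1| + `|v.2| + 1)))).
  by rewrite mulrDl lerD // ler_wpM2l.
rewrite mulrCA ger_pMr // ler_pdivrMr; last by rewrite ltr_wpDl // addr_ge0.
by rewrite mul1r lerDl.
Unshelve. all: by end_near.
Qed.

Section AffineChainRule.
Variables (p : R * R) (a b c d : R).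
Local Notation T := (aff p a b c d).

Lemma continuous_aff : continuous (T : R * R -> R * R).
Proof.
move=> x.
have H1 : (p.1 + a * y.1 + b * y.2) @[y --> x] --> p.1 + a * x.1 + b * x.2.
  by apply: cvgD; [apply: cvgD; [exact: cvg_cst|apply: cvgM; [exact: cvg_cst|exact: cvg_fst]]|apply: cvgM; [exact: cvg_cst|exact: cvg_snd]].
have H2 : (p.2 + c * y.1 + d * y.2) @[y --> x] --> p.2 + c * x.1 + d * x.2.
  by apply: cvgD; [apply: cvgD; [exact: cvg_cst|apply: cvgM; [exact: cvg_cst|exact: cvg_fst]]|apply: cvgM; [exact: cvg_cst|exact: cvg_snd]].
exact: cvg_pair H1 H2.
Qed.

Lemma is_dx_aff f x : Ck 1 f -> is_derive x e1 (f \o T) (a * dx f (T x) + c * dy f (T x)).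
Proof.
move=> Cf; apply/is_derive_line; have /is_derive_line := Ck_is_derive (T x) (a, c) Cf.
have -> // : (fun t => (f \o T) (t *: e1 + x)) = (fun t => f (t *: (a, c) + T x)).
by apply/funext => t /=; congr f; rewrite /aff /=; congr pair; rewrite /= /GRing.scale /=; ring.
Qed.
Lemma is_dy_aff f x : Ck 1 f -> is_derive x e2 (f \o T) (b * dx f (T x) + d * dy f (T x)).
Proof.
move=> Cf; apply/is_derive_line; have /is_derive_line := Ck_is_derive (T x) (b, d) Cf.
have -> // : (fun t => (f \o T) (t *: e2 + x)) = (fun t => f (t *: (b, d) + T x)).
by apply/funext => t /=; congr f; rewrite /aff /=; congr pair; rewrite /= /GRing.scale /=; ring.
Qed.

Lemma Ck1S k f : Ck k.+1 f -> Ck 1 f.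
Proof. by elim: k => // k IH /CkS /IH. Qed.

Lemma Ck_aff k f : Ck k f -> Ck k (fun x => f (T x)).
Proof.
have cc f' : continuous f' -> continuous (fun x => f' (T x)).
  by move=> cf x; apply: (@continuous_comp _ _ _ T f'); [exact: continuous_aff|exact: cf].
elim: k f => [|k IH] f H; first by split => //; apply: cc; exact: Ck_cont H.
apply: (@Ck_intro _ _ (fun x => a * dx f (T x) + c * dy f (T x)) (fun x => b * dx f (T x) + d * dy f (T x))).
- by apply: cc; exact: Ck_cont H.
- by move=> x; apply: is_dx_aff; exact: Ck1S H.
- by move=> x; apply: is_dy_aff; exact: Ck1S H.
- by apply: CkD; (apply: CkM; first exact: Ck_cst); apply: IH; [exact: Ck_dx|exact: Ck_dy].
- by apply: CkD; (apply: CkM; first exact: Ck_cst); apply: IH; [exact: Ck_dx|exact: Ck_dy].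
Qed.

Lemma smooth_aff f : smooth f -> smooth (fun x => f (T x)).
Proof. by move=> h k; exact: Ck_aff. Qed.
Lemma dx_aff f x : smooth f -> px (fun x => f (T x)) x = a * px f (T x) + c * py f (T x).
Proof. by move=> h; apply: (dxE (g := fun x => a * px f (T x) + c * py f (T x))) => y; rewrite pxE pyE; apply: is_dx_aff. Qed.
Lemma dy_aff f x : smooth f -> py (fun x => f (T x)) x = b * px f (T x) + d * py f (T x).
Proof. by move=> h; apply: (dyE (g := fun x => b * px f (T x) + d * py f (T x))) => y; rewrite pxE pyE; apply: is_dy_aff. Qed.
End AffineChainRule.

End Calculus.

Section Bumps.
Context {R : realType}.
Implicit Types (f g : R * R -> R) (x : R * R).
Local Notation e1 := ((1, 0) : R * R).
Local Notation e2 := ((0, 1) : R * R).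
Local Notation RR := (measurableTypeR R * measurableTypeR R)%type.

Lemma ball2P x (r : R) y : ball x r y <-> `|x.1 - y.1| < r /\ `|x.2 - y.2| < r.
Proof. by []. Qed.

(** Used for the symmetry of second derivatives, whose two sides are only
    compared at nearby points. *)
Lemma continuous_eq_near f g x : continuous f -> continuous g ->
  (forall h : R, 0 < h -> exists p q, [/\ f p = g q, ball x h p & ball x h q]) -> f x = g x.
Proof.
move=> cf cg H; apply/eqP; rewrite -subr_eq0 -normr_le0; apply/ler_addgt0Pr => e e0; rewrite add0r.
have e20 : 0 < e / 2 by rewrite divr_gt0.
have /cvgrPdist_le/(_ _ e20)/nbhs_ballP[r1 /= r10 H1] := cf x.
have /cvgrPdist_le/(_ _ e20)/nbhs_ballP[r2 /= r20 H2] := cg x.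
have [|p [q [pq px qx]]] := H (Num.min r1 r2); first by rewrite lt_min r10.
rewrite (_ : _ - _ = (f x - f p) - (g x - g q)); last by rewrite pq; ring.
rewrite (le_trans (ler_normB _ _)) // [e]splitr lerD //.
  by apply: H1; apply: le_ball px; rewrite ge_min lexx.
by apply: H2; apply: le_ball qx; rewrite ge_min lexx orbT.
Qed.

(** The second difference of [f] over a small square is, by the mean value
    theorem applied twice, a value of either mixed derivative in this square. *)
Lemma schwarz f : smooth f -> forall x, px (py f) x = py (px f) x.
Proof.
move=> sf x; apply: continuous_eq_near.
- exact/smooth_cont/smooth_dx/smooth_dy.
- exact/smooth_cont/smooth_dy/smooth_dx.
move=> h0 h00; pose h := h0 / 2.
have h_gt0 : 0 < h by rewrite divr_gt0.
have hh0 : h < h0 by rewrite ltr_pdivrMr // ltr_pMr // ltr1n.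
pose D := (f (x.1 + h, x.2 + h) - f (x.1 + h, x.2)) - (f (x.1, x.2 + h) - f (x.1, x.2)).
have [p [P1 P2]] : exists p : R * R, py (px f) p = D / h / h /\ (`|p.1 - x.1| <= h /\ `|p.2 - x.2| <= h).
  have [s sb E1] := @mvt R (fun t => f (t, x.2 + h) - f (t, x.2))
    (fun t => px f (t, x.2 + h) - px f (t, x.2)) x.1 (x.1 + h)
    (fun t => is_deriveB ((isdx1 f (t, x.2 + h) _).1 (smooth_isdx sf _)) ((isdx1 f (t, x.2) _).1 (smooth_isdx sf _))).
  have [s' sb' E2] := @mvt R (fun t => px f (s, t)) (fun t => py (px f) (s, t)) x.2 (x.2 + h)
    (fun t => (isdy1 (px f) (s, t) _).1 (smooth_isdy (smooth_dx sf) _)).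
  exists (s, s'); split; last by move: sb sb'; rewrite ![_ + h]addrC !addrK (gtr0_norm h_gt0).
  have -> : D = py (px f) (s, s') * h * h.
    rewrite /D; move: E1; rewrite E2 ![_ + h]addrC !addrK => <-; ring.
  by rewrite !mulfK // gt_eqF.
have [q [Q1 Q2]] : exists p : R * R, px (py f) p = D / h / h /\ (`|p.1 - x.1| <= h /\ `|p.2 - x.2| <= h).
  have [s sb E1] := @mvt R (fun t => f (x.1 + h, t) - f (x.1, t))
    (fun t => py f (x.1 + h, t) - py f (x.1, t)) x.2 (x.2 + h)
    (fun t => is_deriveB ((isdy1 f (x.1 + h, t) _).1 (smooth_isdy sf _)) ((isdy1 f (x.1, t) _).1 (smooth_isdy sf _))).
  have [s' sb' E2] := @mvt R (fun t => py f (t, s)) (fun t => px (py f) (t, s)) x.1 (x.1 + h)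
    (fun t => (isdx1 (py f) (t, s) _).1 (smooth_isdx (smooth_dy sf) _)).
  exists (s', s); split; last by move: sb sb'; rewrite ![_ + h]addrC !addrK (gtr0_norm h_gt0).
  have -> : D = px (py f) (s', s) * h * h.
    rewrite /D; move: E1; rewrite E2 ![_ + h]addrC !addrK => <-; ring.
  by rewrite !mulfK // gt_eqF.
exists q, p; split; first by rewrite Q1 P1.
  by apply/ball2P; case: Q2 => q1 q2; split; rewrite distrC; exact: le_lt_trans hh0.
by apply/ball2P; case: P2 => q1 q2; split; rewrite distrC; exact: le_lt_trans hh0.
Qed.

(** [van f x]: the point [x] is not in the support of [f]. *)
Definition van f x := \forall y \near x, f y = 0.

Lemma van_at f x : van f x -> f x = 0.
Proof. exact: nbhs_singleton. Qed.

Lemma van_der f x v : van f x -> \forall y \near x, 'D_v f y = 0.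
Proof.
move=> /nbhs_interior; apply: filterS => y fy.
have [->|v0] := eqVneq v 0; first by rewrite derive0.
rewrite -[RHS](derive_cst (0 : R) y v); apply: near_eq_derive => //.
Qed.
Lemma van_dx f x : van f x -> van (px f) x.
Proof. by rewrite pxE; exact: van_der. Qed.
Lemma van_dy f x : van f x -> van (py f) x.
Proof. by rewrite pyE; exact: van_der. Qed.
Lemma vanMr f g x : van g x -> van (fun x => f x * g x) x.
Proof. by apply: filterS => y ->; rewrite mulr0. Qed.
Lemma vanD f g x : van f x -> van g x -> van (fun x => f x + g x) x.
Proof. by apply: filterS2 => y -> ->; rewrite addr0. Qed.

Lemma bsupp_van f : bsupp f <-> exists M, forall x, M < `|x| -> van f x.
Proof.
split=> -[M H]; exists M => x Mx; last exact/van_at/H.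
have : \forall y \near x, M < `|y|.
  have : (fun y : R * R => `|y|) y @[y --> x] --> `|x| by apply: cvg_norm; exact: cvg_id.
  by move/cvgr_gt; apply.
by apply: filterS => y; exact: H.
Qed.

(** Test functions, with the support condition in pointwise form. *)
Definition tfB (B : set (R * R)) f := [/\ smooth f, bsupp f & forall x, ~ B x -> van f x].

Lemma tfB_test B f : tfB B f -> test_function B f.
Proof.
move=> [sf [M hM] vB]; split => //.
  apply: (@subclosed_compact _ _ (`[-M, M] `*` `[-M, M])).
  - exact: closed_closure.
  - by apply: compact_setX; exact: segment_compact.
  - have cl : closed (`[-M, M] `*` `[-M, M] : set (R * R)).
      by apply: compact_closed; [exact: norm_hausdorff|apply: compact_setX; exact: segment_compact].
    rewrite closure_id in cl; rewrite cl; apply: closure_subset => x /= fx.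
    have : `|x| <= M by rewrite leNgt; apply/negP => /hM /eqP; rewrite (negbTE fx).
    by rewrite prod_normE ge_max !ler_norml => /andP[h1 h2]; split; rewrite /= in_itv.
move=> x cx; apply: contrapT => /vB vx.
by have [y [/= /eqP]] := cx _ vx.
Qed.

Lemma test_tfB B f : test_function B f -> tfB B f.
Proof.
move=> [sf cf clB]; split => //.
  have /compact_bounded[M [Mr HM]] := cf.
  exists (M + 1) => x Mx; apply: contrapT => /eqP fx.
  have cx : closure [set x | f x != 0] x by apply: subset_closure.
  have M1 : M < M + 1 by rewrite ltrDl.
  by have := HM _ M1 x cx; rewrite /= leNgt Mx.
move=> x Bx; have : ~ closure [set x | f x != 0] x by move/clB.
rewrite /closure /= => /existsNP[A] /not_implyP[nA].
move=> /set0P/negP/negPn/eqP E; apply: filterS nA => y Ay.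
apply: contrapT => /eqP fy; have : ([set x | f x != 0] `&` A) y by [].
by rewrite E.
Qed.

Definition tf := tfB setT.
Lemma tfE f : smooth f -> bsupp f -> tf f. Proof. by move=> sf bf; split => // x []. Qed.
Lemma tfB_tf B f : tfB B f -> tf f. Proof. by case=> sf bf _; apply: tfE. Qed.
Lemma tfBS (A B : set (R * R)) f : A `<=` B -> tfB A f -> tfB B f.
Proof. by move=> AB [sf bf vf]; split => // x Bx; apply: vf => /AB. Qed.
Lemma tfB_smooth B f : tfB B f -> smooth f. Proof. by case. Qed.
Lemma tfB_out B f x : tfB B f -> ~ B x -> f x = 0.
Proof. by move=> [_ _ h] /h /van_at. Qed.

Lemma tfBD B f g : tfB B f -> tfB B g -> tfB B (fun x => f x + g x).
Proof.
move=> [sf bf vf] [sg bg vg]; split; first exact: smoothD.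
  by apply: (bsuppU bf bg) => x -> ->; rewrite addr0.
by move=> x Bx; apply: vanD; [exact: vf|exact: vg].
Qed.
Lemma tfBMl B f g : smooth f -> tfB B g -> tfB B (fun x => f x * g x).
Proof.
move=> sf [sg bg vg]; split; first exact: smoothM.
  by apply: (bsupp_le bg) => x ->; rewrite mulr0.
by move=> x Bx; apply: vanMr; exact: vg.
Qed.
Lemma tfBMr B f g : tfB B f -> smooth g -> tfB B (fun x => f x * g x).
Proof. by move=> hf sg; under eq_fun do rewrite mulrC; exact: tfBMl. Qed.
Lemma tfBZ B c f : tfB B f -> tfB B (fun x => c * f x).
Proof. by apply: tfBMl; exact: smooth_cst. Qed.
Lemma tfBN B f : tfB B f -> tfB B (fun x => - f x).
Proof. by move=> /(tfBZ (-1)); under eq_fun do rewrite mulN1r. Qed.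
Lemma tfBB B f g : tfB B f -> tfB B g -> tfB B (fun x => f x - g x).
Proof. by move=> hf /tfBN; exact: tfBD. Qed.
Lemma tfB_dx B f : tfB B f -> tfB B (px f).
Proof.
move=> [sf /bsupp_van[M bf] vf]; split; first exact: smooth_dx.
  by apply/bsupp_van; exists M => x /bf /van_dx.
by move=> x /vf /van_dx.
Qed.
Lemma tfB_dy B f : tfB B f -> tfB B (py f).
Proof.
move=> [sf /bsupp_van[M bf] vf]; split; first exact: smooth_dy.
  by apply/bsupp_van; exists M => x /bf /van_dy.
by move=> x /vf /van_dy.
Qed.
Lemma tfB_aff p a b c d (A B : set (R * R)) f : `|a * d - b * c| = 1 ->
  (forall x, B (aff p a b c d x) -> A x) -> tfB B f -> tfB A (fun x => f (aff p a b c d x)).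
Proof.
move=> D AB [sf [M bf] vf]; split; first exact: smooth_aff.
  by have [N hN] := aff_bounded p D M; exists N => x /hN /bf.
move=> x Ax; have : ~ B (aff p a b c d x) by move/AB.
move=> /vf; rewrite /van; exact: (@continuous_aff R p a b c d x).
Qed.

(** An open set is the union of the squares with rational centre that it
    contains; measurability is relative to the product of the Borel sigma-algebras. *)
Lemma open2_measurable (U : set (R * R)) : open U -> measurable (U : set RR).
Proof.
move=> oU.
pose bx (i : rat * rat * nat) : set RR :=
  ball (ratr i.1.1 : R) i.2.+1%:R^-1 `*` ball (ratr i.1.2 : R) i.2.+1%:R^-1.
have -> : U = \bigcup_(i in [set i | bx i `<=` U]) bx i.
  apply/seteqP; split=> [x Ux|x [i iU xi]]; last exact: iU.
  have /nbhs_ballP[r /= r0 rU] : nbhs x U by exact: open_nbhs_nbhs.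
  have r20 : 0 < r / 2 by rewrite divr_gt0.
  have [n _ /(_ n (leqnn n)) /= nr] := near_infty_natSinv_lt (PosNum r20).
  have n0 : 0 < n.+1%:R^-1 :> R by rewrite invr_gt0.
  have [q1] := @rat_in_itvoo R x.1 (x.1 + n.+1%:R^-1) ltac:(by rewrite ltrDl).
  have [q2] := @rat_in_itvoo R x.2 (x.2 + n.+1%:R^-1) ltac:(by rewrite ltrDl).
  rewrite !in_itv /= => /andP[a1 a2] /andP[b1 b2].
  exists (q1, q2, n); last first.
    by rewrite /bx /=; move: a1 a2 b1 b2; set t := _^-1 => *; split; rewrite /ball /= ger0_norm; lra.
  move=> y [y1 y2]; apply: rU; apply/ball2P; move: y1 y2 nr a1 a2 b1 b2; rewrite /ball /=.
  set t := _^-1 => y1 y2 nr a1 a2 b1 b2; split.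
    rewrite (_ : x.1 - y.1 = (x.1 - ratr q1) + (ratr q1 - y.1)); last by ring.
    by rewrite (le_lt_trans (ler_normD _ _)) // [r]splitr ltrD // ?(lt_trans y1) // ltr0_norm; lra.
  rewrite (_ : x.2 - y.2 = (x.2 - ratr q2) + (ratr q2 - y.2)); last by ring.
  by rewrite (le_lt_trans (ler_normD _ _)) // [r]splitr ltrD // ?(lt_trans y2) // ltr0_norm; lra.
rewrite bigcup_mkcond; apply: countable_bigcupT_measurable => // i.
case: ifPn => // _; apply: measurableX; exact: measurable_ball.
Qed.

Lemma mf_cont f : continuous f -> mf f.
Proof.
move=> cf; apply: (measurability _ (RGenOpens.measurableE R)).
move=> _ [_ [a [b ->] <-]]; rewrite setTI; apply: open2_measurable.
by apply: open_comp => //; exact: interval_open.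
Qed.
End Bumps.

(** * Mollifiers *)
Section Kernel.
Context {R : realType}.
Implicit Types (f g : R * R -> R) (x : R * R).
Local Notation e1 := ((1, 0) : R * R).
Local Notation e2 := ((0, 1) : R * R).

Lemma cont_bsupp_bounded f : continuous f -> bsupp f -> exists K, forall x, `|f x| <= K.
Proof.
move=> cf [M hM].
have : compact (f @` (`[-M, M] `*` `[-M, M])).
  apply: continuous_compact; last by apply: compact_setX; exact: segment_compact.
  exact: continuous_subspaceT.
move=> /compact_bounded[K [Kr HK]]; exists (Num.max 0 (K + 1)) => x.
have [Mx|xM] := ltP M `|x|; first by rewrite hM // normr0 le_max lexx.
rewrite le_max; apply/orP; right; apply: (HK (K + 1)); first by rewrite ltrDl.
exists x => //; move: xM; rewrite prod_normE ge_max !ler_norml => /andP[h1 h2].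
by split; rewrite /= in_itv.
Qed.

Lemma bL2_tf f : tf f -> bL2 f.
Proof.
move=> [sf bf _]; apply: bL2_bounded => //; first by apply: mf_cont; exact: smooth_cont.
by apply: cont_bsupp_bounded => //; exact: smooth_cont.
Qed.

Lemma bm_tf f : tf f -> bm f.
Proof.
move=> [sf bf _]; split; first by apply: mf_cont; exact: smooth_cont.
by apply: cont_bsupp_bounded => //; exact: smooth_cont.
Qed.

Lemma is_dM1 (u v : R -> R) (t du dv : R) : is_derive t (1 : R) u du -> is_derive t (1 : R) v dv ->
  is_derive t (1 : R) (fun y => u y * v y) (du * v t + u t * dv).
Proof.
move=> hf hg; apply: (is_derive_eq (is_deriveM hf hg)).
by rewrite addrC; congr (_ + _); rewrite /GRing.scale /= mulrC.
Qed.

(** The functions t^-j exp(-1/t), extended by 0 to t <= 0: their derivatives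
    are combinations of functions of the same family. *)
Definition flat (j : nat) (t : R) : R := if 0 < t then t^-1 ^+ j * expR (- t^-1) else 0.

Lemma flat_ge0 j t : 0 <= flat j t.
Proof.
rewrite /flat; case: ifPn => // t0; apply: mulr_ge0; [apply: exprn_ge0; by rewrite invr_ge0 ltW|exact: expR_ge0].
Qed.

(** By the power series of the exponential; this gives differentiability at 0. *)
Lemma flat_le j t : flat j t <= (j.+2)`!%:R * t ^+ 2.
Proof.
rewrite /flat; case: ifPn => [t0|_]; last by rewrite mulr_ge0 ?sqr_ge0.
have ti : 0 < t^-1 by rewrite invr_gt0.
have := @expR_ge1Dxn R t^-1 j.+1 (ltW ti).
set F : R := (j.+2)`!%:R; have F0 : 0 < F by rewrite ltr0n fact_gt0.
move=> H; have : t^-1 ^+ j.+2 / F <= expR t^-1 by apply: le_trans H; rewrite lerDr.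
rewrite ler_pdivrMr // => H2.
have -> : t^-1 ^+ j * expR (- t^-1) = t^-1 ^+ j.+2 * (t ^+ 2 * expR (- t^-1)).
  by rewrite -addn2 exprD; field; rewrite gt_eqF.
have -> : F * t ^+ 2 = (expR t^-1 * F) * (t ^+ 2 * expR (- t^-1)).
  by rewrite [expR t^-1 * F]mulrC mulrA -[LHS]mulr1 -(expRxMexpNx_1 t^-1); ring.
by rewrite ler_wpM2r // mulr_ge0 ?sqr_ge0 ?expR_ge0.
Qed.

Lemma is_derive_flat j (t : R) : is_derive t (1 : R) (flat j) (- j%:R * flat j.+1 t + flat j.+2 t).
Proof.
have [t0|t0|->] := ltrgtP t 0.
- have E : \forall s \near t, cst 0 s = flat j s.
    by near=> s; rewrite /flat ifF //; apply/negbTE; rewrite -leNgt ltW //; near: s; exact: lt_nbhsl.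
  rewrite /flat ltNge (ltW t0) /= mulr0 addr0.
  by apply: (near_eq_is_derive E); exact: is_derive_cst.
- have E : \forall s \near t, (fun s => s^-1 ^+ j * expR (- s^-1)) s = flat j s.
    by near=> s; rewrite /flat ifT //; near: s; exact: lt_nbhsr.
  apply: (near_eq_is_derive E).
  have tn : t != 0 by rewrite gt_eqF.
  have dV : is_derive t (1 : R) (fun s : R => s^-1) (- t ^- 2).
    apply: (is_derive_eq (@is_deriveV R id t 1 1 tn (is_derive_id _ _))).
    by rewrite /GRing.scale /= mulr1.
  have dX : is_derive t (1 : R) (fun s : R => s^-1 ^+ j) (j%:R * t^-1 ^+ j.-1 * - t ^- 2).
    by have := @is_deriveX R _ (fun s : R => s^-1) j t 1 _ dV; rewrite exprfctE.
  have dE : is_derive t (1 : R) (fun s : R => expR (- s^-1)) (expR (- t^-1) * t ^- 2).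
    apply: (is_derive_eq (@is_derive1_comp R expR (fun s : R => - s^-1) t _ _ (is_derive_expR _) (is_deriveN dV))).
    by rewrite opprK.
  apply: (is_derive_eq (is_dM1 dX dE)).
  rewrite /flat t0 /GRing.scale /=; case: j {E dX} => [|j].
    by rewrite /=; field.
  by rewrite /= !exprS; set q := t^-1 ^+ j; field.
- have f0 k : flat k 0 = 0 by rewrite /flat ltxx.
  rewrite !f0 mulr0 addr0.
  suff H : (h : R)^-1 *: ((flat j \o shift 0) (h *: (1 : R)) - flat j 0) @[h --> 0^'] --> (0 : R).
    by split; [apply/cvg_ex; eexists; exact: H|exact: cvg_lim].
  apply/cvgrPdist_le => /= e e0; set C : R := (j.+2)`!%:R.
  have C0 : 0 < C by rewrite ltr0n fact_gt0.
  near=> h.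
  have h0 : h != 0 by near: h; exact: nbhs_dnbhs_neq.
  have he : `|h| < e / C by near: h; apply: dnbhs0_lt; rewrite divr_gt0.
  rewrite f0 subr0 addr0 sub0r normrN /GRing.scale /= mulr1 normrM normfV.
  rewrite ler_pdivrMl ?normr_gt0 // ger0_norm ?flat_ge0 // (le_trans (flat_le _ _)) // -/C.
  rewrite -(real_normK (num_real h)) expr2 mulrA mulrC ler_wpM2l //.
  by rewrite mulrC -ler_pdivlMr // ltW.
Unshelve. all: by end_near.
Qed.

Lemma continuous_flat j : continuous (flat j).
Proof.
move=> t; apply: differentiable_continuous; apply/derivable1_diffP.
by have [] := is_derive_flat j t.
Qed.

Lemma Ck_flat1 k j (c s : R) : Ck k (fun x => flat j (c + s * x.1)).
Proof.
have cc i : continuous (fun x : R * R => flat i (c + s * x.1)).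
  move=> x; apply: (@continuous_comp _ _ _ (fun x : R * R => c + s * x.1) (flat i)); last exact: continuous_flat.
  by apply: cvgD; [exact: cvg_cst|apply: cvgM; [exact: cvg_cst|exact: cvg_fst]].
elim: k j => [|k IH] j; first by split.
apply: (@Ck_intro _ _ _ (fun x => s * (- j%:R * flat j.+1 (c + s * x.1) + flat j.+2 (c + s * x.1))) (fun=> 0)) => //.
- move=> x; apply/isdx1 => /=.
  have dA : is_derive x.1 (1 : R) (fun t : R => c + s * t) s.
    have := @is_deriveD R _ _ (cst c) (fun t : R => s *: t) x.1 1 _ _ (is_derive_cst _ _ _) (is_deriveZ _ (is_derive_id _ _)).
    by rewrite add0r /GRing.scale /= mulr1.
  apply: (is_derive_eq (@is_derive1_comp R (flat j) (fun t : R => c + s * t) x.1 _ _ (is_derive_flat _ _) dA)).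
  by rewrite mulrC.
- by move=> x; apply/isdy1 => /=; exact: is_derive_cst.
- apply: CkM; first exact: Ck_cst.
  by apply: CkD => //; apply: CkM => //; exact: Ck_cst.
- exact: Ck_cst.
Qed.

(** Positive exactly on the open square of half-width [r] centred at 0. *)
Definition bump0 (r : R) x := (flat 0 (r + x.1) * flat 0 (r - x.1)) * (flat 0 (r + x.2) * flat 0 (r - x.2)).

Lemma smooth_bump0 r : smooth (bump0 r).
Proof.
have E (s : R) : smooth (fun x : R * R => flat 0 (r + s * x.1)) by move=> k; exact: Ck_flat1.
have E1 : smooth (fun x : R * R => flat 0 (r + x.1)).
  by under eq_fun do rewrite -[_.1]mul1r; exact: E.
have E2 : smooth (fun x : R * R => flat 0 (r - x.1)).
  by under eq_fun do rewrite -[X in _ - X]mul1r -mulNr; exact: E.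
have S f : smooth f -> smooth (fun x => f (x.2, x.1)).
  move=> /(smooth_aff (0,0) 0 1 1 0); rewrite /aff /=.
  by under eq_fun do rewrite !mul0r !mul1r !add0r addr0.
apply: smoothM; first exact: smoothM.
by apply: smoothM; [exact: (S _ E1)|exact: (S _ E2)].
Qed.

Lemma bump0_ge0 r x : 0 <= bump0 r x.
Proof. by rewrite !mulr_ge0 // flat_ge0. Qed.

Lemma bump0_out r x : r <= `|x| -> bump0 r x = 0.
Proof.
have f0 (t : R) : t <= 0 -> flat 0 t = 0 by move=> t0; rewrite /flat ltNge t0.
rewrite prod_normE le_max !ler_normr /bump0 => /orP[] /orP[] h.
- by rewrite (f0 (r - x.1)) ?(mulr0, mul0r) // subr_le0.
- by rewrite (f0 (r + x.1)) ?(mulr0, mul0r) // -lerBrDr sub0r.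
- by rewrite (f0 (r - x.2)) ?(mulr0, mul0r) // subr_le0.
- by rewrite (f0 (r + x.2)) ?(mulr0, mul0r) // -lerBrDr sub0r.
Qed.

Lemma tf_bump0 r : tf (bump0 r).
Proof. by apply: tfE; [exact: smooth_bump0|exists r => x /ltW /bump0_out]. Qed.

(** On the square of half the size, the bump function is bounded below. *)
Lemma I_bump0 r : 0 < r -> 0 < I (bump0 r).
Proof.
move=> r0; pose s := r / 2; have s0 : 0 < s by rewrite divr_gt0.
pose c := flat 0 s; have c0 : 0 < c by rewrite /c /flat s0 expr0 mul1r expR_gt0.
have fc (t : R) : s <= t -> c <= flat 0 t.
  move=> st; have t0 := lt_le_trans s0 st.
  by rewrite /c /flat s0 t0 !expr0 !mul1r ler_expR lerN2 lef_pV2.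
apply: (@lt_le_trans _ _ (I (fun x => c ^+ 4 * \1_(`[-s, s] `*` `[-s, s] : set (R * R)) x))).
  rewrite IZ; last exact: itg_box.
  rewrite mulr_gt0 ?exprn_gt0 // -lte_fin IE; last exact: itg_box.
  rewrite integral_indic ?setIT //; last exact: measurableX.
  rewrite mu_setX // lebesgue_measure_itv /= lte_fin ifT; last by lra.
  by rewrite -EFinM lte_fin mulr_gt0; lra.
apply: le_I; [exact/itgZ/itg_box|exact/bL2_itg/bL2_tf/tf_bump0|] => x.
rewrite indicE; case: (boolP (_ \in _)) => [|_]; last by rewrite mulr0 bump0_ge0.
rewrite inE => -[/= + +]; rewrite !in_itv /= mulr1 => /andP[a1 a2] /andP[b1 b2].
rewrite (_ : c ^+ 4 = (c * c) * (c * c)); last by ring.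
have rs : r = s + s by rewrite /s -splitr.
have h1 : c <= flat 0 (r + x.1) by apply: fc; rewrite rs; lra.
have h2 : c <= flat 0 (r - x.1) by apply: fc; rewrite rs; lra.
have h3 : c <= flat 0 (r + x.2) by apply: fc; rewrite rs; lra.
have h4 : c <= flat 0 (r - x.2) by apply: fc; rewrite rs; lra.
by rewrite /bump0 !ler_pM ?mulr_ge0 // ltW.
Qed.

Definition mol (r : R) x := (I (bump0 r))^-1 * bump0 r x.

Lemma mol_ge0 r x : 0 <= mol r x.
Proof. by rewrite mulr_ge0 ?bump0_ge0 // invr_ge0 I_ge0 // => y; exact: bump0_ge0. Qed.
Lemma mol_out r x : r <= `|x| -> mol r x = 0.
Proof. by move=> h; rewrite /mol bump0_out // mulr0. Qed.
Lemma tf_mol r : tf (mol r). Proof. exact/tfBZ/tf_bump0. Qed.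
Lemma I_mol r : 0 < r -> I (mol r) = 1.
Proof.
move=> r0; rewrite IZ; last exact/bL2_itg/bL2_tf/tf_bump0.
by rewrite mulVf // gt_eqF // I_bump0.
Qed.
Lemma mol_even r x : mol r (- x) = mol r x.
Proof. by rewrite /mol /bump0 /= !opprK; congr (_ * _); ring. Qed.
End Kernel.

(** * Integration by parts *)
Section Divergence.
Context {R : realType}.
Implicit Types (f g F H : R * R -> R) (x : R * R).
Local Notation leb := (@lebesgue_measure R).
Local Notation RR := (measurableTypeR R * measurableTypeR R)%type.
Local Notation mu := (lebesgue2 R).

Definition ind (A : set (R * R)) (x : R * R) : R := (\1_A : R * R -> R) x.
Lemma ind1 (A : set (R * R)) x : A x -> ind A x = 1.
Proof. by move=> Ax; rewrite /ind indicE mem_set. Qed.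
Lemma ind0 (A : set (R * R)) x : ~ A x -> ind A x = 0.
Proof. by move=> Ax; rewrite /ind indicE memNset. Qed.
Lemma bm_ind (A : set RR) : measurable A -> bm (ind A).
Proof. exact: bm_indic. Qed.

Lemma continuous_line1 f (t : R) : continuous f -> continuous (fun s : R => f (s, t)).
Proof.
move=> cf s; apply: (@continuous_comp _ _ _ (fun s : R => (s, t)) f); last exact: cf.
exact: cvg_pair (@cvg_id _ (nbhs s)) (cvg_cst t).
Qed.

Definition J (a b : R) (g : R -> R) : R := \int[leb]_(t in `]a, b[) g t.

Lemma bL2_box f (a b c d : R) : continuous f -> bL2 (fun x => ind (`]a, b[ `*` `]c, d[) x * f x).
Proof.
move=> cdx; pose B : set RR := `]a, b[ `*` `]c, d[.
have mB : measurable B by exact: measurableX.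
have [K hK] : exists K, forall x, B x -> `|f x| <= K.
  have : compact (f @` (`[a, b] `*` `[c, d])).
    apply: continuous_compact; last by apply: compact_setX; exact: segment_compact.
    exact: continuous_subspaceT.
  move=> /compact_bounded[K [Kr HK]]; exists (K + 1) => x [/= x1 x2].
  apply: (HK (K + 1)); first by rewrite ltrDl.
  by exists x => //; split; apply: subset_itv_oo_cc.
apply: bL2_bounded.
- by apply: mfM; [exact: (bm_ind mB).1|exact: mf_cont].
- exists (`|a| + `|b| + `|c| + `|d|) => x Hx; rewrite ind0 ?mul0r // => -[/=].
    rewrite !in_itv /= => /andP[x1 x2] /andP[x3 x4]; move: Hx; apply/negP; rewrite -leNgt.
    have [a1 a2] := (ler_norm a, ler_norm (- a)); have [b1 b2] := (ler_norm b, ler_norm (- b)).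
    have [c1 c2] := (ler_norm c, ler_norm (- c)); have [d1 d2] := (ler_norm d, ler_norm (- d)).
    rewrite !normrN in a2 b2 c2 d2.
    by rewrite prod_normE ge_max !ler_norml; apply/andP; split; apply/andP; split; lra.
- exists (Num.max 0 K) => x; have [Bx|nB] := pselect (B x).
      by rewrite ind1 // mul1r le_max hK // orbT.
    by rewrite ind0 // mul0r normr0 le_max lexx.
Qed.

(** The fundamental theorem of calculus on horizontal lines. *)
Lemma box_dx H (a b c d : R) : a < b -> smooth H ->
  I (fun x => ind (`]a, b[ `*` `]c, d[) x * px H x) = J c d (fun t => H (b, t) - H (a, t)).
Proof.
move=> ab sH; pose B : set RR := `]a, b[ `*` `]c, d[.
have hb : bL2 (fun x => ind B x * px H x) by apply: bL2_box; exact/smooth_cont/smooth_dx.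
have hI := bL2_itg hb.
rewrite I_E /Rintegral.
have := @integral21_prod_meas1 _ _ _ _ R leb leb _ hI.
rewrite /lebesgue2 => <-.
rewrite /J /Rintegral [in RHS]integral_mkcond; congr fine.
apply: eq_integral => y _; rewrite /fubini_G patchE.
case: ifPn => [|yn]; last first.
  transitivity (0%E : \bar R); last by [].
  rewrite -(@integral0 _ _ _ leb setT); apply: eq_integral => x _ /=; rewrite ind0 ?mul0r // => -[_ /= yc].
  by move: yn; rewrite notin_setE.
rewrite inE => yc.
transitivity (\int[leb]_(x in `]a, b[) (px H (x, y))%:E)%E.
  rewrite [RHS]integral_mkcond; apply: eq_integral => x _ /=; rewrite patchE.
  case: ifPn => [|xn]; first by rewrite inE => xb; rewrite ind1 ?mul1r //; split.
  transitivity (0%E : \bar R); last by [].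
  by rewrite ind0 ?mul0r // => -[/= xb _]; move: xn; rewrite notin_setE.
have cF : continuous (fun s => H (s, y)) by apply: continuous_line1; exact: smooth_cont.
have mD A : measurable_fun A (fun s : measurableTypeR R => (px H (s, y))%:E).
  apply/measurable_EFinP; apply: measurable_funTS; apply: continuous_measurable_fun.
  by apply: continuous_line1; exact/smooth_cont/smooth_dx.
rewrite integral_itv_bndo_bndc //.
rewrite integral_itv_obnd_cbnd.
  rewrite (@continuous_FTC2 _ (fun s => px H (s, y)) (fun s => H (s, y))) //.
  - by apply: continuous_subspaceT; apply: continuous_line1; exact/smooth_cont/smooth_dx.
  - split => [t _|  |]; first by have [] := (isdx1 H (t, y) _).1 (smooth_isdx sH _).
      exact: cvg_at_right_filter (cF _).
    exact: cvg_at_left_filter (cF _).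
  - by move=> t _; rewrite derive1E; have h := (isdx1 H (t, y) _).1 (smooth_isdx sH _); exact: derive_val.
- exact: mD.
- exact: mD.
Qed.

Lemma smooth_swap f : smooth f -> smooth (fun x => f (x.2, x.1)).
Proof.
move=> /(smooth_aff (0,0) 0 1 1 0); rewrite /aff /=.
by under eq_fun do rewrite !mul0r !mul1r !add0r addr0.
Qed.

Lemma eq_J a b u v : (forall t, a < t < b -> u t = v t) -> J a b u = J a b v.
Proof. by move=> uv; apply: eq_Rintegral => t; rewrite inE /= in_itv => /uv. Qed.

Lemma det_swap : `|0 * 0 - 1 * 1 : R| = 1.
Proof. by rewrite mul0r mul1r sub0r normrN normr1. Qed.

Lemma box_dy H (a b c d : R) : c < d -> smooth H ->
  I (fun x => ind (`]a, b[ `*` `]c, d[) x * py H x) = J a b (fun t => H (t, d) - H (t, c)).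
Proof.
move=> cd sH; rewrite -(box_dx a b cd (smooth_swap sH)).
rewrite -(I_aff (0, 0) det_swap); last by apply/bL2_itg/bL2_box; exact/smooth_cont/smooth_dy.
apply: eq_I => x /=.
have -> : aff (0, 0) 0 1 1 0 x = (x.2, x.1) by rewrite /aff /= !mul0r !mul1r !add0r addr0.
congr (_ * _).
  have [[h1 h2]|h] := pselect ((`]c, d[ `*` `]a, b[)%classic x); first by rewrite !ind1.
  by rewrite !ind0 // => -[h1 h2]; apply: h.
have -> : (fun x : R * R => H (x.2, x.1)) = (fun x => H (aff (0, 0) 0 1 1 0 x)).
  by apply/funext => z; rewrite /aff /= !mul0r !mul1r !add0r addr0.
rewrite dx_aff // mul0r add0r mul1r; congr (py H _).
by rewrite /aff /= !mul0r !mul1r !add0r addr0.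
Qed.

Lemma eq_J0 a b u : (forall t, a < t < b -> u t = 0) -> J a b u = 0.
Proof. by move=> u0; rewrite (@eq_J _ _ _ (fun=> 0)) // /J /Rintegral integral0. Qed.

Lemma tf_box F (c : R) : tf F -> exists2 M, 0 < M & forall x, M <= `|x| -> F x = 0.
Proof.
move=> [_ [M hM] _]; exists (Num.max 1 (M + 1)); first by rewrite lt_max ltr01.
by move=> x; rewrite ge_max => /andP[_ h]; apply: hM; rewrite (lt_le_trans _ h) // ltrDl.
Qed.

Lemma prod_norm_ge (M : R) x : (M <= `|x|) = (M <= `|x.1|) || (M <= `|x.2|).
Proof. by rewrite prod_normE le_max. Qed.

Lemma I_box F (M : R) : (forall x, M <= `|x| -> F x = 0) ->
  I F = I (fun x => ind (`]-M, M[ `*` `]-M, M[) x * F x).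
Proof.
move=> hM; apply: eq_I => x; have [Mx|xM] := leP M `|x|; first by rewrite hM // mulr0.
rewrite ind1 ?mul1r //; move: xM; rewrite prod_normE gt_max !ltr_norml.
by move=> /andP[h1 h2]; split; rewrite /= in_itv.
Qed.

Lemma I_dx F : tf F -> I (px F) = 0.
Proof.
move=> tF; have [M M0 hM] := tf_box 0 (tfB_dx tF); have [N N0 hN] := tf_box 0 tF.
pose P := Num.max M N.
rewrite (@I_box _ P) => [|x Px]; last by apply: hM; rewrite (le_trans _ Px) // le_max lexx.
have P0 : 0 < P by rewrite lt_max M0.
have NP : N <= P by rewrite le_max lexx orbT.
rewrite box_dx; [|by lra|exact: tfB_smooth tF].
by apply: eq_J0 => t _; rewrite !hN ?subrr // prod_norm_ge /= ?normrN (gtr0_norm P0) NP.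
Qed.

Lemma I_dy F : tf F -> I (py F) = 0.
Proof.
move=> tF; have [M M0 hM] := tf_box 0 (tfB_dy tF); have [N N0 hN] := tf_box 0 tF.
pose P := Num.max M N.
rewrite (@I_box _ P) => [|x Px]; last by apply: hM; rewrite (le_trans _ Px) // le_max lexx.
have P0 : 0 < P by rewrite lt_max M0.
have NP : N <= P by rewrite le_max lexx orbT.
rewrite box_dy; [|by lra|exact: tfB_smooth tF].
by apply: eq_J0 => t _; rewrite !hN ?subrr // prod_norm_ge /= ?normrN (gtr0_norm P0) NP orbT.
Qed.

Lemma itg_tf F : tf F -> itg F. Proof. by move/bL2_tf/bL2_itg. Qed.

Lemma ibp_dx f g : smooth f -> tf g -> ip (px f) g = - ip f (px g).
Proof.
move=> sf tg; have sg := tfB_smooth tg; apply/eqP; rewrite -subr_eq0 opprK /ip -ID.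
- by rewrite -(I_dx (tfBMl sf tg)); apply/eqP; apply: eq_I => x; rewrite dxM.
- by apply: itg_tf; apply: tfBMl => //; exact: smooth_dx.
- by apply: itg_tf; apply: tfBMl => //; exact: tfB_dx.
Qed.
Lemma ibp_dy f g : smooth f -> tf g -> ip (py f) g = - ip f (py g).
Proof.
move=> sf tg; have sg := tfB_smooth tg; apply/eqP; rewrite -subr_eq0 opprK /ip -ID.
- by rewrite -(I_dy (tfBMl sf tg)); apply/eqP; apply: eq_I => x; rewrite dyM.
- by apply: itg_tf; apply: tfBMl => //; exact: smooth_dy.
- by apply: itg_tf; apply: tfBMl => //; exact: tfB_dy.
Qed.

(** Expand the square: integrating the product [px p * py q] by parts twice
    turns it into [py p * px q], which is the square of either factor. *)
Lemma n2_div (p q : R * R -> R) : tf p -> tf q -> (forall x, py p x = px q x) ->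
  n2 (px p) + n2 (py p) + n2 (px q) + n2 (py q) = n2 (fun x => px p x + py q x).
Proof.
move=> tp tq pq; have sp := tfB_smooth tp; have sq := tfB_smooth tq.
have E : ip (px p) (py q) = ip (py p) (px q).
  rewrite (ibp_dx sp (tfB_dy tq)) (ibp_dy sp (tfB_dx tq)); congr (- _).
  by apply: eq_I => x; rewrite schwarz.
have E1 : ip (py p) (px q) = n2 (py p) by apply: eq_I => x; rewrite -pq.
have E2 : n2 (px q) = n2 (py p) by apply: eq_I => x; rewrite -pq.
have b1 := bL2_tf (tfB_dx tp); have b2 := bL2_tf (tfB_dy tq).
have := n2_lin 1 b1 b2; under eq_fun do rewrite mul1r.
by rewrite E E1 E2 expr1n !mul1r mulr1 => ->; ring.
Qed.

End Divergence.

(** * Convolution with a test function *)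
Section Convolution.
Context {R : realType}.
Implicit Types (f g k : R * R -> R) (x : R * R).
Local Notation e1 := ((1, 0) : R * R).
Local Notation e2 := ((0, 1) : R * R).

Lemma sub_aff x y : x - y = aff x (-1) 0 0 (-1) y.
Proof. by rewrite /aff; case: x y => [a b] [c d] /=; congr pair; rewrite /=; ring. Qed.

Lemma det_refl : `|(-1) * (-1) - 0 * 0 : R| = 1.
Proof. by rewrite mulrNN mul1r mul0r subr0 normr1. Qed.

Lemma tf_sub k x : tf k -> tf (fun y => k (x - y)).
Proof.
move=> tk; under eq_fun do rewrite sub_aff.
by apply: (tfB_aff det_refl _ tk).
Qed.
Lemma px_sub k x y : smooth k -> px (fun y => k (x - y)) y = - px k (x - y).
Proof.
move=> sk; under [in LHS]eq_fun do rewrite sub_aff.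
by rewrite dx_aff // mul0r addr0 mulN1r sub_aff.
Qed.
Lemma py_sub k x y : smooth k -> py (fun y => k (x - y)) y = - py k (x - y).
Proof.
move=> sk; under [in LHS]eq_fun do rewrite sub_aff.
by rewrite dy_aff // mul0r add0r mulN1r sub_aff.
Qed.

Lemma tf_bound k : tf k -> exists2 C, 0 <= C & forall x, `|k x| <= C.
Proof.
move=> /bm_tf[_ [C HC]]; exists C => //.
by rewrite (le_trans _ (HC 0)).
Qed.

Lemma lip_x k (C a b t : R) : smooth k -> (forall x, `|px k x| <= C) ->
  `|k (a, t) - k (b, t)| <= C * `|a - b|.
Proof.
move=> sk HC; have [c _ ->] := @mvt R (fun s => k (s, t)) (fun s => px k (s, t)) b a
    (fun s => (isdx1 k (s, t) _).1 (smooth_isdx sk _)).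
by rewrite normrM ler_wpM2r.
Qed.
Lemma lip_y k (C a b t : R) : smooth k -> (forall x, `|py k x| <= C) ->
  `|k (t, a) - k (t, b)| <= C * `|a - b|.
Proof.
move=> sk HC; have [c _ ->] := @mvt R (fun s => k (t, s)) (fun s => py k (t, s)) b a
    (fun s => (isdy1 k (t, s) _).1 (smooth_isdy sk _)).
by rewrite normrM ler_wpM2r.
Qed.

Lemma tf_lip k : tf k -> exists2 C, 0 <= C & forall x y, `|k x - k y| <= C * `|x - y|.
Proof.
move=> tk; have sk := tfB_smooth tk.
have [C1 C10 H1] := tf_bound (tfB_dx tk); have [C2 C20 H2] := tf_bound (tfB_dy tk).
exists (C1 + C2); first exact: addr_ge0.
move=> x y; rewrite (_ : _ - _ = (k (x.1, x.2) - k (y.1, x.2)) + (k (y.1, x.2) - k (y.1, y.2))); last first.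
  by rewrite -!surjective_pairing; ring.
rewrite (le_trans (ler_normD _ _)) // mulrDl lerD //.
  rewrite (le_trans (lip_x _ _ _ sk H1)) // ler_wpM2l // prod_normE le_max.
  by apply/orP; left; rewrite [X in _ <= `|X|]/=.
rewrite (le_trans (lip_y _ _ _ sk H2)) // ler_wpM2l // prod_normE le_max.
by apply/orP; right; rewrite [X in _ <= `|X|]/=.
Qed.

(** With a remainder uniform in the base point, so that it can be integrated
    against [f] in [conv_is_derive]. *)
Lemma taylor_x k : tf k -> exists2 C, 0 <= C & forall z (h : R),
  `|k (h *: e1 + z) - k z - h * px k z| <= C * h ^+ 2.
Proof.
move=> tk; have sk := tfB_smooth tk.
have [C C0 HC] := tf_bound (tfB_dx (tfB_dx tk)); exists C => // -[a b] h.
have -> : h *: e1 + (a, b) = (a + h, b).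
  by congr pair; rewrite /= /GRing.scale /=; ring.
have [c cb E] := @mvt R (fun s => k (s, b)) (fun s => px k (s, b)) a (a + h)
    (fun s => (isdx1 k (s, b) _).1 (smooth_isdx sk _)).
rewrite E addrAC subrr add0r [_ * h]mulrC -mulrBr normrM.
rewrite -(real_normK (num_real h)) expr2 mulrCA ler_wpM2l //.
rewrite (le_trans (lip_x _ _ _ (smooth_dx sk) HC)) // ler_wpM2l //.
by rewrite (le_trans cb) // addrAC subrr add0r.
Qed.
Lemma taylor_y k : tf k -> exists2 C, 0 <= C & forall z (h : R),
  `|k (h *: e2 + z) - k z - h * py k z| <= C * h ^+ 2.
Proof.
move=> tk; have sk := tfB_smooth tk.
have [C C0 HC] := tf_bound (tfB_dy (tfB_dy tk)); exists C => // -[a b] h.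
have -> : h *: e2 + (a, b) = (a, b + h).
  by congr pair; rewrite /= /GRing.scale /=; ring.
have [c cb E] := @mvt R (fun s => k (a, s)) (fun s => py k (a, s)) b (b + h)
    (fun s => (isdy1 k (a, s) _).1 (smooth_isdy sk _)).
rewrite E addrAC subrr add0r [_ * h]mulrC -mulrBr normrM.
rewrite -(real_normK (num_real h)) expr2 mulrCA ler_wpM2l //.
rewrite (le_trans (lip_y _ _ _ (smooth_dy sk) HC)) // ler_wpM2l //.
by rewrite (le_trans cb) // addrAC subrr add0r.
Qed.

Definition conv f k x : R := ip f (fun y => k (x - y)).

Lemma itg_conv f k x : bL2 f -> tf k -> itg (fun y => f y * k (x - y)).
Proof. by move=> bf tk; apply: itgM => //; exact/bL2_tf/tf_sub. Qed.

Lemma conv_continuous f k : bL2 f -> tf k -> continuous (conv f k).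
Proof.
move=> bf tk; have [C C0 HC] := tf_lip tk => x.
pose A := I (fun y => `|f y|); have A0 : 0 <= A by apply: I_ge0 => y.
have H y : `|conv f k x - conv f k y| <= A * C * `|x - y|.
  rewrite /conv /ip -IB; try exact: itg_conv.
  rewrite (le_trans (norm_I _)) //; first by apply: itgB; exact: itg_conv.
  rewrite -mulrA mulrC -IZ; last exact/itg_norm/bL2_itg.
  apply: le_I.
  - by apply: itg_norm; apply: itgB; exact: itg_conv.
  - exact/itgZ/itg_norm/bL2_itg.
  - move=> z; rewrite -mulrBr normrM mulrC ler_wpM2r //.
    by rewrite (le_trans (HC _ _)) // opprB addrA subrK.
have p : 0 < A * C + 1 by rewrite ltr_wpDl // mulr_ge0.
apply/cvgrPdist_le => e e0; near=> y.
rewrite (le_trans (H y)) //.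
apply: (@le_trans _ _ ((A * C + 1) * `|x - y|)); first by rewrite ler_wpM2r // lerDl.
rewrite mulrC -ler_pdivlMr //.
near: y; apply: (@cvgr_dist_le _ _ _ (nbhs x) _ id x (@cvg_id _ _)).
by rewrite divr_gt0.
Unshelve. all: by end_near.
Qed.

(** Differentiation under the integral sign. *)
Lemma conv_is_derive f k kd (v : R * R) : bL2 f -> tf k -> tf kd ->
  (exists2 C, 0 <= C & forall z (h : R), `|k (h *: v + z) - k z - h * kd z| <= C * h ^+ 2) ->
  forall x, is_derive x v (conv f k) (conv f kd x).
Proof.
move=> bf tk tkd [C C0 HC] x.
pose A := I (fun y => `|f y|); have A0 : 0 <= A by apply: I_ge0 => y.
have H (h : R) : `|conv f k (h *: v + x) - conv f k x - h * conv f kd x| <= A * C * h ^+ 2.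
  rewrite /conv /ip -IZ -?IB; try (try apply: itgB; try apply: itgZ; exact: itg_conv).
  rewrite (le_trans (norm_I _)) //; first by apply: itgB; [apply: itgB|apply: itgZ]; exact: itg_conv.
  rewrite -mulrA mulrC -IZ; last exact/itg_norm/bL2_itg.
  apply: le_I.
  - by apply: itg_norm; apply: itgB; [apply: itgB|apply: itgZ]; exact: itg_conv.
  - exact/itgZ/itg_norm/bL2_itg.
  - move=> z; rewrite -mulrBr mulrCA -mulrBr normrM mulrC ler_wpM2r //.
    by have := HC (x - z) h; rewrite addrA.
suff HH : h^-1 *: ((conv f k \o shift x) (h *: v) - conv f k x) @[h --> 0^'] --> conv f kd x.
  by split; [apply/cvg_ex; eexists; exact: HH|exact: cvg_lim].
have p : 0 < A * C + 1 by rewrite ltr_wpDl // mulr_ge0.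
apply/cvgrPdist_le => e e0; near=> h.
have h0 : h != 0 by near: h; exact: nbhs_dnbhs_neq.
have he : `|h| < e / (A * C + 1) by near: h; apply: dnbhs0_lt; rewrite divr_gt0.
rewrite distrC (_ : _ - _ = h^-1 * (conv f k (h *: v + x) - conv f k x - h * conv f kd x)); last first.
  by rewrite /GRing.scale /=; field.
rewrite normrM normfV ler_pdivrMl ?normr_gt0 // (le_trans (H h)) //.
rewrite -(real_normK (num_real h)) expr2 mulrA mulrC ler_wpM2l //.
apply: (@le_trans _ _ ((A * C + 1) * `|h|)); first by rewrite ler_wpM2r // lerDl.
by rewrite mulrC -ler_pdivlMr // ltW.
Unshelve. all: by end_near.
Qed.

Lemma smooth_conv f k : bL2 f -> tf k -> smooth (conv f k).
Proof.
move=> bf tk m; elim: m k tk => [|m IH] k tk; first by split => //; exact: conv_continuous.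
apply: (@Ck_intro _ _ _ (conv f (px k)) (conv f (py k))).
- exact: conv_continuous.
- by apply: conv_is_derive => //; [exact: tfB_dx|exact: taylor_x].
- by apply: conv_is_derive => //; [exact: tfB_dy|exact: taylor_y].
- by apply: IH; exact: tfB_dx.
- by apply: IH; exact: tfB_dy.
Qed.
Lemma px_conv f k : bL2 f -> tf k -> px (conv f k) = conv f (px k).
Proof.
move=> bf tk; apply/funext/dxE; apply: conv_is_derive => //; [exact: tfB_dx|exact: taylor_x].
Qed.
Lemma py_conv f k : bL2 f -> tf k -> py (conv f k) = conv f (py k).
Proof.
move=> bf tk; apply/funext/dyE; apply: conv_is_derive => //; [exact: tfB_dy|exact: taylor_y].
Qed.

Lemma conv_supp f k (r : R) x : (forall y, r <= `|y| -> k y = 0) -> conv f k x != 0 ->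
  exists2 y, `|x - y| < r & f y != 0.
Proof.
move=> kr; apply: contra_neqP => H; rewrite -[RHS]I0; apply: eq_I => y.
have [h|h] := leP r `|x - y|; first by rewrite kr // mulr0.
have [->|fy] := eqVneq (f y) 0; first by rewrite mul0r.
by exfalso; apply: H; exists y.
Qed.

Lemma tf_conv f k : bL2 f -> tf k -> tf (conv f k).
Proof.
move=> bf tk; apply: tfE; first exact: smooth_conv.
have [r r0 kr] := tf_box 0 tk; have [_ [M fM] _] := bf.
exists (M + r) => x Mx; apply/eqP; apply: contraTT Mx => /(conv_supp kr)[y xy fy].
have yM : `|y| <= M by rewrite leNgt; apply: contra fy => /fM ->.
rewrite -leNgt -[x](subrK y) (le_trans (ler_normD _ _)) // addrC lerD // ltW //.
Qed.

End Convolution.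

(** * Density of smooth functions in L2 *)
Section SigmaFinite.
Context {R : realType}.
Local Notation leb := (@lebesgue_measure R).
Local Notation RR := (measurableTypeR R * measurableTypeR R)%type.
Local Notation mu := (lebesgue2 R).

Lemma sigma_finite_lebesgue2 : sigma_finite [set: RR] (lebesgue2 R).
Proof.
exists (fun n : nat => (`[- n%:R, n%:R] `*` `[- n%:R, n%:R])%classic).
  apply/esym; rewrite -subTset => -[a b] _.
  have [n nb] : exists n : nat, `|a| <= n%:R /\ `|b| <= n%:R.
    exists (maxn (Num.bound `|a|) (Num.bound `|b|)).
    split; rewrite (le_trans (ltW (archi_boundP _))) // ler_nat; [exact: leq_maxl|exact: leq_maxr].
  by exists n => //; move: nb; rewrite !ler_norml => -[? ?]; split; rewrite /= in_itv.
move=> n; split; first exact: measurableX.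
rewrite mu_setX // lebesgue_measure_itv /=.
by case: ifPn => _; rewrite ?mule0 ?ltry // -EFinM ltry.
Qed.

End SigmaFinite.
Definition lebesgue2s (R : realType) : set (measurableTypeR R * measurableTypeR R) -> \bar R := lebesgue2 R.
HB.instance Definition _ (R : realType) := Measure.on (@lebesgue2s R).
HB.instance Definition _ (R : realType) := @Measure_isSigmaFinite.Build _ _ _ (@lebesgue2s R) (@sigma_finite_lebesgue2 R).
Definition lebesgue2sf (R : realType) : {sigma_finite_measure set (measurableTypeR R * measurableTypeR R)%type -> \bar R} := @lebesgue2s R.
Section TonelliPlane.
Context {R : realType}.
Local Notation RR := (measurableTypeR R * measurableTypeR R)%type.
Local Notation mu := (lebesgue2 R).
Lemma tonelli_mu (F : RR * RR -> \bar R) : measurable_fun setT F -> (forall x, 0 <= F x)%E ->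
  (\int[mu]_x \int[mu]_y F (x, y) = \int[mu]_y \int[mu]_x F (x, y))%E.
Proof. by move=> mF F0; exact: (@fubini_tonelli _ _ _ _ R (lebesgue2sf R) (lebesgue2sf R) F mF F0). Qed.
End TonelliPlane.

Section Young.
Context {R : realType}.
Implicit Types (f g k : R * R -> R) (x : R * R).
Local Notation leb := (@lebesgue_measure R).
Local Notation RR := (measurableTypeR R * measurableTypeR R)%type.
Local Notation mu := (lebesgue2 R).

Lemma I_mol_sub r x : 0 < r -> I (fun y => mol r (x - y)) = 1.
Proof.
move=> r0; rewrite -[RHS](I_mol r0) -(I_aff x det_refl (itg_tf (tf_mol r))).
by apply: eq_I => y /=; rewrite sub_aff.
Qed.
Lemma I_mol_sub' r y : 0 < r -> I (fun x => mol r (x - y)) = 1.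
Proof.
move=> r0; rewrite -[RHS](I_mol_sub y r0); apply: eq_I => x.
by rewrite -[RHS]mol_even opprB.
Qed.

Lemma tf_mol_sub (r : R) x : tf (fun y => mol r (x - y)).
Proof. exact/tf_sub/tf_mol. Qed.

Lemma itg_sqM f r x : bL2 f -> itg (fun y => f y ^+ 2 * mol r (x - y)).
Proof.
move=> bf; have [C C0 HC] := tf_bound (tf_mol (R := R) r).
apply: (itg_le (g := fun y => C * f y ^+ 2)).
- by apply: mfM; [apply: mf_sqr; exact: bL2_mf|exact: (bL2_mf (bL2_tf (tf_mol_sub r x)))].
- exact/itgZ/bL2_itg2.
- by move=> y; rewrite normrM [X in X <= _]mulrC [X in _ * X]ger0_norm ?sqr_ge0 // ler_wpM2r // sqr_ge0.
Qed.

(** Jensen's inequality for the probability density [mol r]. *)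
Lemma conv_sqr_le f r x : 0 < r -> bL2 f ->
  conv f (mol r) x ^+ 2 <= I (fun y => f y ^+ 2 * mol r (x - y)).
Proof.
move=> r0 bf; set m := conv f (mol r) x.
have tk := tf_mol_sub r x; have ik := itg_tf tk.
have if1 := itg_conv x bf (tf_mol r).
have : 0 <= I (fun y => (f y ^+ 2 * mol r (x - y) - 2 * m * (f y * mol r (x - y))) + m ^+ 2 * mol r (x - y)).
  apply: I_ge0 => y; have -> : (f y ^+ 2 * mol r (x - y) - 2 * m * (f y * mol r (x - y))) + m ^+ 2 * mol r (x - y) =
     (f y - m) ^+ 2 * mol r (x - y) by ring.
  by rewrite mulr_ge0 ?sqr_ge0 ?mol_ge0.
rewrite ID; [|by apply: itgB; [exact: itg_sqM|exact: itgZ]|exact: itgZ].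
rewrite IB; [|exact: itg_sqM|exact: itgZ].
rewrite (IZ (2 * m) if1) (IZ (m ^+ 2) ik) I_mol_sub //.
have -> : I (fun y => f y * mol r (x - y)) = m by [].
by rewrite !expr2; lra.
Qed.

(** Jensen's inequality followed by Tonelli's theorem. *)
Lemma young f r : 0 < r -> bL2 f -> n2 (conv f (mol r)) <= n2 f.
Proof.
move=> r0 bf; have tc := tf_conv bf (tf_mol r); have bc := bL2_tf tc.
rewrite -lee_fin /n2 /ip IE; last exact: itgM.
under eq_integral => x _ do rewrite -expr2.
have mF : measurable_fun [set: RR * RR] (fun z : RR * RR => (f z.2 ^+ 2 * mol r (z.1 - z.2))%:E).
  apply/measurable_EFinP; apply: measurable_funM.
    apply: (measurable_funX 2); apply: (measurableT_comp (bL2_mf bf)); exact: measurable_snd.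
  apply: (measurableT_comp (bL2_mf (bL2_tf (tf_mol r)))).
  apply/measurable_fun_pairP; split => /=.
    by apply: measurable_funB; apply: (measurableT_comp measurable_fst); [exact: measurable_fst|exact: measurable_snd].
  by apply: measurable_funB; apply: (measurableT_comp measurable_snd); [exact: measurable_fst|exact: measurable_snd].
have F0 (z : RR * RR) : (0 <= (f z.2 ^+ 2 * mol r (z.1 - z.2))%:E)%E.
  by rewrite lee_fin mulr_ge0 ?sqr_ge0 ?mol_ge0.
apply: (@le_trans _ _ (\int[mu]_x \int[mu]_y (f y ^+ 2 * mol r (x - y))%:E)%E).
  apply: ge0_le_integral => //.
  - by move=> x _; rewrite lee_fin sqr_ge0.
  - by apply/measurable_EFinP; apply: mf_sqr; exact: bL2_mf.
  - exact: (@measurable_fun_fubini_tonelli_F _ _ _ _ R (lebesgue2sf R) _ mF F0).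
  - by move=> x _; rewrite -IE; [rewrite lee_fin conv_sqr_le|exact: itg_sqM].
rewrite (tonelli_mu mF F0) /=.
have E y : (\int[mu]_x (f y ^+ 2 * mol r (x - y))%:E = (f y * f y)%:E)%E.
  have ik : itg (fun x => mol r (x - y)).
    by under eq_fun do rewrite -mol_even opprB; exact/itg_tf/tf_mol_sub.
  by rewrite -IE; [rewrite IZ // I_mol_sub' // mulr1 expr2|exact: itgZ].
by under eq_integral => y _ do rewrite E; rewrite -IE //; exact: itgM.
Qed.

Lemma convD f g k x : bL2 f -> bL2 g -> tf k ->
  conv (fun y => f y + g y) k x = conv f k x + conv g k x.
Proof. by move=> bf bg tk; rewrite /conv ipDl //; exact/bL2_tf/tf_sub. Qed.
Lemma convB f g k x : bL2 f -> bL2 g -> tf k ->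
  conv (fun y => f y - g y) k x = conv f k x - conv g k x.
Proof. by move=> bf bg tk; rewrite /conv ipBl //; exact/bL2_tf/tf_sub. Qed.
Lemma convZ c f k x : bL2 f -> tf k -> conv (fun y => c * f y) k x = c * conv f k x.
Proof. by move=> bf tk; rewrite /conv ipZl //; exact/bL2_tf/tf_sub. Qed.

Definition mollifiable f := forall e : R, 0 < e -> exists2 r0, 0 < r0 &
  forall r, 0 < r < r0 -> n2 (fun x => conv f (mol r) x - f x) <= e.

Lemma bL2_conv f k : bL2 f -> tf k -> bL2 (conv f k).
Proof. by move=> bf tk; exact/bL2_tf/tf_conv. Qed.

Lemma mollifiableD f g : bL2 f -> bL2 g -> mollifiable f -> mollifiable g -> mollifiable (fun x => f x + g x).
Proof.
move=> bf bg gf gg e e0; have e4 : 0 < e / 4 by rewrite divr_gt0.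
have [r1 r10 H1] := gf _ e4; have [r2 r20 H2] := gg _ e4.
exists (Num.min r1 r2) => [|r]; first by rewrite lt_min r10.
rewrite lt_min => /and3P[r0 rr1 rr2].
have tk := tf_mol (R := R) r.
have b1 := bL2B (bL2_conv bf tk) bf; have b2 := bL2B (bL2_conv bg tk) bg.
rewrite (_ : n2 _ = n2 (fun x => (conv f (mol r) x - f x) + (conv g (mol r) x - g x))); last first.
  by congr n2; apply/funext => x; rewrite convD //; ring.
apply: (le_trans (n2D b1 b2)).
by have := H1 r; have := H2 r; rewrite r0 rr1 rr2 => /(_ erefl) ? /(_ erefl) ?; lra.
Qed.

Lemma mollifiableZ c f : bL2 f -> mollifiable f -> mollifiable (fun x => c * f x).
Proof.
move=> bf gf e e0; have c0 : 0 < c ^+ 2 + 1 by rewrite ltr_wpDl // sqr_ge0.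
have [r0 r00 H] := gf (e / (c ^+ 2 + 1)) (divr_gt0 e0 c0).
exists r0 => // r /H Hr; have tk := tf_mol (R := R) r.
rewrite (_ : n2 _ = n2 (fun x => c * (conv f (mol r) x - f x))); last first.
  by congr n2; apply/funext => x; rewrite convZ // mulrBr.
rewrite n2Z; last by apply: bL2B => //; exact: bL2_conv.
move: Hr; rewrite ler_pdivlMr // => Hr; apply: le_trans Hr.
by rewrite mulrC ler_wpM2l ?n2_ge0 // lerDl.
Qed.

(** By Young's inequality mollification is uniformly bounded in L2, so that
    these functions form a closed set. *)
Lemma mollifiable_lim f : bL2 f ->
  (forall e : R, 0 < e -> exists g, [/\ bL2 g, mollifiable g & n2 (fun x => f x - g x) <= e]) -> mollifiable f.
Proof.
move=> bf H e e0; have e8 : 0 < e / 10 by rewrite divr_gt0.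
have [g [bg gg fg]] := H _ e8; have [r0 r00 Hr] := gg _ e8; exists r0 => // r rr.
have tk := tf_mol (R := R) r; have /andP[rp _] := rr.
have b0 := bL2B bf bg; have b1 := bL2_conv b0 tk; have b2 := bL2B (bL2_conv bg tk) bg.
rewrite (_ : n2 _ = n2 (fun x => (conv (fun x => f x - g x) (mol r) x + (conv g (mol r) x - g x)) - (f x - g x))); last first.
  by congr n2; apply/funext => x; rewrite convB //; ring.
apply: (le_trans (n2B (bL2D b1 b2) b0)); have := n2D b1 b2; have := young rp b0; have := Hr _ rr.
by lra.
Qed.

Lemma I_ind_box (a b c d : R) : a <= b -> c <= d -> I (ind (`]a, b] `*` `]c, d])) = (b - a) * (d - c).
Proof.
move=> ab cd; pose B : set RR := `]a, b] `*` `]c, d].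
have mB : measurable B by exact: measurableX.
have iB : (\int[mu]_x (ind B x)%:E = ((b - a) * (d - c))%:E)%E.
  rewrite integral_indic // setIT mu_setX // !lebesgue_measure_itv /= !lte_fin.
  have [ab'|] := ltP a b; last by move=> ba; rewrite (le_anti (introT andP (conj ab ba))) subrr mul0r mul0e.
  have [cd'|] := ltP c d; last by move=> dc; rewrite (le_anti (introT andP (conj cd dc))) subrr mulr0 mule0.
  by rewrite -!EFinD -EFinM.
by rewrite I_E /Rintegral iB.
Qed.
End Young.

Section MollifiedBoxes.
Context {R : realType}.
Implicit Types (f g k : R * R -> R) (x : R * R).
Local Notation leb := (@lebesgue_measure R).
Local Notation RR := (measurableTypeR R * measurableTypeR R)%type.
Local Notation mu := (lebesgue2 R).

Lemma boxP (a b c d : R) (x : R * R) :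
  (`]a, b] `*` `]c, d])%classic x <-> [/\ a < x.1, x.1 <= b, c < x.2 & x.2 <= d].
Proof.
split; first by move=> [/=]; rewrite !in_itv /= => /andP[? ?] /andP[? ?].
by move=> [? ? ? ?]; split; rewrite /= in_itv /=; apply/andP.
Qed.

Lemma ind01 (A : set (R * R)) x : 0 <= ind A x <= 1.
Proof. by rewrite /ind indicE; case: (_ \in _); rewrite ?lexx ?ler01. Qed.

Lemma conv01 f r x : 0 < r -> bL2 f -> (forall y, 0 <= f y <= 1) -> 0 <= conv f (mol r) x <= 1.
Proof.
move=> r0 bf f01; apply/andP; split.
  by apply: I_ge0 => y; rewrite mulr_ge0 ?mol_ge0 //; case/andP: (f01 y).
rewrite -(I_mol_sub x r0); apply: le_I.
- exact: itg_conv (tf_mol r).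
- exact/itg_tf/tf_mol_sub.
- by move=> y; rewrite ler_piMl ?mol_ge0 //; case/andP: (f01 y).
Qed.

Lemma bL2_ind (A : set RR) : measurable A -> (exists M, forall x, A x -> `|x| <= M) -> bL2 (ind A).
Proof.
move=> mA [M hM]; apply: bL2_bounded; first exact: (bm_ind mA).1.
  by exists M => x Mx; rewrite ind0 // => /hM; rewrite leNgt Mx.
by exists 1 => x; have /andP[h0 h1] := ind01 A x; rewrite ger0_norm.
Qed.

Lemma bL2_indbox (a b c d : R) : bL2 (ind (`]a, b] `*` `]c, d])).
Proof.
apply: bL2_ind; first exact: measurableX.
exists (`|a| + `|b| + `|c| + `|d|) => x /boxP[x1 x2 x3 x4].
have [a1 a2] := (ler_norm a, ler_norm (- a)); have [b1 b2] := (ler_norm b, ler_norm (- b)).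
have [c1 c2] := (ler_norm c, ler_norm (- c)); have [d1 d2] := (ler_norm d, ler_norm (- d)).
rewrite !normrN in a2 b2 c2 d2.
by rewrite prod_normE ge_max !ler_norml; apply/andP; split; apply/andP; split; lra.
Qed.

Lemma mollifiable0 : mollifiable (fun=> 0 : R).
Proof.
move=> e e0; exists 1 => // r _; rewrite (_ : n2 _ = 0) ?ltW // -[RHS]I0.
apply: eq_I => x; rewrite subr0 (_ : conv _ _ _ = 0) ?mulr0 // -[RHS]I0.
by apply: eq_I => y; rewrite mul0r.
Qed.

(** The mollified indicator differs from the indicator only within distance
    [r] of the boundary of the box, and by at most 1. *)
Lemma mollifiable_box (a b c d : R) : mollifiable (ind (`]a, b] `*` `]c, d])).
Proof.
have [ba|ab] := leP b a.
  rewrite (_ : ind _ = fun=> 0); first exact: mollifiable0.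
  by apply/funext => x; rewrite ind0 // => /boxP[]; lra.
have [dc|cd] := leP d c.
  rewrite (_ : ind _ = fun=> 0); first exact: mollifiable0.
  by apply/funext => x; rewrite ind0 // => /boxP[]; lra.
set B := _ `*` _ => e e0.
pose s := (b - a) + (d - c); have s0 : 0 < s by rewrite /s; lra.
exists (Num.min (e / (4 * s)) (Num.min ((b - a) / 2) ((d - c) / 2))).
  by rewrite !lt_min !divr_gt0 ?mulr_gt0 //; lra.
move=> r; rewrite !lt_min => /and4P[r0 re rb rd].
have bB := bL2_indbox a b c d.
pose O := ind (`]a - r, b + r] `*` `]c - r, d + r]).
pose N := ind (`]a + r, b - r] `*` `]c + r, d - r]).
have bO : bL2 O by exact: bL2_indbox.
have bN : bL2 N by exact: bL2_indbox.
have ltx x y : `|x - y| < r -> [/\ x.1 - r < y.1, y.1 < x.1 + r, x.2 - r < y.2 & y.2 < x.2 + r].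
  rewrite prod_normE gt_max /= !ltr_norml => /andP[/andP[? ?] /andP[? ?]]; split; lra.
have ON x : `|conv (ind B) (mol r) x - ind B x| <= O x - N x.
  have /andP[k0 k1] := conv01 x r0 bB (ind01 B).
  have [Nx|nN] := pselect ((`]a + r, b - r] `*` `]c + r, d - r])%classic x).
    have [Ox Bx] : (`]a - r, b + r] `*` `]c - r, d + r])%classic x /\ B x.
      by move/boxP: Nx => [? ? ? ?]; split; apply/boxP; split; lra.
    rewrite /O /N !ind1 // subrr (_ : conv _ _ _ = 1) ?subrr ?normr0 //.
    rewrite -[RHS](I_mol_sub x r0); apply: eq_I => y.
    have [h|/ltx[y1 y2 y3 y4]] := leP r `|x - y|; first by rewrite mol_out // mulr0.
    rewrite ind1 ?mul1r //.
    by move/boxP: Nx => [? ? ? ?]; apply/boxP; split; lra.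
  rewrite /N (ind0 nN) subr0.
  have [Ox|nO] := pselect ((`]a - r, b + r] `*` `]c - r, d + r])%classic x).
    rewrite /O (ind1 Ox); have /andP[? ?] := ind01 B x; rewrite ler_norml; lra.
  rewrite /O (ind0 nO) (@ind0 _ B) ?subr0; last first.
    by move=> /boxP[? ? ? ?]; apply/nO/boxP; split; lra.
  rewrite (_ : conv _ _ _ = 0) ?normr0 // -[RHS]I0; apply: eq_I => y.
  have [h|/ltx[y1 y2 y3 y4]] := leP r `|x - y|; first by rewrite mol_out // mulr0.
  rewrite ind0 ?mul0r // => /boxP[? ? ? ?].
  by apply/nO/boxP; split; lra.
have bc : bL2 (fun x => conv (ind B) (mol r) x - ind B x).
  by apply: bL2B => //; apply: bL2_conv => //; exact: tf_mol.
apply: (@le_trans _ _ (I (fun x => O x - N x))).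
  apply: le_I; [exact: itgM|apply: itgB; exact: bL2_itg|] => x.
  rewrite -expr2 -(real_normK (num_real _)); apply: (le_trans _ (ON x)).
  rewrite expr2 ler_piMl // (le_trans (ON x)) //.
  by have := ind01 _ x : 0 <= O x <= 1; have := ind01 _ x : 0 <= N x <= 1; lra.
rewrite IB; try exact: bL2_itg.
rewrite !I_ind_box; try lra.
have -> : (b + r - (a - r)) * (d + r - (c - r)) - (b - r - (a + r)) * (d - r - (c + r)) = 4 * s * r.
  by rewrite /s; ring.
by rewrite mulrC -ler_pdivlMr ?mulr_gt0 // ltW.
Qed.

End MollifiedBoxes.

Section Density.
Context {R : realType}.
Implicit Types (f g k : R * R -> R) (x : R * R).
Local Notation leb := (@lebesgue_measure R).
Local Notation RR := (measurableTypeR R * measurableTypeR R)%type.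
Local Notation mu := (lebesgue2 R).

Definition bigbox (M : R) : set RR := `]- M, M] `*` `]- M, M].

Definition boxes : set (set RR) := [set X `*` Y | X in @ocitv R & Y in @ocitv R].

(** Cylinders are countable unions of bounded boxes. *)
Lemma measurable_boxes : (@measurable _ RR) `<=` <<s boxes >>.
Proof.
have ocT : [set: R] = \bigcup_(n : nat) `](- n%:R), n%:R]%classic.
  apply/esym; rewrite -subTset => a _; exists (Num.bound `|a|) => //=.
  have := archi_boundP (normr_ge0 a); rewrite ltr_norml in_itv /= => /andP[-> /ltW ->] //.
have H1 (X : set (measurableTypeR R)) : measurable X -> <<s boxes >> (X `*` setT).
  move=> mX; have : measurable_fun [set: g_sigma_algebraType boxes] (fst : g_sigma_algebraType boxes -> measurableTypeR R).
    apply: (measurability (@ocitv R)) => // _ [Y oY <-]; rewrite setTI.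
    have -> : fst @^-1` Y = \bigcup_n (Y `*` `](- n%:R), n%:R]%classic) :> set (R * R).
      apply/seteqP; split=> [[u v] /= Yu|[u v] [n _ [/= ? _]] //].
      have : [set: R] v by []. rewrite ocT => -[n _ nv]; by exists n.
    apply: sigma_algebra_bigcup => n; apply: sub_sigma_algebra.
    by exists Y => //; exists `](- n%:R), n%:R]%classic => //; exact: is_ocitv.
  by move=> /(_ measurableT X mX); rewrite setTI (_ : fst @^-1` X = X `*` setT) //; apply/seteqP; split=> [[? ?] //|[? ?] []].
have H2 (X : set (measurableTypeR R)) : measurable X -> <<s boxes >> (setT `*` X).
  move=> mX; have : measurable_fun [set: g_sigma_algebraType boxes] (snd : g_sigma_algebraType boxes -> measurableTypeR R).
    apply: (measurability (@ocitv R)) => // _ [Y oY <-]; rewrite setTI.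
    have -> : snd @^-1` Y = \bigcup_n (`](- n%:R), n%:R]%classic `*` Y) :> set (R * R).
      apply/seteqP; split=> [[u v] /= Yu|[u v] [n _ [/= ? _]] //].
      have : [set: R] u by []. rewrite ocT => -[n _ nv]; by exists n.
    apply: sigma_algebra_bigcup => n; apply: sub_sigma_algebra.
    by exists `](- n%:R), n%:R]%classic; [exact: is_ocitv|exists Y].
  by move=> /(_ measurableT X mX); rewrite setTI (_ : snd @^-1` X = setT `*` X) //; apply/seteqP; split=> [[? ?] //|[? ?] []].
apply: smallest_sub; first exact: smallest_sigma_algebra.
move=> A [[X mX <-]|[X mX <-]]; rewrite setTI.
  rewrite (_ : _ @^-1` X = X `*` setT); first exact: H1.
  by apply/seteqP; split=> [[? ?] //|[? ?] []].
rewrite (_ : _ @^-1` X = setT `*` X); first exact: H2.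
by apply/seteqP; split=> [[? ?] //|[? ?] []].
Qed.

Lemma bigboxP (M : R) x : bigbox M x -> `|x| <= `|M|.
Proof.
move=> /boxP[h1 h2 h3 h4]; have h := ler_norm M.
by rewrite prod_normE ge_max !ler_norml; apply/andP; split; apply/andP; split; lra.
Qed.

Lemma measurable_bigbox M : measurable (bigbox M). Proof. exact: measurableX. Qed.

Lemma bL2_indI (A : set RR) M : measurable A -> bL2 (ind (A `&` bigbox M)).
Proof.
move=> mA; apply: bL2_ind; first by apply: measurableI => //; exact: measurable_bigbox.
by exists `|M| => x [_ /bigboxP].
Qed.

Lemma I_ind (A : set RR) : measurable A -> itg (ind A) -> ((I (ind A))%:E = mu A)%E.
Proof. by move=> mA iA; rewrite IE // integral_indic // setIT. Qed.

Lemma n2_ind (A : set RR) : n2 (ind A) = I (ind A).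
Proof.
apply: eq_I => x; have [Ax|nA] := pselect (A x); first by rewrite ind1 // mulr1.
by rewrite ind0 // mul0r.
Qed.

Lemma ind_setD (A B : set RR) x : B `<=` A -> ind (A `\` B) x = ind A x - ind B x.
Proof.
move=> BA; have [Bx|nB] := pselect (B x).
  by rewrite (ind1 Bx) (ind1 (BA _ Bx)) subrr ind0 // => -[].
have [Ax|nA] := pselect (A x); first by rewrite (ind1 Ax) (ind0 nB) subr0 ind1.
by rewrite (ind0 nA) (ind0 nB) subr0 ind0 // => -[].
Qed.

(** By the pi-lambda theorem, starting from boxes. *)
Lemma mollifiable_measurable (A : set RR) M : measurable A -> mollifiable (ind (A `&` bigbox M)).
Proof.
move=> mA; have setIb : setI_closed boxes.
  move=> _ _ [X1 oX1 [Y1 oY1 <-]] [X2 oX2 [Y2 oY2 <-]].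
  exists (X1 `&` X2); first exact: ocitvI.
  by exists (Y1 `&` Y2); [exact: ocitvI|rewrite setXI].
pose H : set (set RR) := [set S | measurable S /\ mollifiable (ind (S `&` bigbox M))].
have lH : lambda_system setT H.
  split => //.
  - split; first exact: measurableT.
    by rewrite setTI; exact: mollifiable_box.
  - move=> S S' S'S [mS gS] [mS' gS']; split; first exact: measurableD.
    have -> : ind ((S `\` S') `&` bigbox M) = fun x => ind (S `&` bigbox M) x + (-1) * ind (S' `&` bigbox M) x.
      apply/funext => x; rewrite mulN1r -ind_setD; last exact: setSI.
      congr (ind _ x); apply/seteqP; split=> y.
        by move=> [[Sy nS'y] By]; split => // -[].
      by move=> [[Sy By] nS'y]; split => //; split => // S'y; apply: nS'y.
    apply: mollifiableD => //; first exact: bL2_indI.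
      by apply: bL2Z; exact: bL2_indI.
    by apply: mollifiableZ => //; exact: bL2_indI.
  - move=> F ndF HF; have mF n : measurable (F n) by case: (HF n).
    have mU : measurable (\bigcup_n F n) by exact: bigcupT_measurable.
    split => //; apply: mollifiable_lim; first exact: bL2_indI.
    move=> e e0; set U := \bigcup_n F n.
    have FU n : F n `&` bigbox M `<=` U `&` bigbox M by apply: setSI; exact: bigcup_sup.
    have fin (S : set RR) : measurable S -> ((I (ind (S `&` bigbox M)))%:E = mu (S `&` bigbox M))%E.
      move=> mS; apply: I_ind; last exact/bL2_itg/bL2_indI.
      by apply: measurableI => //; exact: measurable_bigbox.
    have cv : mu (F n `&` bigbox M) @[n --> \oo] --> mu (U `&` bigbox M).
      rewrite /U setI_bigcupl; apply: nondecreasing_cvg_mu.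
      - by move=> n; apply: measurableI => //; exact: measurable_bigbox.
      - by apply: bigcupT_measurable => n; apply: measurableI => //; exact: measurable_bigbox.
      - by move=> n m nm; apply/subsetPset; apply: setSI; apply/subsetPset; exact: ndF.
    move: cv; rewrite -fin // => cv.
    have cv' : I (ind (F n `&` bigbox M)) @[n --> \oo] --> I (ind (U `&` bigbox M)).
      move/fine_cvgP: cv => [_]; apply: cvg_trans; apply: near_eq_cvg.
      by near=> n; rewrite /= -fin.
    have /cvgrPdist_le/(_ e e0)[n _ /(_ n (leqnn n)) Hn] := cv'.
    exists (ind (F n `&` bigbox M)); split; [exact: bL2_indI|by case: (HF n)|].
    rewrite (_ : (fun x => _) = ind ((U `&` bigbox M) `\` (F n `&` bigbox M))); last first.
      by apply/funext => x; rewrite ind_setD //; exact: FU.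
    rewrite n2_ind (_ : I _ = I (ind (U `&` bigbox M)) - I (ind (F n `&` bigbox M))); last first.
      rewrite -IB; try exact/bL2_itg/bL2_indI.
      by apply: eq_I => x; rewrite ind_setD //; exact: FU.
    by rewrite (le_trans (ler_norm _)).
suff : H A by case.
have := measurable_boxes mA; apply: (lambda_system_subset setIb lH).
- move=> _ [X oX [Y oY <-]]; split.
    by apply: measurableX; exact: sub_sigma_algebra.
  have [a _ Ea] := ocitvI oX (is_ocitv (- M) M).
  have [b _ Eb] := ocitvI oY (is_ocitv (- M) M).
  rewrite /bigbox -setXI -Ea -Eb; exact: mollifiable_box.
- by [].
Unshelve. all: by end_near.
Qed.

Import HBNNSimple.

Lemma mollifiable_sum (s : seq R) (F : R -> R * R -> R) :
  (forall y, bL2 (F y)) -> (forall y, mollifiable (F y)) ->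
  bL2 (fun x => \sum_(y <- s) F y x) /\ mollifiable (fun x => \sum_(y <- s) F y x).
Proof.
move=> bF gF; elim: s => [|a s [IH1 IH2]].
  by under eq_fun do rewrite big_nil; split; [exact: bL2_0|exact: mollifiable0].
under eq_fun do rewrite big_cons.
by split; [exact: bL2D|exact: mollifiableD].
Qed.

Lemma n2_dominated_cvg (g : nat -> R * R -> R) h :
  (forall n, bL2 (g n)) -> bL2 h -> (forall n x, `|g n x| <= `|h x|) ->
  (forall x, g n x @[n --> \oo] --> 0) -> n2 (g n) @[n --> \oo] --> 0.
Proof.
move=> bg bh gh g0.
have mG n : measurable_fun [set: RR] (fun x => (g n x * g n x)%:E).
  by apply: mfE; apply: mfM; exact: bL2_mf.
have c0 x : (g n x * g n x)%:E @[n --> \oo] --> (0%E : \bar R).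
  apply/fine_cvgP; split; first exact: nearW.
  by rewrite -(mulr0 (0 : R)); apply: cvgM; exact: g0.
have dom n x : (`|(g n x * g n x)%:E| <= (h x * h x)%:E)%E.
  by rewrite lee_fin normrM -[h x * h x]ger0_norm ?normrM ?ler_pM // -expr2 sqr_ge0.
have [||_ _] := @dominated_convergence _ _ R mu setT measurableT (fun n x => (g n x * g n x)%:E) (cst 0%E)
  (fun x => (h x * h x)%:E) mG (measurable_cst _) _ (itgM bh bh) _.
- by apply: aeW => x _; exact: c0.
- by apply: aeW => x n _; exact: dom.
- by rewrite integral0 => /fine_cvgP[_]; apply: cvg_trans; apply: near_eq_cvg; apply: nearW => n; rewrite /n2 /ip I_E.
Qed.

(** By approximation from below with simple functions. *)
Lemma mollifiable_nonneg f : bL2 f -> (forall x, 0 <= f x) -> mollifiable f.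
Proof.
move=> bf f0; have mff := mfE (bL2_mf bf).
pose g := nnsfun_approx measurableT mff.
have cvg x : g n x @[n --> \oo] --> f x.
  have : (EFin \o g^~ x) @ \oo --> (EFin \o f) x.
    by apply: (@cvg_nnsfun_approx _ _ _ _ measurableT _ mff) => // y _; rewrite lee_fin.
  by move=> /fine_cvgP[].
have gle n x : g n x <= f x.
  rewrite -(cvg_lim _ (cvg x)) //; apply: (@nondecreasing_cvgn_le _ (fun n => g n x)).
    by move=> a b ab; have /lefP/(_ x) := nd_nnsfun_approx measurableT mff ab.
  by apply/cvg_ex; exists (f x).
have mg n : mf (g n) by exact: measurable_funP.
have g0 n x : 0 <= g n x by exact: fun_ge0.
have bg n : bL2 (g n).
  by apply: (@bL2_le _ 1 f) => // x; rewrite mul1r !ger0_norm.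
have [_ [M hM] _] := bf; pose N := Num.max 0 M + 1.
have mS n y : measurable ((g n : RR -> R) @^-1` [set y]).
  by have := mg n measurableT [set y] (measurable_set1 y); rewrite setTI.
have gg n : mollifiable (g n).
  have E : (g n : R * R -> R) = fun x => \sum_(y <- finmap.enum_fset (fset_set (range (g n)))) (y * ind ((g n @^-1` [set y]) `&` bigbox N) x).
    apply/funext => x; have [Bx|nB] := pselect (bigbox N x).
      rewrite fimfunE fsbig_finite //=; apply: eq_bigr => y _; congr (_ * _).
      have [Sx|nS] := pselect ((g n @^-1` [set y]) x); first by rewrite -/(ind _ x) !ind1.
      by rewrite -/(ind _ x) !ind0 // => -[].
    rewrite big1 => [|y _]; last by rewrite ind0 ?mulr0 // => -[].
    apply/le_anti; rewrite g0 andbT (le_trans (gle n x)) // hM // ltNge; apply/negP => xM.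
    apply: nB; have h0 : 0 <= Num.max 0 M by rewrite le_max lexx.
    have h1 : M <= Num.max 0 M by rewrite le_max lexx orbT.
    move: xM; rewrite prod_normE ge_max !ler_norml => /andP[/andP[? ?] /andP[? ?]].
    by apply/boxP; rewrite /N; split; lra.
  rewrite E; apply: (mollifiable_sum _ _ _).2 => y.
    by apply: bL2Z; exact: bL2_indI.
  by apply: mollifiableZ; [exact: bL2_indI|exact: mollifiable_measurable].
apply: mollifiable_lim => // e e0.
have c : n2 (fun x => f x - g n x) @[n --> \oo] --> 0.
  apply: (@n2_dominated_cvg _ f) => // [n|n x|x]; first exact: bL2B.
    by rewrite !ger0_norm ?subr_ge0 // lerBlDr lerDl.
  by rewrite -(subrr (f x)); apply: cvgB; [exact: cvg_cst|exact: cvg].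
have /cvgrPdist_le/(_ e e0)[n _ /(_ n (leqnn n)) /= Hn] := c.
exists (g n); split => //.
by move: Hn; rewrite sub0r normrN; apply: le_trans; exact: ler_norm.
Qed.

(** Mollification converges in the L2 norm: the functions with this property
    contain the indicators of boxes, and Young's inequality makes their set
    closed, so that the pi-lambda theorem gives all bounded measurable sets. *)
Lemma mollifiable_bL2 f : bL2 f -> mollifiable f.
Proof.
move=> bf; have bp : bL2 (fun x => Num.max (f x) 0).
  apply: (@bL2_le _ 1 f) => //; first by apply: measurable_maxr => //; exact: bL2_mf.
  move=> x; rewrite mul1r /Num.max; by case: ifPn => _; rewrite ?normr0 ?normrN //.
have bn : bL2 (fun x => Num.max (- f x) 0).
  apply: (@bL2_le _ 1 f) => //; first by apply: measurable_maxr => //; apply: mfN; exact: bL2_mf.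
  move=> x; rewrite mul1r /Num.max; by case: ifPn => _; rewrite ?normr0 ?normrN //.
have -> : f = fun x => Num.max (f x) 0 + (-1) * Num.max (- f x) 0.
  apply/funext => x; rewrite mulN1r; have [f0|f0] := leP 0 (f x).
    by rewrite (max_idPr _) ?subr0 // oppr_le0.
  by rewrite (max_idPl _) ?oppr_ge0 ?(ltW f0) // opprK add0r.
apply: mollifiableD => //; first exact: bL2Z.
  by apply: mollifiable_nonneg => // x; rewrite le_max lexx orbT.
by apply: mollifiableZ => //; apply: mollifiable_nonneg => // x; rewrite le_max lexx orbT.
Qed.
End Density.

(** * Completeness of L2 *)
Section Completeness.
Context {R : realType}.
Implicit Types (f g : R * R -> R) (x : R * R).
Local Notation RR := (measurableTypeR R * measurableTypeR R)%type.
Local Notation mu := (lebesgue2 R).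

Lemma I_null (N : set RR) f : measurable N -> mu N = 0%E -> itg f ->
  (forall x, ~ N x -> f x = 0) -> I f = 0.
Proof.
move=> mN N0 itf fN; rewrite I_E /Rintegral (negligible_integral mN measurableT itf N0).
rewrite (eq_integral (cst 0%E)) ?integral0 // => x; rewrite inE => -[_ Nx].
by rewrite /= fN.
Qed.

(** Pointwise convergence of a sequence whose increments are weighted square
    bounded: they are dominated by a geometric series of ratio 1/2. *)
Lemma cvg_weighted (u : nat -> R) (C : R) : 0 <= C ->
  (forall k, 4 ^+ k * (u k.+1 - u k) ^+ 2 <= C) -> cvgn u.
Proof.
move=> C0 H; have -> : u = (fun n => u 0%N + series (telescope u) n).
  by apply/funext => n; exact: eq_sum_telescope.
apply: is_cvgD; first exact: is_cvg_cst.
apply: normed_cvg; apply: (@series_le_cvg _ _ (geometric (C + 1) (2^-1))) => //.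
- by move=> n; exact: normr_ge0.
- by move=> n; rewrite /geometric /= mulr_ge0 ?addr_ge0 ?exprn_ge0 ?invr_ge0.
- move=> n; rewrite /geometric /= /telescope /=.
  have h2 : 0 < 2 ^+ n :> R by rewrite exprn_gt0.
  rewrite exprVn ler_pdivlMr //; have := H n.
  have -> : 4 ^+ n = (2 ^+ n) ^+ 2 :> R by rewrite -exprM mulnC exprM; congr (_ ^+ _); ring.
  rewrite -exprMn -(real_normK (num_real (_ * _))) normrM gtr0_norm // [`|_| * _]mulrC.
  set t := _ * _; have t0 : 0 <= t by rewrite mulr_ge0 // ltW.
  by move=> Ht; nra.
- by apply: is_cvg_geometric_series; rewrite ger0_norm ?invr_ge0 // invf_lt1 // ltr1n.
Qed.

(** Along a subsequence whose increments have squared norm at most [16^-k], the sum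
    of the squared increments with weights [4^k] is integrable, hence finite almost
    everywhere; [cvg_weighted] then gives the limit, and Fatou's lemma the rate of
    convergence. The sequences met below vanish outside a fixed ball, and so does
    their limit. *)
Lemma L2_complete (g : nat -> R * R -> R) (M : R) :
  (forall n, bL2 (g n)) -> (forall n x, M < `|x| -> g n x = 0) ->
  (forall e : R, 0 < e -> exists N : nat, forall m n, (N <= m)%N -> (N <= n)%N ->
     n2 (fun x => g m x - g n x) <= e) ->
  exists2 f, bL2 f & n2 (fun x => g n x - f x) @[n --> \oo] --> 0.
Proof.
move=> bg gM cau.
have e16 k : 0 < (16^-1) ^+ k :> R by rewrite exprn_gt0.
pose phi0 k := projT1 (cid (cau _ (e16 k))).
have phi0P k m n : (phi0 k <= m)%N -> (phi0 k <= n)%N -> n2 (fun x => g m x - g n x) <= (16^-1) ^+ k.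
  exact: (projT2 (cid (cau _ (e16 k)))).
pose phi k := (\sum_(i < k.+1) phi0 i)%N.
have phige k j : (k <= j)%N -> (phi0 k <= phi j)%N.
  move=> kj; have kj' : (k < j.+1)%N by [].
  by rewrite /phi (bigD1 (Ordinal kj')) //= leq_addr.
pose h k := g (phi k).
have bh k : bL2 (h k) by exact: bg.
have hP k i j : (k <= i)%N -> (k <= j)%N -> n2 (fun x => h i x - h j x) <= (16^-1) ^+ k.
  by move=> ki kj; apply: phi0P; exact: phige.
pose F k x := ((4 ^+ k) * (h k.+1 x - h k x) ^+ 2)%:E.
have F0 k x : (0 <= F k x)%E by rewrite lee_fin mulr_ge0 ?sqr_ge0 // exprn_ge0.
have itF k : itg (fun x => (4 ^+ k) * (h k.+1 x - h k x) ^+ 2).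
  by apply: itgZ; apply: bL2_itg2; exact: bL2B.
have mF k : measurable_fun [set: RR] (F k) by apply: mfE; exact: itg_mf (itF k).
pose S x := (\sum_(k <oo) F k x)%E.
have mS : measurable_fun [set: RR] S by apply: ge0_emeasurable_sum.
have S0 x : (0 <= S x)%E by apply: nneseries_ge0.
have iS : (\int[mu]_x S x < +oo)%E.
  rewrite integral_nneseries //.
  apply: (@le_lt_trans _ _ ((1 - 4^-1 : R)^-1)%:E); last exact: ltry.
  apply: lime_le; first by apply: is_cvg_nneseries => n _ _; exact: integral_ge0.
  apply: nearW => n.
  apply: (@le_trans _ _ (\sum_(0 <= k < n) ((4^-1 : R) ^+ k)%:E)%E).
    apply: lee_sum => k _; rewrite -IE // lee_fin IZ; last by apply: bL2_itg2; exact: bL2B.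
    have -> : I (fun x => (h k.+1 x - h k x) ^+ 2) = n2 (fun x => h k.+1 x - h k x).
      by apply: eq_I => x; rewrite expr2.
    apply: (@le_trans _ _ (4 ^+ k * (16^-1) ^+ k)); first by rewrite ler_wpM2l ?exprn_ge0 ?hP.
    by rewrite -exprMn (_ : 4 * 16^-1 = 4^-1) //; lra.
  rewrite sumEFin lee_fin.
  rewrite -[X in _ <= X]mul1r.
  apply: (le_trans _ (@geometric_le_lim R n 1 (4^-1) ler01 _ _)).
  - by rewrite /series /= /geometric /=; apply: ler_sum => i _; rewrite mul1r.
  - by rewrite invr_gt0.
  - by rewrite ger0_norm ?invr_ge0 // invf_lt1 // ltr1n.
have intS : mu.-integrable [set: RR] S.
  by apply/integrableP; split => //; under eq_integral => x _ do rewrite gee0_abs //.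
have [N [mN N0 HN]] := integrable_ae measurableT intS.
have finS x : ~ N x -> S x \is a fin_num.
  by move=> Nx; apply: contrapT => H; apply: Nx; apply: HN => /(_ Logic.I).
pose NC : set RR := ~` N.
have mNC : measurable NC by exact: measurableC.
pose h' k x := ind NC x * h k x.
have bh' k : bL2 (h' k) by apply: bmM => //; exact: bm_ind.
have cv x : cvgn (fun k => h' k x).
  have [Nx|Nx] := pselect (N x).
    rewrite (_ : (fun k => _) = fun=> 0); first exact: is_cvg_cst.
    by apply/funext => k; rewrite /h' ind0 ?mul0r // => /(_ Nx).
  apply: (@cvg_weighted _ (fine (S x))); first exact: fine_ge0.
  move=> k; rewrite /h' !ind1 // !mul1r -lee_fin fineK; last exact: finS.
  have := @nneseries_lim_ge R (fun k => F k x) xpredT 0 k.+1 (fun _ _ _ => F0 _ _).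
  apply: le_trans; rewrite big_nat_recr //= leeDr //.
  by apply: sume_ge0.
pose f x := limn (fun k => h' k x).
have cvf x : h' k x @[k --> \oo] --> f x by exact: cv.
have mff : mf f by apply: (@measurable_fun_cvg _ _ _ setT h') => // k; exact: bL2_mf.
have fat k : (\int[mu]_x ((f x - h' k x) ^+ 2)%:E <= ((16^-1) ^+ k)%:E)%E.
  have mj j : measurable_fun [set: RR] (fun x => ((h' j x - h' k x) ^+ 2)%:E).
    by apply: mfE; apply: mf_sqr; apply: mfB; exact: bL2_mf.
  have pj j (x : RR) : [set: RR] x -> (0 <= ((h' j x - h' k x) ^+ 2)%:E)%E.
    by move=> _; rewrite lee_fin sqr_ge0.
  (* Fatou: the squared distance to the limit is at most the liminf of those to later terms. *)
  have H := @fatou _ _ R mu setT measurableT (fun j x => ((h' j x - h' k x) ^+ 2)%:E) mj pj.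
  have -> : (\int[mu]_x ((f x - h' k x) ^+ 2)%:E =
      \int[mu]_x limn_einf (fun j => ((h' j x - h' k x) ^+ 2)%:E))%E.
    apply: eq_integral => x _; symmetry; apply: (@cvg_limn_einf_sup _ _ _ _).1.
    apply/fine_cvgP; split; first exact: nearW.
    under eq_fun do rewrite /= expr2; rewrite expr2.
    by apply: cvgM; (apply: cvgB; [exact: cvf|exact: cvg_cst]).
  apply: (le_trans H); rewrite limn_einf_lim.
  apply: lime_le; first exact: is_cvg_einfs.
  apply: nearW => n; apply: (@ereal_inf_le _ _ _ _).
  exists (\int[mu]_x ((h' (maxn n k) x - h' k x) ^+ 2)%:E)%E.
    by exists (maxn n k) => //=; exact: leq_maxl.
  have bd : bL2 (fun x => h (maxn n k) x - h k x) by exact: bL2B.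
  rewrite -IE; last by apply: bL2_itg2; exact: bL2B.
  rewrite lee_fin (le_trans _ (hP k (maxn n k) k _ _)) ?leq_maxr //.
  apply: le_I; [by apply: bL2_itg2; exact: bL2B|exact: itgM|] => x.
  rewrite /h' -mulrBr exprMn -expr2.
  have [Nx|Nx] := pselect (NC x); first by rewrite ind1 // expr1n mul1r.
  by rewrite ind0 // expr0n mul0r sqr_ge0.
have bd k : bL2 (fun x => f x - h' k x).
  split; first by apply: mfB => //; exact: bL2_mf.
    exists M => x Mx; rewrite /f (_ : (fun _ => _) = fun=> 0); last first.
      by apply/funext => j; rewrite /h' /h gM // mulr0.
    by rewrite lim_cst // /h' /h gM // mulr0 subrr.
  apply: itg_ge0 => //; first by apply: mf_sqr; apply: mfB => //; exact: bL2_mf.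
    by move=> x; exact: sqr_ge0.
  exact: le_lt_trans (fat k) (ltry _).
have bf : bL2 f.
  have -> : f = fun x => (f x - h' 0%N x) + h' 0%N x by apply/funext => x; rewrite subrK.
  exact: bL2D.
have fk k : n2 (fun x => f x - h' k x) <= (16^-1) ^+ k.
  rewrite -lee_fin IE; last exact: itgM.
  by under eq_integral => x _ do rewrite -expr2; exact: fat.
have hk k : n2 (fun x => h k x - h' k x) = 0.
  apply: (I_null mN N0); first by apply: itgM; exact: bL2B.
  by move=> x Nx; rewrite /h' ind1 // mul1r subrr mul0r.
exists f => //.
apply/cvgrPdist_le => e e0.
have c16 : (16^-1 : R) ^+ k @[k --> \oo] --> (0 : R).
  have := @cvg_geometric R 1 (16^-1); rewrite /geometric /=; under eq_fun do rewrite mul1r; apply.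
  by rewrite ger0_norm ?invr_ge0 // invf_lt1 // ltr1n.
have e6 : 0 < e / 6 by rewrite divr_gt0.
have /cvgrPdist_le/(_ _ e6)[k _ /(_ k (leqnn k)) /=] := c16.
rewrite sub0r normrN ger0_norm ?exprn_ge0 ?invr_ge0 // => hk6.
exists (phi0 k) => // n /= nk; rewrite sub0r normrN ger0_norm ?n2_ge0 //.
have b1 : bL2 (fun x => g n x - h k x) by exact: bL2B.
have b2 : bL2 (fun x => h k x - h' k x) by exact: bL2B.
have -> : n2 (fun x => g n x - f x) = n2 (fun x => (g n x - h k x) + ((h k x - h' k x) - (f x - h' k x))).
  by congr n2; apply/funext => x; ring.
apply: (le_trans (n2D b1 (bL2B b2 (bd k)))).
have := n2B b2 (bd k); rewrite hk => H2.
have := fk k; have : n2 (fun x => g n x - h k x) <= (16^-1) ^+ k by apply: phi0P => //; exact: phige.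
lra.
Qed.

End Completeness.

(** * Weak gradients *)
Section WeakGradient.
Context {R : realType}.
Implicit Types (f g h u v p q phi : R * R -> R) (x : R * R).
Local Notation RR := (measurableTypeR R * measurableTypeR R)%type.
Local Notation mu := (lebesgue2 R).

Definition cvgL2 (g : nat -> R * R -> R) f := n2 (fun x => g n x - f x) @[n --> \oo] --> 0.

Lemma cvgL2P (g : nat -> R * R -> R) f :
  cvgL2 g f <-> forall e : R, 0 < e -> \forall n \near \oo, n2 (fun x => g n x - f x) <= e.
Proof.
split=> [/cvgrPdist_le H e e0|H].
  have := H e e0; apply: filterS => n; rewrite sub0r normrN; apply: le_trans; exact: ler_norm.
apply/cvgrPdist_le => e e0; have := H e e0; apply: filterS => n.
by rewrite sub0r normrN ger0_norm ?n2_ge0.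
Qed.

Lemma cvgL2_ip (g : nat -> R * R -> R) f h : (forall n, bL2 (g n)) -> bL2 f -> bL2 h ->
  cvgL2 g f -> ip (g n) h @[n --> \oo] --> ip f h.
Proof.
move=> bg bf bh /cvgL2P H; apply/cvgrPdist_le => e e0.
have d0 : 0 < n2 h + 1 by rewrite ltr_wpDl // n2_ge0.
have := H (e ^+ 2 / (n2 h + 1)) (divr_gt0 (exprn_gt0 2 e0) d0); apply: filterS => n.
rewrite ler_pdivlMr // => Hn; rewrite distrC -ipBl //.
have := CS (bL2B (bg n) bf) bh; set t := ip _ _ => ct.
rewrite -(@ler_pXn2r _ 2) ?nnegrE ?(ltW e0) // real_normK ?num_real //.
apply: (le_trans ct); apply: le_trans Hn; rewrite ler_wpM2l ?n2_ge0 // lerDl //.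
Qed.

Definition moll f (n : nat) := conv f (mol (n.+1%:R^-1)).

Lemma tf_moll f n : bL2 f -> tf (moll f n).
Proof. by move=> bf; apply: tf_conv => //; exact: tf_mol. Qed.
Lemma bL2_moll f n : bL2 f -> bL2 (moll f n).
Proof. by move=> bf; exact/bL2_tf/tf_moll. Qed.
Lemma moll_cvg f : bL2 f -> cvgL2 (moll f) f.
Proof.
move=> bf; apply/cvgL2P => e e0; have [r0 r00 H] := mollifiable_bL2 bf e0.
have := near_infty_natSinv_lt (PosNum r00); apply: filterS => n /= nr.
by apply: H; rewrite invr_gt0 ltr0Sn.
Qed.
Lemma moll_supp f n x : moll f n x != 0 -> exists2 y, `|x - y| < n.+1%:R^-1 & f y != 0.
Proof. by apply: conv_supp => y; exact: mol_out. Qed.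

(** [(p, q)] is the gradient of [u] against the test functions supported in [B]. *)
Definition wg (B : set (R * R)) u p q := forall phi, tfB B phi ->
  ip u (px phi) = - ip p phi /\ ip u (py phi) = - ip q phi.

(** The derivative of the mollification at [x] tests the weak derivative with the
    translate at [x] of the mollifier. *)
Lemma px_moll u p q n : bL2 u -> bL2 p -> wg setT u p q -> px (moll u n) = moll p n.
Proof.
move=> bu bp H; have tk := tf_mol (R := R) n.+1%:R^-1; have sk := tfB_smooth tk.
rewrite /moll px_conv //; apply/funext => x.
have [H1 _] := H _ (tf_mol_sub n.+1%:R^-1 x).
have E : ip u (fun y => px (mol n.+1%:R^-1) (x - y)) = - ip u (px (fun y => mol n.+1%:R^-1 (x - y))).
  rewrite -IN; last by apply: itgM => //; exact/bL2_tf/tfB_dx/tf_mol_sub.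
  by apply: eq_I => y; rewrite px_sub // mulrN opprK.
by rewrite /conv E H1 opprK.
Qed.
Lemma py_moll u p q n : bL2 u -> bL2 q -> wg setT u p q -> py (moll u n) = moll q n.
Proof.
move=> bu bp H; have tk := tf_mol (R := R) n.+1%:R^-1; have sk := tfB_smooth tk.
rewrite /moll py_conv //; apply/funext => x.
have [_ H1] := H _ (tf_mol_sub n.+1%:R^-1 x).
have E : ip u (fun y => py (mol n.+1%:R^-1) (x - y)) = - ip u (py (fun y => mol n.+1%:R^-1 (x - y))).
  rewrite -IN; last by apply: itgM => //; exact/bL2_tf/tfB_dy/tf_mol_sub.
  by apply: eq_I => y; rewrite py_sub // mulrN opprK.
by rewrite /conv E H1 opprK.
Qed.

(** The part of [U] at distance at least [d] of its complement. *)
Definition inner (U : set (R * R)) (d : R) : set (R * R) := [set x | ball x d `<=` U].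

Lemma inner_measurable U d : measurable (inner U d : set RR).
Proof.
rewrite -[inner U d]setCK; apply: measurableC; apply: open2_measurable.
have -> : ~` inner U d = \bigcup_(y in ~` U) ball y d.
  apply/seteqP; split => [x /=|x [y /= nUy yx]].
    by move=> /existsNP[y] /not_implyP[xy nUy]; exists y => //; apply: ball_sym.
  by move=> H; apply: nUy; apply: H; apply: ball_sym.
by apply: bigcup_open => y _; exact: ball_open.
Qed.

Lemma innerS U d : 0 < d -> inner U d `<=` U.
Proof. by move=> d0 x; apply; exact: ballxx. Qed.

Lemma inner_cvg U x : open U -> U x -> \forall n \near \oo, inner U n.+1%:R^-1 x.
Proof.
move=> oU Ux; have /nbhs_ballP[r /= r0 rU] : nbhs x U by exact: open_nbhs_nbhs.
have := near_infty_natSinv_lt (PosNum r0); apply: filterS => n /= nr.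
by apply: subset_trans rU; apply: le_ball; exact: ltW.
Qed.

Lemma ind_inner_cvg U f x : open U -> ind (inner U n.+1%:R^-1) x * f x @[n --> \oo] --> ind U x * f x.
Proof.
move=> oU; have [Ux|nU] := pselect (U x).
  apply: cvg_near_cst; have := inner_cvg oU Ux; apply: filterS => n Hn.
  by rewrite !ind1.
rewrite (_ : (fun n : nat => _) = fun=> ind U x * f x); first exact: cvg_cst.
by apply/funext => n; rewrite !ind0 // => /innerS; rewrite invr_gt0 ltr0Sn => /(_ isT).
Qed.

(** A function orthogonal to all test functions supported in an open set vanishes
    there: it is tested against mollifications of itself, cut off near the boundary. *)
Lemma orthogonal_zero U f : open U -> bL2 f -> (forall phi, tfB U phi -> ip f phi = 0) ->
  n2 (fun x => ind U x * f x) = 0.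
Proof.
move=> oU bf H.
have mU := open2_measurable oU.
have bU : bL2 (fun x => ind U x * f x) by apply: bmM => //; exact: bm_ind.
pose g k x := ind (inner U k.+1%:R^-1) x * f x.
have bg k : bL2 (g k) by apply: bmM => //; apply: bm_ind; exact: inner_measurable.
have g0 k : n2 (g k) = 0.
  have c : ip (moll (g k) n) f @[n --> \oo] --> ip (g k) f.
    by apply: cvgL2_ip => //; [move=> n; exact: bL2_moll|exact: moll_cvg].
  have -> : n2 (g k) = ip (g k) f.
    apply: eq_I => x; rewrite /g; have [Ux|nU] := pselect (inner U k.+1%:R^-1 x).
      by rewrite ind1 // !mul1r.
    by rewrite ind0 // !mul0r.
  rewrite -(cvg_lim _ c) //; apply/cvg_lim => //.
  apply: cvg_near_cst.
  exists k.+1 => // n /= kn; rewrite ipC; apply: H.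
  have tm := tf_moll n (bg k); have [sm bm_ _] := tm; split => // x nUx.
  have dn : n.+1%:R^-1 < k.+1%:R^-1 :> R by rewrite ltf_pV2 ?posrE ?ltr0Sn // ltr_nat ltnS.
  have e0 : 0 < k.+1%:R^-1 - n.+1%:R^-1 :> R by rewrite subr_gt0.
  apply/nbhs_ballP; exists (k.+1%:R^-1 - n.+1%:R^-1) => //= y xy.
  apply/eqP; apply: contrapT => /negP/moll_supp[z yz gz].
  apply: nUx; have : inner U k.+1%:R^-1 z.
    by apply: contrapT => nz; move: gz; rewrite /g ind0 // mul0r eqxx.
  apply; rewrite -[k.+1%:R^-1](subrK n.+1%:R^-1) addrC.
  by apply: (@ball_triangle _ _ y); [apply: ball_sym; rewrite -ball_normE|apply: ball_sym].
have c : n2 (fun x => ind U x * f x - g n x) @[n --> \oo] --> 0.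
  apply: (@n2_dominated_cvg _ _ f) => // [n|n x|x]; first exact: bL2B.
    rewrite -mulrBl normrM ler_piMl // ler_norml.
    have /andP[? ?] := ind01 U x; have /andP[? ?] := ind01 (inner U n.+1%:R^-1) x; lra.
  rewrite -(subrr (ind U x * f x)); apply: cvgB; first exact: cvg_cst.
  exact: ind_inner_cvg.
have E n : n2 (fun x => ind U x * f x - g n x) = n2 (fun x => ind U x * f x).
  have -> : n2 (fun x => ind U x * f x - g n x) = n2 (fun x => ind U x * f x + (-1) * g n x).
    by congr n2; apply/funext => x; rewrite mulN1r.
  by rewrite n2_lin // g0 mulr0 addr0 ipC ip_n2_0 // mulr0 addr0.
by move: c; under eq_fun do rewrite E; move=> /cvg_lim <- //; rewrite lim_cst.
Qed.

End WeakGradient.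

(** * Sobolev spaces on bounded open sets *)
Section SobolevSpaces.
Context {R : realType}.
Implicit Types (f g h u v p q phi : R * R -> R) (x : R * R) (U : set (R * R)).
Local Notation RR := (measurableTypeR R * measurableTypeR R)%type.
Local Notation mu := (lebesgue2 R).

Definition bnd U := exists M : R, forall x, U x -> `|x| <= M.

Definition cut U f x := ind U x * f x.

Lemma cut_in U f x : U x -> cut U f x = f x.
Proof. by move=> Ux; rewrite /cut ind1 // mul1r. Qed.
Lemma cut_out U f x : ~ U x -> cut U f x = 0.
Proof. by move=> Ux; rewrite /cut ind0 // mul0r. Qed.

Lemma restrictE U f : f \_ U = cut U f.
Proof.
apply/funext => x; rewrite patchE; case: (boolP (x \in U)) => [|h].
  by rewrite inE => Ux; rewrite cut_in.
by rewrite cut_out // => Ux; move: h; rewrite mem_set.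
Qed.

Lemma powerR2 (t : R) : (`|t%:E| `^ 2%:R)%E = (t ^+ 2)%:E.
Proof.
by rewrite (_ : `|t%:E|%E = `|t|%:E) // poweR_EFin powR_mulrn // real_normK // num_real.
Qed.

Lemma Lnorm2E f : ('N[mu]_2[EFin \o f] = (\int[mu]_x (f x ^+ 2)%:E) `^ 2^-1)%E.
Proof. by rewrite unlock; congr poweR; apply: eq_integral => x _; rewrite -powerR2. Qed.

Lemma L2P U f : bnd U -> L2 U f <-> bL2 (cut U f).
Proof.
move=> [M hM]; rewrite /L2 restrictE; split => [|[mf1 b1 i1]].
  rewrite inE => /andP[]; rewrite !inE => /= mf1 /=; rewrite /finite_norm Lnorm2E => h.
  split => //; first by exists M => x Mx; rewrite cut_out // => /hM; rewrite leNgt Mx.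
  apply: itg_ge0; [exact: mf_sqr|by move=> x; exact: sqr_ge0|].
  rewrite ltey; apply/eqP => H; move: h; rewrite (eqy_poweR _ H) ?ltxx // invr_gt0 //.
rewrite inE; apply/andP; split; rewrite inE //= /finite_norm Lnorm2E.
by apply: poweR_lty; rewrite -IE // ltry.
Qed.

Lemma L2normE U f : bL2 (cut U f) -> L2norm U f = (Num.sqrt (n2 (cut U f)))%:E.
Proof.
move=> bf; rewrite /L2norm restrictE Lnorm2E -IE; last exact: bL2_itg2.
rewrite (_ : I _ = n2 (cut U f)); last by apply: eq_I => x; rewrite expr2.
by rewrite poweR_EFin powR12_sqrt // n2_ge0.
Qed.

Lemma bL2_cut U f : measurable (U : set RR) -> bL2 f -> bL2 (cut U f).
Proof. by move=> mU bf; apply: bmM => //; exact: bm_ind. Qed.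

Lemma cut_cut (U V : set (R * R)) f x : V `<=` U -> cut V (cut U f) x = cut V f x.
Proof.
by move=> VU; have [Vx|nV] := pselect (V x); [rewrite !cut_in //; exact: VU|rewrite !cut_out].
Qed.

Lemma RintegralU U h : \int[mu]_(x in U) h x = I (cut U h).
Proof. by rewrite Rintegral_mkcond restrictE I_E. Qed.

Definition der (i j : nat) phi := iter i (@px R) (iter j (@py R) phi).

Lemma partialE i j phi : partial i j phi = der i j phi.
Proof.
rewrite /partial /der; have -> : iter j dy phi = iter j (@py R) phi.
  by elim: j => //= j ->; rewrite pyE.
by elim: i => //= i ->; rewrite pxE.
Qed.

Lemma tfB_der B i j phi : tfB B phi -> tfB B (der i j phi).
Proof.
move=> t; have : tfB B (iter j (@py R) phi) by elim: j => //= j; exact: tfB_dy.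
by rewrite /der; elim: i => //= i IH /IH; exact: tfB_dx.
Qed.

(** Weak derivatives on a bounded set, in terms of functions cut off outside it. *)
Definition wd U i j u g := forall phi, tfB U phi ->
  ip (cut U u) (der i j phi) = (-1) ^+ (i + j) * ip (cut U g) phi.

Lemma is_weak_derivP U i j u g : bnd U ->
  is_weak_deriv U i j u g <-> bL2 (cut U g) /\ wd U i j u g.
Proof.
move=> bU; rewrite /is_weak_deriv (L2P _ bU).
have E v w : \int[mu]_(x in U) (v x * w x) = ip (cut U v) w.
  by rewrite RintegralU; apply: eq_I => x; rewrite /cut mulrA.
split=> -[bg H]; split => // phi.
  by move=> /tfB_test/H; rewrite !E partialE.
by move=> /test_tfB/H; rewrite !E partialE.
Qed.

(** The difference is orthogonal to all test functions of [U]. *)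
Lemma wd_unique U i j u g h : open U -> bL2 (cut U g) -> bL2 (cut U h) ->
  wd U i j u g -> wd U i j u h -> n2 (fun x => cut U g x - cut U h x) = 0.
Proof.
move=> oU bg bh H1 H2; have bd := bL2B bg bh.
rewrite -(orthogonal_zero oU bd).
  congr n2; apply/funext => x; have [Ux|nU] := pselect (U x); first by rewrite ind1 // mul1r.
  by rewrite ind0 // !cut_out // subrr mul0r.
move=> phi tphi; have bphi := bL2_tf (tfB_tf tphi).
rewrite ipBl //; have := H1 _ tphi; rewrite (H2 _ tphi) => /eqP.
by rewrite (inj_eq (mulfI _)) ?signr_eq0 // => /eqP ->; rewrite subrr.
Qed.

(** The representative chosen by [weakD] agrees almost everywhere with any other. *)
Lemma weakDP U i j u g : open U -> bnd U -> bL2 (cut U g) -> wd U i j u g ->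
  [/\ bL2 (cut U (weakD U i j u)), wd U i j u (weakD U i j u) &
     n2 (fun x => cut U (weakD U i j u) x - cut U g x) = 0].
Proof.
move=> oU bU bg H.
have : is_weak_deriv U i j u (weakD U i j u).
  rewrite /weakD; apply: xgetPex; exists g; exact/(is_weak_derivP _ _ _ _ bU).
by move=> /(is_weak_derivP _ _ _ _ bU)[b1 H1]; split => //; exact: wd_unique H.
Qed.

Lemma weakD_n2 U i j u g : open U -> bnd U -> bL2 (cut U g) -> wd U i j u g ->
  n2 (cut U (weakD U i j u)) = n2 (cut U g).
Proof. by move=> oU bU bg H; have [b1 _ E] := weakDP oU bU bg H; exact: n2_eq. Qed.

Lemma SobolevP k U u : bnd U -> Sobolev k U u <->
  bL2 (cut U u) /\ forall i j, (i + j <= k)%N -> exists2 g, bL2 (cut U g) & wd U i j u g.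
Proof.
move=> bU; rewrite /Sobolev (L2P _ bU); split=> -[b1 H]; split => // i j ij.
  by have [g /(is_weak_derivP _ _ _ _ bU)[? ?]] := H i j ij; exists g.
by have [g ? ?] := H i j ij; exists g; exact/(is_weak_derivP _ _ _ _ bU).
Qed.

Lemma wd0 U u : wd U 0 0 u u.
Proof. by move=> phi _; rewrite /der /= expr0 mul1r. Qed.

Lemma Sobolev_normE k U u (G : nat -> nat -> R * R -> R) : open U -> bnd U ->
  (forall i j, (i + j <= k)%N -> bL2 (cut U (G i j)) /\ wd U i j u (G i j)) ->
  Sobolev_norm k U u = (Num.sqrt (\sum_(i < k.+1) \sum_(j < k.+1 | (i + j <= k)%N) n2 (cut U (G i j))))%:E.
Proof.
move=> oU bU H; rewrite /Sobolev_norm.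
transitivity (sqrte ((\sum_(i < k.+1) \sum_(j < k.+1 | (i + j <= k)%N) n2 (cut U (G i j)))%R%:E)); last by [].
congr sqrte; rewrite -sumEFin; apply: eq_bigr => i _; rewrite -sumEFin; apply: eq_bigr => j ij.
have [bg Hg] := H _ _ ij; have [b1 _ _] := weakDP oU bU bg Hg.
by rewrite L2normE // -EFin_expe sqr_sqrtr ?n2_ge0 // (weakD_n2 oU bU bg Hg).
Qed.

Definition G1 u p q (i j : nat) := if i is 0%N then (if j is 0%N then u else q) else p.

Lemma Sobolev_norm1E U u p q : open U -> bnd U -> bL2 (cut U u) -> bL2 (cut U p) -> bL2 (cut U q) ->
  wd U 1 0 u p -> wd U 0 1 u q ->
  Sobolev_norm 1 U u = (Num.sqrt (n2 (cut U u) + n2 (cut U p) + n2 (cut U q)))%:E.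
Proof.
move=> oU bU bu bp bq Hp Hq; rewrite (@Sobolev_normE _ _ _ (G1 u p q)) //; last first.
  by case=> [|[|i]] [|[|j]] //= _; split => //; exact: wd0.
congr (Num.sqrt _)%:E; under eq_bigr => i _ do rewrite big_mkcond /=.
rewrite !big_ord_recl !big_ord0 /=.
by rewrite /bump /=; ring.
Qed.

Definition G2 u p q a b c (i j : nat) := match i, j with
  | 0%N, 0%N => u | 1%N, 0%N => p | 0%N, 1%N => q
  | 2%N, 0%N => a | 1%N, 1%N => b | _, _ => c end.

Lemma Sobolev_norm2E U u p q a b c : open U -> bnd U -> bL2 (cut U u) -> bL2 (cut U p) -> bL2 (cut U q) ->
  bL2 (cut U a) -> bL2 (cut U b) -> bL2 (cut U c) ->
  wd U 1 0 u p -> wd U 0 1 u q -> wd U 2 0 u a -> wd U 1 1 u b -> wd U 0 2 u c ->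
  Sobolev 2 U u /\
  Sobolev_norm 2 U u = (Num.sqrt (n2 (cut U u) + n2 (cut U p) + n2 (cut U q) +
     n2 (cut U a) + n2 (cut U b) + n2 (cut U c)))%:E.
Proof.
move=> oU bU bu bp bq ba bb bc Hp Hq Ha Hb Hc.
have K i j : (i + j <= 2)%N -> bL2 (cut U (G2 u p q a b c i j)) /\ wd U i j u (G2 u p q a b c i j).
  by case: i => [|[|[|i]]]; case: j => [|[|[|j]]] //= _; split => //; exact: wd0.
split; first by apply/SobolevP => //; split => // i j /K[? ?]; exists (G2 u p q a b c i j).
rewrite (@Sobolev_normE _ _ _ (G2 u p q a b c)) //.
congr (Num.sqrt _)%:E; under eq_bigr => i _ do rewrite big_mkcond /=.
rewrite !big_ord_recl !big_ord0 /=.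
by rewrite /bump /=; ring.
Qed.

End SobolevSpaces.

(** * Interior regularity for the Poisson equation *)

(** Closure properties of the classes [tfB] and [bL2], for composite expressions. *)
Ltac tfs := repeat first [assumption | apply: tfB_dx | apply: tfB_dy | apply: tf_moll | apply: tfBD
  | apply: tfBB | apply: tfBN | apply: tf_mol_sub | (apply: tfBMr; [|by apply: tfB_smooth; eassumption])
  | (apply: tfBMl; [by apply: tfB_smooth; eassumption|]) ].
Ltac bl := repeat first [assumption | exact: bL2_0 | apply: bL2D | apply: bL2B | apply: bL2N
  | apply: bmM | exact: bm_cst | apply: bmD | apply: bmN | apply: bmm | (apply: bm_tf; by tfs) | (apply: bL2_tf; by tfs) ].

Section Regularity.
Context {R : realType}.
Implicit Types (f g h u v w p q phi chi : R * R -> R) (x : R * R).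
Local Notation RR := (measurableTypeR R * measurableTypeR R)%type.

Lemma px_out f (M : R) : (forall x, M < `|x| -> f x = 0) -> forall x, M < `|x| -> px f x = 0 /\ py f x = 0.
Proof.
move=> fM x Mx; have vx : van f x.
  have : (fun y : R * R => `|y|) y @[y --> x] --> `|x| by apply: cvg_norm; exact: cvg_id.
  by move=> /cvgr_gt /(_ _ Mx); apply: filterS => y; exact: fM.
by split; apply: van_at; [exact: van_dx|exact: van_dy].
Qed.

(** The factor 2 comes from the inequality [n2B]. *)
Lemma cvgL2_bound (f : nat -> R * R -> R) g (K : R) : (forall n, bL2 (f n)) -> bL2 g -> cvgL2 f g ->
  (forall n, n2 (f n) <= K) -> n2 g <= 2 * K.
Proof.
move=> bf bg /cvgL2P c fK; apply/ler_addgt0Pr => e e0.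
have e2 : 0 < e / 2 by rewrite divr_gt0.
have [n _ /(_ n (leqnn n)) /= Hn] := c _ e2.
have -> : n2 g = n2 (fun x => f n x - (f n x - g x)) by congr n2; apply/funext => x; ring.
apply: (le_trans (n2B (bf n) (bL2B (bf n) bg))); have := fK n; lra.
Qed.

(** [w] has first derivatives [p, q] and second derivatives [a, b, c] in L2 of the plane. *)
Record H2 w p q a b c : Prop := {
  H2w : bL2 w; H2p : bL2 p; H2q : bL2 q; H2a : bL2 a; H2b : bL2 b; H2c : bL2 c;
  H2_wpq : wg setT w p q; H2_pab : wg setT p a b; H2_qbc : wg setT q b c }.

(** Interior regularity on the whole plane: the mollifications of a weak solution
    have second derivatives controlled by those of the right-hand side
    ([n2_div]), so that these form Cauchy sequences. *)
Lemma regularity w p q g : bL2 w -> bL2 p -> bL2 q -> bL2 g -> wg setT w p q ->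
  (forall phi, tf phi -> ip p (px phi) + ip q (py phi) = ip g phi) ->
  exists a b c, H2 w p q a b c /\ [/\ n2 a <= 2 * n2 g, n2 b <= 2 * n2 g & n2 c <= 2 * n2 g].
Proof.
move=> bw bp bq bg Hw Hg.
have tp n : tf (moll p n) by exact: tf_moll.
have tq n : tf (moll q n) by exact: tf_moll.
have tw n : tf (moll w n) by exact: tf_moll.
have pq n x : py (moll p n) x = px (moll q n) x.
  by rewrite -(px_moll n bw bp Hw) -(py_moll n bw bq Hw) schwarz //; exact: tfB_smooth (tw n).
have dv n x : px (moll p n) x + py (moll q n) x = - moll g n x.
  have tk := tf_mol (R := R) n.+1%:R^-1; have sk := tfB_smooth tk.
  have tks := tf_mol_sub n.+1%:R^-1 x.
  rewrite /moll px_conv // py_conv // /conv.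
  have E1 : ip p (fun y => px (mol n.+1%:R^-1) (x - y)) = - ip p (px (fun y => mol n.+1%:R^-1 (x - y))).
    rewrite -IN; last by apply: itgM => //; bl.
    by apply: eq_I => y; rewrite px_sub // mulrN opprK.
  have E2 : ip q (fun y => py (mol n.+1%:R^-1) (x - y)) = - ip q (py (fun y => mol n.+1%:R^-1 (x - y))).
    rewrite -IN; last by apply: itgM => //; bl.
    by apply: eq_I => y; rewrite py_sub // mulrN opprK.
  by rewrite E1 E2 -opprD Hg.
have [M pqM] : exists M, forall n x, M < `|x| -> moll p n x = 0 /\ moll q n x = 0.
  have [_ [M1 h1] _] := bp; have [_ [M2 h2] _] := bq.
  exists (Num.max M1 M2 + 1) => n x Mx.
  have n1 : n.+1%:R^-1 <= 1 :> R by rewrite invf_le1 ?ltr0Sn // ler1n.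
  have K f' M' : (forall x, M' < `|x| -> f' x = 0) -> M' <= Num.max M1 M2 -> moll f' n x = 0.
    move=> hM MM; apply/eqP; apply: contraTT Mx => /moll_supp[y xy fy].
    have yM : `|y| <= M' by rewrite leNgt; apply: contra fy => /hM ->.
    rewrite -leNgt -[x](subrK y) (le_trans (ler_normD _ _)) // addrC lerD //.
      exact: le_trans yM MM.
    by rewrite (le_trans (ltW xy)).
  by split; [apply: (K _ M1)|apply: (K _ M2)] => //; rewrite le_max lexx ?orbT.
have bound m n : [/\ n2 (fun x => px (moll p m) x - px (moll p n) x) <= n2 (fun x => moll g m x - moll g n x),
    n2 (fun x => py (moll p m) x - py (moll p n) x) <= n2 (fun x => moll g m x - moll g n x) &
    n2 (fun x => py (moll q m) x - py (moll q n) x) <= n2 (fun x => moll g m x - moll g n x)].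
  have sp k := tfB_smooth (tp k); have sq k := tfB_smooth (tq k).
  pose P x := moll p m x - moll p n x; pose Q x := moll q m x - moll q n x.
  have tP : tf P by exact: tfBB (tp m) (tp n). have tQ : tf Q by exact: tfBB (tq m) (tq n).
  have eP : px P = fun x => px (moll p m) x - px (moll p n) x by apply/funext => x; rewrite dxB.
  have eP' : py P = fun x => py (moll p m) x - py (moll p n) x by apply/funext => x; rewrite dyB.
  have eQ : py Q = fun x => py (moll q m) x - py (moll q n) x by apply/funext => x; rewrite dyB.
  have PQ x : py P x = px Q x by rewrite dyB // dxB // !pq.
  have := n2_div tP tQ PQ.
  have -> : n2 (fun x => px P x + py Q x) = n2 (fun x => moll g m x - moll g n x).
    rewrite -[RHS]n2N; congr n2; apply/funext => x; rewrite eP eQ.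
    by rewrite addrACA -opprD !dv; ring.
  rewrite -eP -eP' -eQ => H; have := n2_ge0 (px P); have := n2_ge0 (py P); have := n2_ge0 (px Q); have := n2_ge0 (py Q).
  by split; lra.
have cau : forall e : R, 0 < e -> exists N : nat, forall m n, (N <= m)%N -> (N <= n)%N ->
     n2 (fun x => moll g m x - moll g n x) <= e.
  move=> e e0; have e4 : 0 < e / 4 by rewrite divr_gt0.
  have /cvgL2P/(_ _ e4)[N _ HN] := moll_cvg bg; exists N => m n Nm Nn.
  have bgm k := bL2B (bL2_moll k bg) bg.
  rewrite (_ : n2 _ = n2 (fun x => (moll g m x - g x) - (moll g n x - g x))); last first.
    by congr n2; apply/funext => x; ring.
  by apply: (le_trans (n2B (bgm m) (bgm n))); have := HN _ Nm; have := HN _ Nn; rewrite /=; lra.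
have sup (f : nat -> R * R -> R) : (forall m n, n2 (fun x => f m x - f n x) <= n2 (fun x => moll g m x - moll g n x)) ->
   forall e : R, 0 < e -> exists N : nat, forall m n, (N <= m)%N -> (N <= n)%N -> n2 (fun x => f m x - f n x) <= e.
  by move=> H e /cau[N HN]; exists N => m n Nm Nn; rewrite (le_trans (H m n)) // HN.
have out1 n x : M < `|x| -> px (moll p n) x = 0 by move=> Mx; have [] := px_out (fun y My => (pqM n y My).1) Mx.
have out2 n x : M < `|x| -> py (moll p n) x = 0 by move=> Mx; have [] := px_out (fun y My => (pqM n y My).1) Mx.
have out3 n x : M < `|x| -> py (moll q n) x = 0 by move=> Mx; have [] := px_out (fun y My => (pqM n y My).2) Mx.
have b1 n : bL2 (px (moll p n)) by bl.
have b2 n : bL2 (py (moll p n)) by bl.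
have b3 n : bL2 (py (moll q n)) by bl.
have [a ba ca] := L2_complete b1 out1 (sup _ (fun m n => let: And3 h _ _ := bound m n in h)).
have [b bb cb] := L2_complete b2 out2 (sup _ (fun m n => let: And3 _ h _ := bound m n in h)).
have [c bc cc] := L2_complete b3 out3 (sup _ (fun m n => let: And3 _ _ h := bound m n in h)).
have lim_eq (s t : nat -> R) (S T : R) : (forall n, s n = t n) -> s n @[n --> \oo] --> S ->
    t n @[n --> \oo] --> T -> S = T.
  move=> st cs ct; have E : s = t by apply/funext.
  by rewrite E in cs; rewrite -(cvg_lim _ cs) // -(cvg_lim _ ct).
have limx p' a' (s : nat -> R * R -> R) : bL2 p' -> (forall n, bL2 (s n)) -> bL2 a' ->
    (forall n, s n = px (moll p' n)) -> cvgL2 s a' -> forall phi, tf phi -> ip p' (px phi) = - ip a' phi.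
  move=> bp' bs ba' sE cs phi tphi; have bphi := bL2_tf tphi; have bx := bL2_tf (tfB_dx tphi).
  apply: (@lim_eq (fun n => ip (moll p' n) (px phi)) (fun n => - ip (s n) phi)).
  - by move=> n; rewrite sE ibp_dx ?opprK //; apply: tfB_smooth; exact: tf_moll.
  - by apply: cvgL2_ip => //; [move=> n; exact: bL2_moll|exact: moll_cvg].
  - by apply: cvgN; exact: cvgL2_ip.
have limy p' a' (s : nat -> R * R -> R) : bL2 p' -> (forall n, bL2 (s n)) -> bL2 a' ->
    (forall n, s n = py (moll p' n)) -> cvgL2 s a' -> forall phi, tf phi -> ip p' (py phi) = - ip a' phi.
  move=> bp' bs ba' sE cs phi tphi; have bphi := bL2_tf tphi; have bx := bL2_tf (tfB_dy tphi).
  apply: (@lim_eq (fun n => ip (moll p' n) (py phi)) (fun n => - ip (s n) phi)).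
  - by move=> n; rewrite sE ibp_dy ?opprK //; apply: tfB_smooth; exact: tf_moll.
  - by apply: cvgL2_ip => //; [move=> n; exact: bL2_moll|exact: moll_cvg].
  - by apply: cvgN; exact: cvgL2_ip.
exists a, b, c; split.
  split => //.
  - by move=> phi tphi; split; [exact: (limx p a _ bp b1 ba (fun=> erefl) ca)|exact: (limy p b _ bp b2 bb (fun=> erefl) cb)].
  - move=> phi tphi; split; last exact: (limy q c _ bq b3 bc (fun=> erefl) cc).
    apply: (limx q b _ bq b2 bb _ cb) => // n; apply/funext => x; exact: pq.
have K n : [/\ n2 (px (moll p n)) <= n2 g, n2 (py (moll p n)) <= n2 g & n2 (py (moll q n)) <= n2 g].
  have yg : n2 (moll g n) <= n2 g by apply: young => //; rewrite invr_gt0 ltr0Sn.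
  have := n2_div (tp n) (tq n) (pq n).
  have -> : n2 (fun x => px (moll p n) x + py (moll q n) x) = n2 (moll g n).
    by rewrite -[RHS]n2N; congr n2; apply/funext => x; rewrite dv.
  have := n2_ge0 (px (moll p n)); have := n2_ge0 (py (moll p n)).
  have := n2_ge0 (px (moll q n)); have := n2_ge0 (py (moll q n)).
  by move=> *; split; lra.
by split; [apply: (cvgL2_bound b1 ba ca)|apply: (cvgL2_bound b2 bb cb)|apply: (cvgL2_bound b3 bc cc)] => n; case: (K n).
Qed.

End Regularity.

Section Localisation.
Context {R : realType}.
Implicit Types (f g h u v w p q phi chi U F P Q : R * R -> R) (x : R * R).
Local Notation RR := (measurableTypeR R * measurableTypeR R)%type.

(** [U] is a weak solution of the Poisson equation in [B], with gradient [(P, Q)]. *)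
Record poisson (B : set (R * R)) U P Q F : Prop := {
  poi_U : bL2 U; poi_P : bL2 P; poi_Q : bL2 Q; poi_F : bL2 F;
  poi_wg : wg B U P Q;
  poi_eq : forall phi, tfB B phi -> ip P (px phi) + ip Q (py phi) = ip F phi }.

Lemma ipDr f g h : bL2 f -> bL2 g -> bL2 h -> ip f (fun x => g x + h x) = ip f g + ip f h.
Proof. by move=> *; rewrite ipC ipDl // ![ip _ f]ipC. Qed.

Lemma ipBr f g h : bL2 f -> bL2 g -> bL2 h -> ip f (fun x => g x - h x) = ip f g - ip f h.
Proof. by move=> *; rewrite ipC ipBl // ![ip _ f]ipC. Qed.

Lemma ipZr c f g : bL2 f -> bL2 g -> ip f (fun x => c * g x) = c * ip f g.
Proof. by move=> *; rewrite ipC ipZl // [ip _ f]ipC. Qed.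

Lemma ipNr f g : bL2 f -> bL2 g -> ip f (fun x => - g x) = - ip f g.
Proof.
move=> bf bg; rewrite -mulN1r -ipZr //; congr ip; apply/funext => x; ring.
Qed.

Lemma n2_mul (B : set (R * R)) m f (K : R) : measurable (B : set RR) -> tfB B m -> bL2 f ->
  (forall x, `|m x| <= K) -> n2 (fun x => m x * f x) <= K ^+ 2 * n2 (cut B f).
Proof.
move=> mB tm bf hK; apply: n2_le; first exact: bL2_cut.
  by apply: bmM => //; exact: bm_tf (tfB_tf tm).
move=> x; have [Bx|nB] := pselect (B x); first by rewrite cut_in // normrM ler_wpM2r.
by rewrite (tfB_out tm nB) mul0r normr0 mulr_ge0 // (le_trans _ (hK x)).
Qed.

(** The product of [chi] with a solution solves the Poisson equation on the whole
    plane, with a right-hand side involving [U] and its gradient only: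
    [chi F - 2 grad chi . (P, Q) - U lap chi]. The constant depends on [chi] only. *)
Lemma localisation (B : set (R * R)) chi : measurable (B : set RR) -> tfB B chi ->
  exists2 C : R, 0 <= C & forall U P Q F, poisson B U P Q F ->
    exists w p q a b c, [/\ H2 w p q a b c, (forall x, w x = chi x * U x) &
      let N := n2 (cut B F) + n2 (cut B P) + n2 (cut B Q) + n2 (cut B U) in
      [/\ n2 w <= C * N, n2 p <= C * N, n2 q <= C * N & [/\ n2 a <= C * N, n2 b <= C * N & n2 c <= C * N]]].
Proof.
move=> mB tchi; have schi := tfB_smooth tchi; have tT := tfB_tf tchi.
pose m1 x := (-2) * px chi x; pose m2 x := (-2) * py chi x.
pose m0 x := - (px (px chi) x + py (py chi) x).
have tm1 : tfB B m1 by apply: tfBZ; exact: tfB_dx.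
have tm2 : tfB B m2 by apply: tfBZ; exact: tfB_dy.
have tm0 : tfB B m0 by apply: tfBN; apply: tfBD; [apply: tfB_dx; exact: tfB_dx|apply: tfB_dy; exact: tfB_dy].
have [K0 K00 h0] := tf_bound tT.
have [K1 K10 h1] := tf_bound (tfB_dx tT); have [K2 K20 h2] := tf_bound (tfB_dy tT).
have [K3 K30 h3] := tf_bound (tfB_tf tm1); have [K4 K40 h4] := tf_bound (tfB_tf tm2).
have [K5 K50 h5] := tf_bound (tfB_tf tm0).
pose K := K0 + K1 + K2 + K3 + K4 + K5.
exists (8 * K ^+ 2); first by rewrite mulr_ge0 ?sqr_ge0.
move=> U P Q F [bU bP bQ bF Hwg Heq].
have K00' : 0 <= K by rewrite /K; lra.
have bd m f : tfB B m -> bL2 f -> (forall x, `|m x| <= K) -> n2 (fun x => m x * f x) <= K ^+ 2 * n2 (cut B f).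
  by move=> *; exact: n2_mul.
have k0 x : `|chi x| <= K by rewrite (le_trans (h0 x)) // /K; lra.
have k1 x : `|px chi x| <= K by rewrite (le_trans (h1 x)) // /K; lra.
have k2 x : `|py chi x| <= K by rewrite (le_trans (h2 x)) // /K; lra.
have k3 x : `|m1 x| <= K by rewrite (le_trans (h3 x)) // /K; lra.
have k4 x : `|m2 x| <= K by rewrite (le_trans (h4 x)) // /K; lra.
have k5 x : `|m0 x| <= K by rewrite (le_trans (h5 x)) // /K; lra.
have bm_ m : tfB B m -> forall f, bL2 f -> bL2 (fun x => m x * f x).
  by move=> tm f bf; apply: bmM => //; exact: bm_tf (tfB_tf tm).
have t1 := tfB_dx tchi; have t2 := tfB_dy tchi.
pose w x := chi x * U x.
pose p x := chi x * P x + px chi x * U x.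
pose q x := chi x * Q x + py chi x * U x.
pose g x := (chi x * F x + m1 x * P x) + (m2 x * Q x + m0 x * U x).
have bw : bL2 w by exact: bm_.
have bp : bL2 p by apply: bL2D; exact: bm_.
have bq : bL2 q by apply: bL2D; exact: bm_.
have bg : bL2 g by apply: bL2D; apply: bL2D; exact: bm_.
have ipm m f phi : ip (fun x => m x * f x) phi = ip f (fun x => m x * phi x).
  by apply: eq_I => x; ring.
(* The weak derivative [f'] of [f], tested with a product. Here [d] and [D] are the
   same partial derivative. *)
have key c f f' d D phi : bL2 f -> bL2 f' -> tfB B c -> tf phi ->
   (forall psi, tfB B psi -> ip f (D psi) = - ip f' psi) ->
   (forall x, D (fun y => c y * phi y) x = d c x * phi x + c x * d phi x) ->
   tf (d phi) -> tfB B (d c) ->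
   ip f (fun x => c x * d phi x) = - ip f' (fun x => c x * phi x) - ip f (fun x => d c x * phi x).
  move=> bf bf' tc tphi HD dE td tdc; have sphi := tfB_smooth tphi; have sdphi := tfB_smooth td.
  have tcp : tfB B (fun x => c x * phi x) by apply: tfBMr.
  rewrite -(HD _ tcp) -ipBr //.
  - by congr ip; apply/funext => x; rewrite dE; ring.
  - have -> : D (fun y => c y * phi y) = fun x => d c x * phi x + c x * d phi x by apply/funext.
    by apply: bL2D; apply: bL2_tf; apply: (@tfB_tf _ B); apply: tfBMr.
  - by apply: bL2_tf; apply: (@tfB_tf _ B); apply: tfBMr.
have keyx c phi : tfB B c -> tf phi ->
    ip U (fun x => c x * px phi x) = - ip P (fun x => c x * phi x) - ip U (fun x => px c x * phi x).
  move=> tc tphi; apply: (key c U P (@px R) (@px R) phi bU bP tc tphi (fun psi H => (Hwg psi H).1) _ (tfB_dx tphi) (tfB_dx tc)).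
  by move=> x; rewrite (dxM (tfB_smooth tc) (tfB_smooth tphi)).
have keyy c phi : tfB B c -> tf phi ->
    ip U (fun x => c x * py phi x) = - ip Q (fun x => c x * phi x) - ip U (fun x => py c x * phi x).
  move=> tc tphi; apply: (key c U Q (@py R) (@py R) phi bU bQ tc tphi (fun psi H => (Hwg psi H).2) _ (tfB_dy tphi) (tfB_dy tc)).
  by move=> x; rewrite (dyM (tfB_smooth tc) (tfB_smooth tphi)).
have Hw : wg setT w p q.
  move=> phi tphi; have bphi := bL2_tf tphi.
  by split; rewrite /p /q /w ipDl ?ipm ?opprD ?keyx ?keyy //; exact: bm_.
have Hg phi : tf phi -> ip p (px phi) + ip q (py phi) = ip g phi.
  move=> tphi; have sphi := tfB_smooth tphi; have bphi := bL2_tf tphi.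
  have tcp : tfB B (fun x => chi x * phi x) by apply: tfBMr.
  have bx := bL2_tf (tfB_dx tphi); have by_ := bL2_tf (tfB_dy tphi).
  have bms m psi : tfB B m -> tf psi -> bL2 (fun x => m x * psi x) by move=> tm tpsi; apply: bm_ => //; exact: bL2_tf.
  have tpx := tfB_dx tphi; have tpy := tfB_dy tphi.
  have t11 := tfB_dx t1; have t22 := tfB_dy t2.
  have c1 : ip P (fun x => chi x * px phi x) + ip Q (fun x => chi x * py phi x) =
     ip F (fun x => chi x * phi x) - ip P (fun x => px chi x * phi x) - ip Q (fun x => py chi x * phi x).
    have ex : px (fun x => chi x * phi x) = fun x => px chi x * phi x + chi x * px phi x.
      by apply/funext => x; rewrite dxM.
    have ey : py (fun x => chi x * phi x) = fun x => py chi x * phi x + chi x * py phi x.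
      by apply/funext => x; rewrite dyM.
    rewrite -(Heq _ tcp) ex ey !ipDr //; try exact: bms.
    ring.
  have c2 : ip U (fun x => m0 x * phi x) = - ip U (fun x => px (px chi) x * phi x) - ip U (fun x => py (py chi) x * phi x).
    have hA := bms _ _ t11 tphi; have hB := bms _ _ t22 tphi.
    rewrite -opprD -(ipDr bU hA hB) -(ipNr bU (bL2D hA hB)).
    by congr ip; apply/funext => x; rewrite /m0; ring.
  have c3 : ip P (fun x => m1 x * phi x) = - 2 * ip P (fun x => px chi x * phi x).
    by rewrite -(ipZr _ bP (bms _ _ t1 tphi)); congr ip; apply/funext => x; rewrite /m1; ring.
  have c4 : ip Q (fun x => m2 x * phi x) = - 2 * ip Q (fun x => py chi x * phi x).
    by rewrite -(ipZr _ bQ (bms _ _ t2 tphi)); congr ip; apply/funext => x; rewrite /m2; ring.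
  rewrite /p /q /g !ipDl //; try (by repeat first [exact: bm_ | apply: bL2D]).
  rewrite !ipm keyx // keyy // c2 c3 c4.
  by move: c1 => /eqP; rewrite -subr_eq0 => /eqP c1; apply/eqP; rewrite -subr_eq0 -c1; apply/eqP; ring.
have [a [b [c [H [na nb nc]]]]] := regularity bw bp bq bg Hw Hg.
exists w, p, q, a, b, c; split => // N.
have N1 := n2_ge0 (cut B F). have N2 := n2_ge0 (cut B P).
have N3 := n2_ge0 (cut B Q). have N4 := n2_ge0 (cut B U).
have KK : 0 <= K ^+ 2 by exact: sqr_ge0.
have w1 := bd _ _ tchi bU k0; have w2 := bd _ _ tchi bP k0; have w3 := bd _ _ tchi bQ k0; have w4 := bd _ _ tchi bF k0.
have w5 := bd _ _ t1 bU k1; have w6 := bd _ _ t2 bU k2.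
have w7 := bd _ _ tm1 bP k3; have w8 := bd _ _ tm2 bQ k4; have w9 := bd _ _ tm0 bU k5.
have ng : n2 g <= 4 * (K ^+ 2 * N).
  apply: (le_trans (n2D _ _)); try (apply: bL2D; exact: bm_).
  have := n2D (bm_ _ tchi _ bF) (bm_ _ tm1 _ bP).
  have := n2D (bm_ _ tm2 _ bQ) (bm_ _ tm0 _ bU); rewrite /N !mulrDr; lra.
have np : n2 p <= 8 * (K ^+ 2 * N).
  apply: (le_trans (n2D (bm_ _ tchi _ bP) (bm_ _ t1 _ bU))).
  have := mulr_ge0 KK N1; have := mulr_ge0 KK N2; have := mulr_ge0 KK N3; have := mulr_ge0 KK N4.
  by rewrite /N !mulrDr; lra.
have nq : n2 q <= 8 * (K ^+ 2 * N).
  apply: (le_trans (n2D (bm_ _ tchi _ bQ) (bm_ _ t2 _ bU))).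
  have := mulr_ge0 KK N1; have := mulr_ge0 KK N2; have := mulr_ge0 KK N3; have := mulr_ge0 KK N4.
  by rewrite /N !mulrDr; lra.
have nw : n2 w <= 8 * (K ^+ 2 * N).
  apply: (le_trans w1).
  have := mulr_ge0 KK N1; have := mulr_ge0 KK N2; have := mulr_ge0 KK N3; have := mulr_ge0 KK N4.
  by rewrite /N !mulrDr; lra.
have -> : 8 * K ^+ 2 * N = 8 * (K ^+ 2 * N) by rewrite mulrA.
by split => //; split; lra.
Qed.
End Localisation.

(** * Symmetrisation by reflections *)
Section Symmetry.
Context {R : realType}.
Implicit Types (f g h u v w p q phi chi U F P Q A B : R * R -> R) (x : R * R).
Local Notation RR := (measurableTypeR R * measurableTypeR R)%type.

(** The involutive affine isometries of the plane: the identity, the reflections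
    across a line and the reflections at a point. The linear part is the matrix
    with rows [(a, b)] and [(b, d)]; the first three equations say that its square is the
    identity, the last two that the affine map is then an involution. *)
Record iso := Iso {
  iso_p : R * R; iso_a : R; iso_b : R; iso_d : R;
  iso_ab : iso_a ^+ 2 + iso_b ^+ 2 = 1;
  iso_bd : iso_b ^+ 2 + iso_d ^+ 2 = 1;
  iso_ad : iso_b * (iso_a + iso_d) = 0;
  iso_p1 : iso_p.1 + iso_a * iso_p.1 + iso_b * iso_p.2 = 0;
  iso_p2 : iso_p.2 + iso_b * iso_p.1 + iso_d * iso_p.2 = 0 }.

Definition iso_fun (s : iso) := aff (iso_p s) (iso_a s) (iso_b s) (iso_b s) (iso_d s).
Coercion iso_fun : iso >-> Funclass.

Lemma iso_det (s : iso) : `|iso_a s * iso_d s - iso_b s * iso_b s| = 1.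
Proof.
case: s => p a b d /= h1 h2 h3 _ _; apply/eqP; rewrite -sqrp_eq1 ?normr_ge0 // -normrX ger0_norm ?sqr_ge0 //.
apply/eqP; have -> : (a * d - b * b) ^+ 2 = (a ^+ 2 + b ^+ 2) * (b ^+ 2 + d ^+ 2) - (b * (a + d)) ^+ 2 by ring.
by rewrite h1 h2 h3 expr0n /=; ring.
Qed.

Lemma isoK (s : iso) x : s (s x) = x.
Proof.
case: s => p a b d /= h1 h2 h3 h4 h5; rewrite /iso_fun /aff /=; case: x => x1 x2 /=; congr pair.
  transitivity (p.1 + a * p.1 + b * p.2 + (a ^+ 2 + b ^+ 2) * x1 + b * (a + d) * x2); first by ring.
  by rewrite h4 h1 h3; ring.
transitivity (p.2 + b * p.1 + d * p.2 + (b ^+ 2 + d ^+ 2) * x2 + b * (a + d) * x1); first by ring.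
by rewrite h5 h2 h3; ring.
Qed.

Lemma bL2_iso (s : iso) f : bL2 f -> bL2 (fun x => f (s x)).
Proof. by move=> bf; exact: bL2_aff (iso_det s) bf. Qed.

Lemma ip_iso (s : iso) f g : bL2 f -> bL2 g -> ip (fun x => f (s x)) g = ip f (fun x => g (s x)).
Proof.
move=> bf bg; rewrite -[RHS](ip_aff (iso_p s) (iso_det s)) //; last exact: bL2_iso.
by congr ip; apply/funext => x; congr g; rewrite -[in LHS](isoK s x).
Qed.

(** The gradient of [f o s] is [(isox s P Q, isoy s P Q)] if that of [f] is [(P, Q)]. *)
Definition isox (s : iso) P Q x := iso_a s * P (s x) + iso_b s * Q (s x).
Definition isoy (s : iso) P Q x := iso_b s * P (s x) + iso_d s * Q (s x).

Lemma px_iso (s : iso) f x : smooth f -> px (fun y => f (s y)) x = isox s (px f) (py f) x.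
Proof. exact: dx_aff. Qed.
Lemma py_iso (s : iso) f x : smooth f -> py (fun y => f (s y)) x = isoy s (px f) (py f) x.
Proof. exact: dy_aff. Qed.

Lemma tf_iso (s : iso) f : tf f -> tf (fun x => f (s x)).
Proof. by move=> tphi; exact: (tfB_aff (iso_det s) (fun _ _ => Logic.I) tphi). Qed.

Lemma bL2_lin (a b : R) f g : bL2 f -> bL2 g -> bL2 (fun x => a * f x + b * g x).
Proof. by move=> bf bg; apply: bL2D; exact: bL2Z. Qed.

Lemma ip_linl (a b : R) f g h : bL2 f -> bL2 g -> bL2 h ->
  ip (fun x => a * f x + b * g x) h = a * ip f h + b * ip g h.
Proof.
move=> bf bg bh; rewrite (ipDl (bL2Z a bf) (bL2Z b bg) bh).
by rewrite (ipZl a bf bh) (ipZl b bg bh).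
Qed.

Lemma ip_linr (a b : R) f g h : bL2 f -> bL2 g -> bL2 h ->
  ip h (fun x => a * f x + b * g x) = a * ip h f + b * ip h g.
Proof. by move=> *; rewrite ipC ip_linl // ![ip _ h]ipC. Qed.

Lemma wg_iso (s : iso) u p q : bL2 u -> bL2 p -> bL2 q -> wg setT u p q ->
  wg setT (fun x => u (s x)) (isox s p q) (isoy s p q).
Proof.
move=> bu bp bq H phi tphi; have sphi := tfB_smooth tphi; have bphi := bL2_tf tphi.
have ts := tf_iso s tphi; have [H1 H2] := H _ ts.
have bx := bL2_tf (tfB_dx tphi); have by_ := bL2_tf (tfB_dy tphi).
have bxs := bL2_tf (tfB_dx ts); have bys := bL2_tf (tfB_dy ts); have bs := bL2_tf ts.
have [_ _ E1 E2] : [/\ True, True, (fun x => px phi (s x)) =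
    (fun x => iso_a s * px (fun y => phi (s y)) x + iso_b s * py (fun y => phi (s y)) x)
  & (fun x => py phi (s x)) =
    (fun x => iso_b s * px (fun y => phi (s y)) x + iso_d s * py (fun y => phi (s y)) x)].
  split => //; apply/funext => x; rewrite px_iso // py_iso // /isox /isoy.
    transitivity ((iso_a s ^+ 2 + iso_b s ^+ 2) * px phi (s x) + iso_b s * (iso_a s + iso_d s) * py phi (s x)); last by ring.
    by rewrite iso_ab iso_ad; ring.
  transitivity ((iso_b s ^+ 2 + iso_d s ^+ 2) * py phi (s x) + iso_b s * (iso_a s + iso_d s) * px phi (s x)); last by ring.
  by rewrite iso_bd iso_ad; ring.
by split; rewrite (ip_iso s) // ?E1 ?E2 ip_linr // H1 H2 /isox /isoy ip_linl //; try exact: bL2_iso;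
  rewrite !(ip_iso s) //; ring.
Qed.

(** With coefficients 1 and -1 this gives the even and odd parts, and extensions by reflection. *)
Fixpoint act (l : seq (R * iso)) f x :=
  if l is e :: l' then e.1 * f (e.2 x) + act l' f x else 0.
Fixpoint actx (l : seq (R * iso)) P Q x :=
  if l is e :: l' then e.1 * isox e.2 P Q x + actx l' P Q x else 0.
Fixpoint acty (l : seq (R * iso)) P Q x :=
  if l is e :: l' then e.1 * isoy e.2 P Q x + acty l' P Q x else 0.

Lemma bL2_isox s P Q : bL2 P -> bL2 Q -> bL2 (isox s P Q).
Proof. by move=> bP bQ; apply: bL2_lin; exact: bL2_iso. Qed.
Lemma bL2_isoy s P Q : bL2 P -> bL2 Q -> bL2 (isoy s P Q).
Proof. by move=> bP bQ; apply: bL2_lin; exact: bL2_iso. Qed.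

Lemma bL2_act l f : bL2 f -> bL2 (act l f).
Proof.
move=> bf; elim: l => [|e l IH]; first exact: bL2_0.
by apply: bL2D => //; apply: bL2Z; exact: bL2_iso.
Qed.
Lemma bL2_actx l P Q : bL2 P -> bL2 Q -> bL2 (actx l P Q).
Proof.
move=> bP bQ; elim: l => [|e l IH]; first exact: bL2_0.
by apply: bL2D => //; apply: bL2Z; exact: bL2_isox.
Qed.
Lemma bL2_acty l P Q : bL2 P -> bL2 Q -> bL2 (acty l P Q).
Proof.
move=> bP bQ; elim: l => [|e l IH]; first exact: bL2_0.
by apply: bL2D => //; apply: bL2Z; exact: bL2_isoy.
Qed.

Lemma tf_act l f : tf f -> tf (act l f).
Proof.
move=> t; elim: l => [|e l IH].
  by have -> : act [::] f = (fun x => 0 * f x) by [apply/funext => x; rewrite /= mul0r]; exact: tfBZ.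
by apply: tfBD => //; apply: tfBZ; exact: tf_iso.
Qed.

Lemma px_act l f : tf f -> px (act l f) = actx l (px f) (py f).
Proof.
move=> t; have st := tfB_smooth t; apply/funext => x; elim: l => [|e l IH]; first exact: dx_cst.
have ti := tf_iso e.2 t; have si := tfB_smooth ti.
transitivity (e.1 * isox e.2 (px f) (py f) x + actx l (px f) (py f) x) => //.
by rewrite -IH -(px_iso e.2 x st) -(dxZ _ si) -(dxD (smoothZ _ si) (tfB_smooth (tf_act l t))).
Qed.
Lemma py_act l f : tf f -> py (act l f) = acty l (px f) (py f).
Proof.
move=> t; have st := tfB_smooth t; apply/funext => x; elim: l => [|e l IH]; first exact: dy_cst.
have ti := tf_iso e.2 t; have si := tfB_smooth ti.
transitivity (e.1 * isoy e.2 (px f) (py f) x + acty l (px f) (py f) x) => //.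
by rewrite -IH -(py_iso e.2 x st) -(dyZ _ si) -(dyD (smoothZ _ si) (tfB_smooth (tf_act l t))).
Qed.

Lemma ip0l f : ip (fun=> 0) f = 0.
Proof. by rewrite /ip (eq_I (g := fun=> 0)) ?I0 // => x; rewrite mul0r. Qed.
Lemma ip0r f : ip f (fun=> 0) = 0.
Proof. by rewrite ipC ip0l. Qed.

Lemma ip_act l f g : bL2 f -> bL2 g -> ip (act l f) g = ip f (act l g).
Proof.
move=> bf bg; elim: l => [|e l IH]; first by rewrite ip0l ip0r.
have b1 := bL2_iso e.2 bf; have b2 := bL2_iso e.2 bg; have b3 := bL2_act l bf; have b4 := bL2_act l bg.
rewrite (ipDl (bL2Z _ b1) b3 bg) (ipDr bf (bL2Z _ b2) b4).
by rewrite (ipZl _ b1 bg) (ipZr _ bf b2) ip_iso // IH.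
Qed.

Lemma energy_act l P Q A B : bL2 P -> bL2 Q -> bL2 A -> bL2 B ->
  ip (actx l P Q) A + ip (acty l P Q) B = ip P (actx l A B) + ip Q (acty l A B).
Proof.
move=> bP bQ bA bB; elim: l => [|e l IH]; first by rewrite !ip0l !ip0r.
have b1 := bL2_isox e.2 bP bQ; have b2 := bL2_isoy e.2 bP bQ.
have b3 := bL2_isox e.2 bA bB; have b4 := bL2_isoy e.2 bA bB.
have b5 := bL2_actx l bP bQ; have b6 := bL2_acty l bP bQ.
have b7 := bL2_actx l bA bB; have b8 := bL2_acty l bA bB.
rewrite (ipDl (bL2Z _ b1) b5 bA) (ipDl (bL2Z _ b2) b6 bB) (ipDr bP (bL2Z _ b3) b7) (ipDr bQ (bL2Z _ b4) b8).
rewrite (ipZl _ b1 bA) (ipZl _ b2 bB) (ipZr _ bP b3) (ipZr _ bQ b4).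
rewrite addrACA IH [RHS]addrACA; congr (_ + _); rewrite -!mulrDr; congr (_ * _).
have i1 := bL2_iso e.2 bP; have i2 := bL2_iso e.2 bQ; have i3 := bL2_iso e.2 bA; have i4 := bL2_iso e.2 bB.
by rewrite !ip_linl // !ip_linr // !ip_iso //; ring.
Qed.

(** Symmetrisation is self-adjoint for the Dirichlet form. *)
Lemma dirichlet_act l P Q phi : bL2 P -> bL2 Q -> tf phi ->
  ip (actx l P Q) (px phi) + ip (acty l P Q) (py phi) =
  ip P (px (act l phi)) + ip Q (py (act l phi)).
Proof.
move=> bP bQ t; rewrite px_act // py_act //.
by apply: energy_act => //; apply: bL2_tf; [exact: tfB_dx|exact: tfB_dy].
Qed.

Lemma wg_act l u p q : bL2 u -> bL2 p -> bL2 q -> wg setT u p q ->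
  wg setT (act l u) (actx l p q) (acty l p q).
Proof.
move=> bu bp bq H phi tphi; have bphi := bL2_tf tphi.
have bx := bL2_tf (tfB_dx tphi); have by_ := bL2_tf (tfB_dy tphi).
elim: l => [|e l [IH1 IH2]]; first by rewrite !ip0l oppr0.
have [H1 H2] := wg_iso e.2 bu bp bq H tphi.
have b1 := bL2_isox e.2 bp bq; have b2 := bL2_isoy e.2 bp bq; have b3 := bL2_iso e.2 bu.
have b5 := bL2_actx l bp bq; have b6 := bL2_acty l bp bq; have b7 := bL2_act l bu.
rewrite (ipDl (bL2Z _ b3) b7 bx) (ipDl (bL2Z _ b3) b7 by_) (ipDl (bL2Z _ b1) b5 bphi) (ipDl (bL2Z _ b2) b6 bphi).
rewrite (ipZl _ b3 bx) (ipZl _ b3 by_) (ipZl _ b1 bphi) (ipZl _ b2 bphi) IH1 IH2 H1 H2.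
by split; ring.
Qed.

Lemma cut_add V f g : cut V (fun x => f x + g x) = fun x => cut V f x + cut V g x.
Proof. by apply/funext => x; rewrite /cut mulrDr. Qed.
Lemma cut_scale V c f : cut V (fun x => c * f x) = fun x => c * cut V f x.
Proof. by apply/funext => x; rewrite /cut mulrCA. Qed.

Section Bounds.
Variables O B V : set (R * R).
Hypotheses (mB : measurable (B : set RR)) (mV : measurable (V : set RR)).

(** Each symmetry of the list sends the points of [O] that it maps into [B] to
    points coming from [V]: on [B], the symmetrised function sees [V] only. *)
Fixpoint inward (l : seq (R * iso)) : Prop :=
  if l is e :: l' then (forall x, O x -> B (e.2 x) -> V x) /\ inward l' else True.

Lemma cut_iso (s : iso) f : bL2 f -> (forall x, ~ O x -> f x = 0) ->
  (forall x, O x -> B (s x) -> V x) -> n2 (cut B (fun x => f (s x))) <= n2 (cut V f).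
Proof.
move=> bf fO sV; have bs := bL2_iso s bf.
have <- : n2 (fun x => cut V f (s x)) = n2 (cut V f) by exact: ip_aff (iso_det s) (bL2_cut mV bf) (bL2_cut mV bf).
rewrite -[leRHS]mul1r -(expr1n _ 2); apply: n2_le.
- exact/bL2_iso/bL2_cut.
- exact: bL2_cut.
- move=> x; rewrite mul1r; have [Bx|nB] := pselect (B x); last by rewrite cut_out // normr0.
  rewrite cut_in //; have [Ox|nO] := pselect (O (s x)); last by rewrite fO // normr0.
  by rewrite cut_in //; apply: sV; rewrite ?isoK.
Qed.

(** Symmetrisation is bounded from L2 of [V] to L2 of [B]; similarly for gradients. *)
Lemma n2_act_cut l : inward l -> exists2 C : R, 0 <= C & forall f, bL2 f -> (forall x, ~ O x -> f x = 0) ->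
  n2 (cut B (act l f)) <= C * n2 (cut V f).
Proof.
elim: l => [|e l IH] /=.
  exists 0 => // f _ _; rewrite mul0r (_ : cut B _ = fun=> 0) ?/n2 ?ip0l //.
  by apply/funext => x; rewrite /cut mulr0.
move=> [e1 /IH[C C0 HC]]; exists (2 * e.1 ^+ 2 + 2 * C); first by have := sqr_ge0 e.1; lra.
move=> f bf fO; rewrite cut_add cut_scale.
have bs := bL2_iso e.2 bf; have bc := bL2_cut mB bs; have ba := bL2_cut mB (bL2_act l bf).
apply: (le_trans (n2D (bL2Z _ bc) ba)); rewrite n2Z //.
have := ler_wpM2l (sqr_ge0 e.1) (cut_iso bf fO e1); have := HC f bf fO.
by rewrite mulrDl; lra.
Qed.

Lemma n2_lin2 (a b : R) f g : bL2 f -> bL2 g ->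
  n2 (fun x => a * f x + b * g x) <= 2 * a ^+ 2 * n2 f + 2 * b ^+ 2 * n2 g.
Proof. by move=> bf bg; rewrite (le_trans (n2D (bL2Z _ bf) (bL2Z _ bg))) // !n2Z // !mulrA. Qed.

Lemma n2_actxy_cut l : inward l -> exists2 C : R, 0 <= C & forall P Q, bL2 P -> bL2 Q ->
  (forall x, ~ O x -> P x = 0) -> (forall x, ~ O x -> Q x = 0) ->
  n2 (cut B (actx l P Q)) <= C * (n2 (cut V P) + n2 (cut V Q)) /\
  n2 (cut B (acty l P Q)) <= C * (n2 (cut V P) + n2 (cut V Q)).
Proof.
elim: l => [|e l IH] /=.
  exists 0 => // P Q _ _ _ _; rewrite mul0r.
  have E f : (forall x, f x = 0) -> n2 (cut B f) = 0.
    move=> f0; rewrite (_ : cut B _ = fun=> 0) ?/n2 ?ip0l //.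
    by apply/funext => x; rewrite /cut f0 mulr0.
  by rewrite !E.
move=> [e1 /IH[C C0 HC]]; set M := iso_a e.2 ^+ 2 + iso_b e.2 ^+ 2 + iso_d e.2 ^+ 2.
have M0 : 0 <= M by rewrite !addr_ge0 ?sqr_ge0.
exists (4 * e.1 ^+ 2 * M + 2 * C); first by have := mulr_ge0 (sqr_ge0 e.1) M0; rewrite -mulrA; lra.
move=> P Q bP bQ PO QO; have [HC1 HC2] := HC _ _ bP bQ PO QO.
have [bsP bsQ] := (bL2_iso e.2 bP, bL2_iso e.2 bQ); have [bcP bcQ] := (bL2_cut mB bsP, bL2_cut mB bsQ).
have [cP cQ] := (cut_iso bP PO e1, cut_iso bQ QO e1).
have key (a b : R) f : bL2 f -> n2 (cut B f) <= C * (n2 (cut V P) + n2 (cut V Q)) -> a ^+ 2 <= M -> b ^+ 2 <= M ->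
  n2 (cut B (fun x => e.1 * (a * P (e.2 x) + b * Q (e.2 x)) + f x)) <=
    (4 * e.1 ^+ 2 * M + 2 * C) * (n2 (cut V P) + n2 (cut V Q)).
  move=> bf Hf aM bM; rewrite cut_add cut_scale cut_add !cut_scale.
  have bl := bL2_lin a b bcP bcQ.
  apply: (le_trans (n2D (bL2Z _ bl) (bL2_cut mB bf))); rewrite n2Z //.
  have HL : n2 (fun x => a * cut B (fun y => P (e.2 y)) x + b * cut B (fun y => Q (e.2 y)) x) <=
      2 * (M * (n2 (cut V P) + n2 (cut V Q))).
    apply: (le_trans (n2_lin2 _ _ bcP bcQ)).
    have := ler_pM (sqr_ge0 a) (n2_ge0 _) aM cP; have := ler_pM (sqr_ge0 b) (n2_ge0 _) bM cQ.
    by rewrite -!mulrA [M * (_ + _)]mulrDr; lra.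
  have := ler_wpM2l (sqr_ge0 e.1) HL.
  have -> : e.1 ^+ 2 * (2 * (M * (n2 (cut V P) + n2 (cut V Q)))) = 2 * (e.1 ^+ 2 * M * (n2 (cut V P) + n2 (cut V Q))) by ring.
  by move: Hf; set S := n2 (cut V P) + n2 (cut V Q); lra.
have sq (t : R) := sqr_ge0 t.
have [[a0 b0] d0] := (sq (iso_a e.2), sq (iso_b e.2), sq (iso_d e.2)).
by split; apply: key => //; [exact: bL2_actx|rewrite /M; lra|rewrite /M; lra|exact: bL2_acty|rewrite /M; lra|rewrite /M; lra].
Qed.

End Bounds.
End Symmetry.

(** * The rectangle and its boundary *)
Section RectangleGeometry.
Context {R : realType}.
Implicit Types (f g h u v w p q phi psi chi F G : R * R -> R) (x y : R * R) (Q : rectangle R).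
Local Notation RR := (measurableTypeR R * measurableTypeR R)%type.
Local Notation leb := (@lebesgue_measure R).

(** Coordinates along the sides of the rectangle. *)
Definition cs Q x := (x.1 - (rect_vertex Q).1) * (rect_dir Q).1 + (x.2 - (rect_vertex Q).2) * (rect_dir Q).2.
Definition ct Q x := (x.2 - (rect_vertex Q).2) * (rect_dir Q).1 - (x.1 - (rect_vertex Q).1) * (rect_dir Q).2.

Lemma rect_pointE Q x : rect_point Q (cs Q x) (ct Q x) = x.
Proof.
have e := rect_dir_unit Q; rewrite /rect_point /cs /ct; case: x => x1 x2 /=.
set v := rect_vertex Q; set d := rect_dir Q; congr pair.
  transitivity (v.1 + (d.1 ^+ 2 + d.2 ^+ 2) * (x1 - v.1)); first by ring.
  by rewrite e; ring.
transitivity (v.2 + (d.1 ^+ 2 + d.2 ^+ 2) * (x2 - v.2)); first by ring.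
by rewrite e; ring.
Qed.

Lemma cs_point Q s t : cs Q (rect_point Q s t) = s.
Proof.
have e := rect_dir_unit Q; rewrite /rect_point /cs /=.
by rewrite -[RHS]mulr1 -e; ring.
Qed.
Lemma ct_point Q s t : ct Q (rect_point Q s t) = t.
Proof.
have e := rect_dir_unit Q; rewrite /rect_point /ct /=.
by rewrite -[RHS]mulr1 -e; ring.
Qed.

Lemma open_rectE Q x : open_rect Q x <->
  [/\ 0 < cs Q x, cs Q x < rect_len1 Q, 0 < ct Q x & ct Q x < rect_len2 Q].
Proof.
split=> [[s /= hs [t /= ht] <-]|[h1 h2 h3 h4]].
  by rewrite cs_point ct_point; move: hs ht; rewrite !in_itv /= => /andP[-> ->] /andP[-> ->].
exists (cs Q x); first by rewrite /= in_itv /= h1.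
by exists (ct Q x); [rewrite /= in_itv /= h3|exact: rect_pointE].
Qed.

Definition closed_rect Q x := [/\ 0 <= cs Q x, cs Q x <= rect_len1 Q, 0 <= ct Q x & ct Q x <= rect_len2 Q].

Lemma continuous_cs Q : continuous (cs Q).
Proof.
move=> x; apply: cvgD; apply: cvgMl; apply: cvgB; try exact: cvg_cst; [exact: cvg_fst|exact: cvg_snd].
Qed.
Lemma continuous_ct Q : continuous (ct Q).
Proof.
move=> x; apply: cvgB; apply: cvgMl; apply: cvgB; try exact: cvg_cst; [exact: cvg_snd|exact: cvg_fst].
Qed.

Lemma open_rect_open Q : open (open_rect Q).
Proof.
have -> : open_rect Q = (cs Q @^-1` [set s | 0 < s] `&` cs Q @^-1` [set s | s < rect_len1 Q]) `&`
   (ct Q @^-1` [set s | 0 < s] `&` ct Q @^-1` [set s | s < rect_len2 Q]).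
  by apply/seteqP; split => x /=; [move=> /open_rectE[? ? ? ?]|move=> [[? ?] [? ?]]; apply/open_rectE].
have oc (f : R * R -> R) (A : set R) : continuous f -> open A -> open (f @^-1` A).
  by move=> cf oA; apply: open_comp => // y _; exact: cf.
have [c1 c2] := (continuous_cs (Q := Q), continuous_ct (Q := Q)).
by apply: openI; apply: openI; apply: oc; try assumption; first [exact: open_gt|exact: open_lt].
Qed.

Lemma open_rect_closed Q : open_rect Q `<=` closed_rect Q.
Proof. by move=> x /open_rectE[? ? ? ?]; split; exact: ltW. Qed.

Lemma closed_rect_closed Q : closed (closed_rect Q).
Proof.
have -> : closed_rect Q = (cs Q @^-1` [set s | 0 <= s] `&` cs Q @^-1` [set s | s <= rect_len1 Q]) `&`
   (ct Q @^-1` [set s | 0 <= s] `&` ct Q @^-1` [set s | s <= rect_len2 Q]).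
  by apply/seteqP; split => x /=; [move=> [? ? ? ?]|move=> [[? ?] [? ?]]; split].
have oc (f : R * R -> R) (A : set R) : continuous f -> closed A -> closed (f @^-1` A).
  by move=> cf oA; apply: closed_comp => // y _; exact: cf.
have [c1 c2] := (continuous_cs (Q := Q), continuous_ct (Q := Q)).
by apply: closedI; apply: closedI; apply: oc; try assumption; first [exact: closed_ge|exact: closed_le].
Qed.

Lemma rect_dir_le1 Q : `|(rect_dir Q).1| <= 1 /\ `|(rect_dir Q).2| <= 1.
Proof.
have e := rect_dir_unit Q; have h1 := sqr_ge0 (rect_dir Q).1; have h2 := sqr_ge0 (rect_dir Q).2.
by split; rewrite -(@expr_le1 _ 2) // -normrX ger0_norm //; lra.
Qed.

(** Points of the closed rectangle are approached along the segment to the centre. *)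
Lemma closure_open_rect Q : closure (open_rect Q) = closed_rect Q.
Proof.
apply/seteqP; split; first by rewrite closureE => x; apply; split; [exact: closed_rect_closed|exact: open_rect_closed].
have L1 := rect_len1_gt0 Q; have L2 := rect_len2_gt0 Q.
move=> x [h1 h2 h3 h4] B /nbhs_ballP[e /= e0 eB].
pose c := rect_point Q (rect_len1 Q / 2) (rect_len2 Q / 2).
have [c1 c2] : cs Q c = rect_len1 Q / 2 /\ ct Q c = rect_len2 Q / 2 by rewrite cs_point ct_point.
pose t : R := e / (e + 1 + `|c - x|).
have d0 : 0 < e + 1 + `|c - x| by have := normr_ge0 (c - x); lra.
have t0 : 0 < t by rewrite divr_gt0.
have t1 : t < 1 by rewrite ltr_pdivrMr // mul1r; have := normr_ge0 (c - x); lra.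
pose z : R * R := (x.1 + t * (c.1 - x.1), x.2 + t * (c.2 - x.2)).
have z1 : cs Q z = (1 - t) * cs Q x + t * cs Q c by rewrite /cs /z /=; ring.
have z2 : ct Q z = (1 - t) * ct Q x + t * ct Q c by rewrite /ct /z /=; ring.
exists z; split.
  apply/open_rectE; rewrite z1 z2 c1 c2.
  have T : 0 < 1 - t by lra.
  have a1 := mulr_ge0 (ltW T) h1; have a2 := mulr_ge0 (ltW T) h3.
  have b1 := ler_wpM2l (ltW T) h2; have b2 := ler_wpM2l (ltW T) h4.
  have p1 := mulr_gt0 t0 L1; have p2 := mulr_gt0 t0 L2.
  by split; lra.
have te : t * `|c - x| < e.
  rewrite /t mulrAC ltr_pdivrMr // ltr_pM2l //; lra.
have key (a b : R) : `|b| <= `|c - x| -> `|a - (a + t * b)| < e.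
  move=> hb; rewrite opprD addrA subrr sub0r normrN normrM ger0_norm ?(ltW t0) //.
  by apply: le_lt_trans te; rewrite ler_wpM2l // ltW.
have [n1 n2] : `|(c - x).1| <= `|c - x| /\ `|(c - x).2| <= `|c - x|.
  by rewrite prod_normE !le_max !lexx orbT.
apply: eB; rewrite -ball_normE /= prod_normE gt_max.
by apply/andP; split; apply: key.
Qed.

Lemma bnd_closed_rect Q : bnd (closed_rect Q).
Proof.
have [e1 e2] := rect_dir_le1 Q; set v := rect_vertex Q.
exists (`|v.1| + `|v.2| + rect_len1 Q + rect_len2 Q) => x [h1 h2 h3 h4].
have key (a b c : R) : `|b| <= 1 -> `|c| <= 1 -> `|a| <= `|v.1| + `|v.2| ->
   `|a + cs Q x * b + ct Q x * c| <= `|v.1| + `|v.2| + rect_len1 Q + rect_len2 Q.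
  move=> hb hc ha; rewrite (le_trans (ler_normD _ _)) // lerD //.
    rewrite (le_trans (ler_normD _ _)) // lerD // normrM ger0_norm // -[leRHS]mulr1.
    by apply: ler_pM.
  by rewrite normrM ger0_norm // -[leRHS]mulr1; apply: ler_pM.
have E1 : x.1 = v.1 + cs Q x * (rect_dir Q).1 + ct Q x * - (rect_dir Q).2.
  by rewrite mulrN -[LHS](congr1 fst (rect_pointE Q x)).
have E2 : x.2 = v.2 + cs Q x * (rect_dir Q).2 + ct Q x * (rect_dir Q).1.
  by rewrite -[LHS](congr1 snd (rect_pointE Q x)).
rewrite prod_normE ge_max; apply/andP; split; first by rewrite E1; apply: key; rewrite ?normrN // lerDl.
by rewrite E2; apply: key; rewrite // lerDr.
Qed.

Lemma dist_rect Q x y : (x.1 - y.1) ^+ 2 + (x.2 - y.2) ^+ 2 = (cs Q x - cs Q y) ^+ 2 + (ct Q x - ct Q y) ^+ 2.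
Proof.
have e := rect_dir_unit Q; rewrite -[LHS]mulr1 -e /cs /ct; ring.
Qed.

End RectangleGeometry.

Section Boundary.
Context {R : realType}.
Implicit Types (f g h u v w p q phi psi chi F G : R * R -> R) (x y : R * R) (Q : rectangle R).
Local Notation RR := (measurableTypeR R * measurableTypeR R)%type.
Local Notation leb := (@lebesgue_measure R).

Lemma itg1_cc (g : R -> R) (a b : R) : continuous g -> leb.-integrable `[a, b] (EFin \o g).
Proof.
move=> cg; apply: continuous_compact_integrable; first exact: segment_compact.
exact: continuous_subspaceT.
Qed.

Lemma itg1 (g : R -> R) (a b : R) : continuous g -> leb.-integrable `]a, b[ (EFin \o g).
Proof.
by move=> cg; apply: integrableS (itg1_cc a b cg) => //; exact: subset_itv_oo_cc.
Qed.

Lemma J_norm (g : R -> R) (a b : R) : continuous g -> `|J a b g| <= J a b (fun t => `|g t|).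
Proof. by move=> cg; apply: le_normr_Rintegral => //; exact: itg1. Qed.

Lemma J_le (g h : R -> R) (a b : R) : continuous g -> continuous h -> (forall t, g t <= h t) -> J a b g <= J a b h.
Proof. by move=> cg ch gh; apply: le_Rintegral => //; exact: itg1. Qed.

Lemma JD (g h : R -> R) (a b : R) : continuous g -> continuous h -> J a b (fun t => g t + h t) = J a b g + J a b h.
Proof. by move=> cg ch; rewrite /J RintegralD //; exact: itg1. Qed.

Lemma JZ (c : R) (g : R -> R) (a b : R) : continuous g -> J a b (fun t => c * g t) = c * J a b g.
Proof. by move=> cg; rewrite /J RintegralZl //; exact: itg1. Qed.

Lemma J_cst (c a b : R) : a <= b -> J a b (fun=> c) = c * (b - a).
Proof.
move=> ab; rewrite /J Rintegral_cst //; congr (_ * _).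
transitivity (fine (leb [set` `]a, b[])) => //; rewrite lebesgue_measure_itv /= lte_fin.
by case: ltgtP ab => // ->; rewrite subrr.
Qed.

Lemma J_cc (g : R -> R) (a b : R) : continuous g -> (\int[leb]_(t in `[a, b]) (g t)%:E)%E = (J a b g)%:E.
Proof.
move=> cg; rewrite /J Rintegral_itv_obnd_cbnd; last first.
  by apply: integrableS (itg1_cc a b cg) => //; exact: subset_itv_oo_cc.
rewrite Rintegral_itv_bndo_bndc; last first.
  by apply: integrableS (itg1_cc a b cg) => //; exact: subset_itv_co_cc.
by rewrite /Rintegral fineK //; exact: integrable_fin_num (itg1_cc a b cg).
Qed.

(** The integral over the boundary of the rectangle. *)
Definition bint Q g := J 0 (rect_len1 Q) (fun s => g (rect_point Q s 0) + g (rect_point Q s (rect_len2 Q))) +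
  J 0 (rect_len2 Q) (fun t => g (rect_point Q 0 t) + g (rect_point Q (rect_len1 Q) t)).

Lemma rect_pointA Q y : rect_point Q y.1 y.2 =
  aff (rect_vertex Q) (rect_dir Q).1 (- (rect_dir Q).2) (rect_dir Q).2 (rect_dir Q).1 y.
Proof. by rewrite /rect_point /aff /= mulNr ![_ * y.1]mulrC ![_ * y.2]mulrC. Qed.

Lemma rect_detA Q : `|(rect_dir Q).1 * (rect_dir Q).1 - - (rect_dir Q).2 * (rect_dir Q).2| = 1.
Proof.
rewrite (_ : _ - _ = (rect_dir Q).1 ^+ 2 + (rect_dir Q).2 ^+ 2); first by rewrite rect_dir_unit normr1.
ring.
Qed.

Lemma continuous_side g Q : continuous g ->
  (forall t, continuous (fun s => g (rect_point Q s t))) /\ (forall s, continuous (fun t => g (rect_point Q s t))).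
Proof.
move=> cg; have cA : continuous (fun y => g (rect_point Q y.1 y.2)).
  move=> y; under eq_fun do rewrite rect_pointA.
  by apply: (@continuous_comp _ _ _ (aff _ _ _ _ _) g); [exact: continuous_aff|exact: cg].
split=> [t|s]; first exact: (continuous_line1 (t := t) cA).
move=> t; apply: (@continuous_comp _ _ _ (fun t : R => (s, t)) (fun y => g (rect_point Q y.1 y.2))); last exact: cA.
exact: cvg_pair (cvg_cst s) (@cvg_id _ (nbhs t)).
Qed.

Lemma bint_le g h Q : continuous g -> continuous h -> (forall x, g x <= h x) -> bint Q g <= bint Q h.
Proof.
move=> /(continuous_side Q)[c1 c2] /(continuous_side Q)[c3 c4] gh.
by apply: lerD; apply: J_le => [t|t|t]; do ?[exact: lerD]; apply: cvgD; first [exact: c1|exact: c2|exact: c3|exact: c4].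
Qed.

Lemma bint_lin (a : R) g Q : continuous g ->
  bint Q (fun x => a + g x) = 2 * a * (rect_len1 Q + rect_len2 Q) + bint Q g.
Proof.
move=> /(continuous_side Q)[c1 c2].
have L1 := ltW (rect_len1_gt0 Q); have L2 := ltW (rect_len2_gt0 Q).
have key (g1 g2 : R -> R) (L : R) : 0 <= L -> continuous g1 -> continuous g2 ->
   J 0 L (fun s => a + g1 s + (a + g2 s)) = 2 * a * L + J 0 L (fun s => g1 s + g2 s).
  move=> L0 k1 k2; rewrite -[X in _ * X]subr0 -J_cst // -JD //; last 2 first.
  - by move=> t; exact: cvg_cst.
  - by move=> t; apply: cvgD; [exact: k1|exact: k2].
  by apply: eq_J => t _; ring.
rewrite /bint !key //; ring.
Qed.

Lemma bintZ (c : R) g Q : continuous g -> bint Q (fun x => c * g x) = c * bint Q g.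
Proof.
move=> /(continuous_side Q)[c1 c2]; rewrite /bint mulrDr -!JZ.
- by congr (_ + _); apply: eq_J => t _; rewrite mulrDr.
- by move=> t; apply: cvgD; [exact: c2|exact: c2].
- by move=> t; apply: cvgD; [exact: c1|exact: c1].
Qed.

Lemma continuous_norm g : continuous g -> continuous (fun x => `|g x|).
Proof. by move=> cg x; apply: cvg_norm; exact: cg. Qed.

Lemma bnd_L2normE Q g : continuous g -> bnd_L2norm Q g = (Num.sqrt (bint Q (fun x => g x ^+ 2)))%:E.
Proof.
move=> cg; rewrite /bnd_L2norm.
have c2 : continuous (fun x => g x ^+ 2).
  have -> : (fun x => g x ^+ 2) = (fun x => g x * g x) by apply/funext => x; rewrite expr2.
  by move=> x; apply: cvgM; exact: cg.
have [k1 k2] := continuous_side Q c2.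
rewrite !J_cc; [|exact: k2|exact: k2|exact: k1|exact: k1].
rewrite -!EFinD; transitivity ((Num.sqrt (bint Q (fun x => g x ^+ 2)))%:E) => //.
congr (Num.sqrt _)%:E; rewrite /bint.
by rewrite (JD _ _ (k1 0) (k1 (rect_len2 Q))) (JD _ _ (k2 0) (k2 (rect_len1 Q))) addrA.
Qed.

Lemma mopen_rect Q : measurable (open_rect Q : set RR).
Proof. by apply: open2_measurable; exact: open_rect_open. Qed.

Lemma bnd_open_rect Q : bnd (open_rect Q).
Proof. by have [M hM] := bnd_closed_rect Q; exists M => x /open_rect_closed/hM. Qed.

Lemma bL2_cut_cont (U : set (R * R)) f : measurable (U : set RR) -> bnd U -> continuous f -> bL2 (cut U f).
Proof.
move=> mU [M hM] cf; have := bL2_box (- M - 1) (M + 1) (- M - 1) (M + 1) cf.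
move=> /(bL2_cut mU); congr bL2; apply/funext => x; rewrite /cut.
have [Ux|nU] := pselect (U x); last by rewrite (ind0 nU) !mul0r.
rewrite (ind1 Ux) [X in 1 * (X * _)]ind1 ?mul1r //; have := hM _ Ux; rewrite prod_normE ge_max !ler_norml.
by move=> /andP[/andP[h1 h2] /andP[h3 h4]]; split; rewrite /= in_itv /=; apply/andP; split; lra.
Qed.

Lemma bL2_cut_rect Q f : continuous f -> bL2 (cut (open_rect Q) f).
Proof. by move=> cf; apply: bL2_cut_cont => //; [exact: mopen_rect|exact: bnd_open_rect]. Qed.

(** The divergence theorem, in the coordinates of the rectangle, where the
    components of the unit normal are at most 1. *)
Lemma rect_div Q G : smooth G ->
  `|I (cut (open_rect Q) (px G))| <= bint Q (fun x => `|G x|) /\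
  `|I (cut (open_rect Q) (py G))| <= bint Q (fun x => `|G x|).
Proof.
move=> sG; set e1 := (rect_dir Q).1; set e2 := (rect_dir Q).2.
have [n1 n2'] := rect_dir_le1 Q.
pose T := aff (rect_vertex Q) e1 (- e2) e2 e1.
pose Gt y := G (T y); have sGt : smooth Gt by exact: smooth_aff.
have L1 := rect_len1_gt0 Q; have L2 := rect_len2_gt0 Q.
pose B := `]0, rect_len1 Q[ `*` `]0, rect_len2 Q[ : set (R * R).
have ee : e1 ^+ 2 + e2 ^+ 2 = 1 := rect_dir_unit Q.
have Ex y : px G (T y) = e1 * px Gt y - e2 * py Gt y.
  rewrite /Gt dx_aff // dy_aff // -[LHS]mul1r -ee; ring.
have Ey y : py G (T y) = e2 * px Gt y + e1 * py Gt y.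
  rewrite /Gt dx_aff // dy_aff // -[LHS]mul1r -ee; ring.
have indT y : ind (open_rect Q) (T y) = ind B y.
  have TE : T y = rect_point Q y.1 y.2 by rewrite rect_pointA.
  have [By|nB] := pselect (B y).
    rewrite (ind1 By) ind1 // TE; apply/open_rectE; rewrite cs_point ct_point.
    by move: By => [/=]; rewrite !in_itv /= => /andP[-> ->] /andP[-> ->].
  rewrite (ind0 nB) ind0 // TE => /open_rectE; rewrite cs_point ct_point => -[h1 h2 h3 h4]; apply: nB.
  by split; rewrite /= in_itv /=; apply/andP.
have cG := smooth_cont sG; have cn := continuous_norm cG; have [k1 k2] := continuous_side Q cG.
have [m1 m2] := continuous_side Q cn.
have bB f : continuous f -> bL2 (fun x => ind B x * f x) by exact: bL2_box.
have bx := bB _ (smooth_cont (smooth_dx sGt)); have by_ := bB _ (smooth_cont (smooth_dy sGt)).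
have X1 := box_dx 0 (rect_len2 Q) L1 sGt; have X2 := box_dy 0 (rect_len1 Q) L2 sGt.
pose A1 := I (fun x => ind B x * px Gt x); pose A2 := I (fun x => ind B x * py Gt x).
have EG y : Gt y = G (rect_point Q y.1 y.2) by rewrite /Gt rect_pointA.
have N1 : `|A1| <= J 0 (rect_len2 Q) (fun t => `|G (rect_point Q 0 t)| + `|G (rect_point Q (rect_len1 Q) t)|).
  rewrite /A1 X1 (@eq_J _ _ _ _ (fun t => G (rect_point Q (rect_len1 Q) t) - G (rect_point Q 0 t))); last first.
    by move=> t _; rewrite !EG.
  have c : continuous (fun t => G (rect_point Q (rect_len1 Q) t) - G (rect_point Q 0 t)).
    by move=> t; apply: cvgB; exact: k2.
  apply: (le_trans (J_norm _ _ c)); apply: J_le.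
  - by move=> t; apply: cvg_norm; exact: c.
  - by move=> t; apply: cvgD; exact: m2.
  - by move=> t; rewrite [leRHS]addrC; exact: ler_normB.
have N2 : `|A2| <= J 0 (rect_len1 Q) (fun s => `|G (rect_point Q s 0)| + `|G (rect_point Q s (rect_len2 Q))|).
  rewrite /A2 X2 (@eq_J _ _ _ _ (fun s => G (rect_point Q s (rect_len2 Q)) - G (rect_point Q s 0))); last first.
    by move=> t _; rewrite !EG.
  have c : continuous (fun s => G (rect_point Q s (rect_len2 Q)) - G (rect_point Q s 0)).
    by move=> t; apply: cvgB; exact: k1.
  apply: (le_trans (J_norm _ _ c)); apply: J_le.
  - by move=> t; apply: cvg_norm; exact: c.
  - by move=> t; apply: cvgD; exact: m1.
  - by move=> t; rewrite [leRHS]addrC; exact: ler_normB.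
have key (a b : R) : `|a| <= 1 -> `|b| <= 1 -> `|a * A1 + b * A2| <= bint Q (fun x => `|G x|).
  move=> ha hb; rewrite /bint [leRHS]addrC; apply: (le_trans (ler_normD _ _)); apply: lerD; rewrite normrM.
    by apply: le_trans N1; rewrite ler_piMl.
  by apply: le_trans N2; rewrite ler_piMl.
have itx (f : R * R -> R) : continuous f -> itg (cut (open_rect Q) f).
  by move=> cf; exact/bL2_itg/bL2_cut_rect.
split.
  rewrite -(I_aff (rect_vertex Q) (rect_detA Q)); last by apply: itx; exact/smooth_cont/smooth_dx.
  have -> : I (cut (open_rect Q) (px G) \o T) = e1 * A1 + - e2 * A2.
    rewrite -(IZ e1 (bL2_itg bx)) -(IZ (- e2) (bL2_itg by_)) -ID; [|exact/bL2_itg/bL2Z|exact/bL2_itg/bL2Z].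
    by apply: eq_I => y; rewrite /= /cut indT Ex; ring.
  by apply: key; rewrite ?normrN.
rewrite -(I_aff (rect_vertex Q) (rect_detA Q)); last by apply: itx; exact/smooth_cont/smooth_dy.
have -> : I (cut (open_rect Q) (py G) \o T) = e2 * A1 + e1 * A2.
  rewrite -(IZ e2 (bL2_itg bx)) -(IZ e1 (bL2_itg by_)) -ID; [|exact/bL2_itg/bL2Z|exact/bL2_itg/bL2Z].
  by apply: eq_I => y; rewrite /= /cut indT Ey; ring.
exact: key.
Qed.

End Boundary.

(** * Functions with zero trace *)
Section ZeroTrace.
Context {R : realType}.
Implicit Types (f g h u v w p q phi psi chi F G : R * R -> R) (x y : R * R) (Q : rectangle R).
Local Notation RR := (measurableTypeR R * measurableTypeR R)%type.

Definition bdry Q x := closed_rect Q x /\ ~ open_rect Q x.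

Lemma bint0 Q g : (forall x, bdry Q x -> g x = 0) -> bint Q g = 0.
Proof.
move=> g0; have L1 := rect_len1_gt0 Q; have L2 := rect_len2_gt0 Q.
rewrite /bint !eq_J0 ?addr0 // => t /andP[t0 t1].
all: by rewrite !g0 ?addr0 //; (split; [split; rewrite ?cs_point ?ct_point ?lexx // ltW|
  move=> /open_rectE; rewrite cs_point ct_point ?ltxx => -[]]).
Qed.

Lemma rect_div0 Q G : smooth G -> (forall x, bdry Q x -> G x = 0) ->
  I (cut (open_rect Q) (px G)) = 0 /\ I (cut (open_rect Q) (py G)) = 0.
Proof.
move=> sG G0; have [h1 h2] := rect_div Q sG.
have E : bint Q (fun x => `|G x|) = 0 by apply: bint0 => x /G0 ->; rewrite normr0.
by split; apply/eqP; rewrite -normr_le0 -E.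
Qed.

Lemma ip_cut (U : set (R * R)) f phi : tfB U phi -> ip (cut U f) phi = ip f phi.
Proof.
move=> tphi; apply: eq_I => x; have [Ux|nU] := pselect (U x); first by rewrite cut_in.
by rewrite (tfB_out tphi nU) !mulr0.
Qed.

Lemma wd_smooth U f : smooth f -> wd U 1 0 f (px f) /\ wd U 0 1 f (py f).
Proof.
move=> sf; split=> phi tphi; have t := tfB_tf tphi; rewrite /der /= (ip_cut _ tphi) expr1 mulN1r.
  by rewrite (ip_cut _ (tfB_dx tphi)) ibp_dx // opprK.
by rewrite (ip_cut _ (tfB_dy tphi)) ibp_dy // opprK.
Qed.

Lemma cutB (U : set (R * R)) f g : cut U (fun x => f x - g x) = fun x => cut U f x - cut U g x.
Proof. by apply/funext => x; rewrite /cut mulrBr. Qed.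

Lemma wdB U i j f g p q : bL2 (cut U f) -> bL2 (cut U g) -> bL2 (cut U p) -> bL2 (cut U q) ->
  wd U i j f p -> wd U i j g q -> wd U i j (fun x => f x - g x) (fun x => p x - q x).
Proof.
move=> bf bg bp bq H1 H2 phi tphi; have bphi := bL2_tf (tfB_tf tphi).
have bd := bL2_tf (tfB_tf (tfB_der i j tphi)).
by rewrite !cutB !ipBl // H1 // H2 // mulrBr.
Qed.

Lemma sqrt_cvg0 (s t : nat -> R) : (forall n, 0 <= t n <= s n) ->
  ((Num.sqrt (s n))%:E @[n --> \oo] --> 0%E) -> t n @[n --> \oo] --> 0.
Proof.
move=> ts /fine_cvgP[_ H]; have H2 : Num.sqrt (s n) * Num.sqrt (s n) @[n --> \oo] --> (0 * 0 : R).
  by apply: cvgM; exact: H.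
rewrite mulr0 in H2; apply: (squeeze_cvgr _ (cvg_cst 0) H2).
apply: nearW => n; have /andP[t0 tS] := ts n; rewrite t0 -expr2 sqr_sqrtr //.
exact: le_trans tS.
Qed.

(** A function in [H10 Q], extended by zero, is weakly differentiable on the
    plane: for the smooth functions approximating it, integration by parts against a
    test function leaves a boundary integral, which tends to 0. *)
Lemma zero_extension Q u : H10 Q u ->
  let O := open_rect Q in let p := weakD O 1 0 u in let q := weakD O 0 1 u in
  [/\ bL2 (cut O u), bL2 (cut O p), bL2 (cut O q), wd O 1 0 u p /\ wd O 0 1 u q &
      wg setT (cut O u) (cut O p) (cut O q)].
Proof.
move=> [Hs [_ [phi [sphi Hphi Hb]]]] O p q.
have oO : open O := @open_rect_open R Q; have bO : bnd O := bnd_open_rect Q.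
have mO : measurable (O : set RR) := mopen_rect Q.
have [bu Hd] := (SobolevP 1 u bO).1 Hs.
have [p0 bp0 wp0] := Hd 1 0 isT; have [q0 bq0 wq0] := Hd 0 1 isT.
have [bp wp _] : [/\ bL2 (cut O p), wd O 1 0 u p & _] := weakDP oO bO bp0 wp0.
have [bq wq _] : [/\ bL2 (cut O q), wd O 0 1 u q & _] := weakDP oO bO bq0 wq0.
clearbody p q.
split; [exact: bu|exact: bp|exact: bq|split; [exact: wp|exact: wq]|].
pose f n := cut O (phi n); pose fx n := cut O (px (phi n)); pose fy n := cut O (py (phi n)).
have bf n : bL2 (f n) by apply: bL2_cut_rect; exact: smooth_cont.
have bfx n : bL2 (fx n) by apply: bL2_cut_rect; exact/smooth_cont/smooth_dx.
have bfy n : bL2 (fy n) by apply: bL2_cut_rect; exact/smooth_cont/smooth_dy.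
pose N n := n2 (fun x => cut O u x - f n x) + n2 (fun x => cut O p x - fx n x) + n2 (fun x => cut O q x - fy n x).
have cN : (Num.sqrt (N n))%:E @[n --> \oo] --> 0%E.
  move: Hphi; apply: cvg_trans; apply: near_eq_cvg; apply: nearW => n.
  have [w1 w2] := wd_smooth O (sphi n).
  have B1 : bL2 (cut O (fun x => u x - phi n x)) by rewrite cutB; exact: bL2B (bf n).
  have B2 : bL2 (cut O (fun x => p x - px (phi n) x)) by rewrite cutB; exact: bL2B (bfx n).
  have B3 : bL2 (cut O (fun x => q x - py (phi n) x)) by rewrite cutB; exact: bL2B (bfy n).
  have W1 := wdB bu (bf n) bp (bfx n) wp w1; have W2 := wdB bu (bf n) bq (bfy n) wq w2.
  have := Sobolev_norm1E oO bO B1 B2 B3 W1 W2; rewrite !cutB => ->.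
  by [].
have nB f1 f2 : n2 (fun x => f1 x - f2 x) = n2 (fun x => f2 x - f1 x).
  by rewrite -n2N; congr n2; apply/funext => x; rewrite opprB.
have ge n := n2_ge0 (R := R) n.
have cf : cvgL2 f (cut O u).
  apply: (sqrt_cvg0 _ cN) => n; rewrite n2_ge0 /= nB /N.
  by have := ge (fun x => cut O p x - fx n x); have := ge (fun x => cut O q x - fy n x); lra.
have cfx : cvgL2 fx (cut O p).
  apply: (sqrt_cvg0 _ cN) => n; rewrite n2_ge0 /= nB /N.
  by have := ge (fun x => cut O u x - f n x); have := ge (fun x => cut O q x - fy n x); lra.
have cfy : cvgL2 fy (cut O q).
  apply: (sqrt_cvg0 _ cN) => n; rewrite n2_ge0 /= nB /N.
  by have := ge (fun x => cut O u x - f n x); have := ge (fun x => cut O p x - fx n x); lra.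
pose b n := bint Q (fun x => phi n x ^+ 2).
have c2 n : continuous (fun x => phi n x ^+ 2).
  have -> : (fun x => phi n x ^+ 2) = (fun x => phi n x * phi n x) by apply/funext => x; rewrite expr2.
  by move=> x; apply: cvgM; exact: (smooth_cont (sphi n)).
have b0 n : 0 <= b n.
  rewrite -(@bint0 Q (fun=> 0)) //; apply: bint_le => [x||x]; [exact: cvg_cst|exact: c2|exact: sqr_ge0].
have cb : b n @[n --> \oo] --> 0.
  apply: (@sqrt_cvg0 b) => [n|]; first by rewrite b0 lexx.
  move: Hb; apply: cvg_trans; apply: near_eq_cvg; apply: nearW => n.
  have cN' : continuous (cst 0 \- phi n).
    by move=> x; apply: cvgB; [exact: cvg_cst|exact: (smooth_cont (sphi n))].
  rewrite bnd_L2normE //; congr (Num.sqrt (bint Q _))%:E; apply/funext => x.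
  by rewrite /= sub0r sqrrN.
move=> psi tpsi; have spsi := tfB_smooth tpsi; have bpsi := bL2_tf tpsi.
have bpx := bL2_tf (tfB_dx tpsi); have bpy := bL2_tf (tfB_dy tpsi).
have key (D : (R * R -> R) -> R * R -> R) (g : nat -> R * R -> R) r :
    (forall n, `|ip (f n) (D psi) + ip (g n) psi| <= bint Q (fun x => `|phi n x * psi x|)) ->
    (forall n, bL2 (g n)) -> bL2 r -> bL2 (D psi) -> cvgL2 g r -> ip (cut O u) (D psi) = - ip r psi.
  move=> Hn bg br bD cg; apply/eqP; rewrite -addr_eq0; apply/eqP.
  have c1 : ip (f n) (D psi) + ip (g n) psi @[n --> \oo] --> ip (cut O u) (D psi) + ip r psi.
    by apply: cvgD; exact: cvgL2_ip.
  suff c3 : ip (f n) (D psi) + ip (g n) psi @[n --> \oo] --> 0.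
    by rewrite -(cvg_lim _ c1) // (cvg_lim _ c3).
  (* The boundary integral of |phi n psi| is at most K + 1 times that of d + phi n ^ 2 / d. *)
  apply/cvgrPdist_le => e e0; have [K K0 hK] := tf_bound tpsi.
  have L1 := rect_len1_gt0 Q; have L2 := rect_len2_gt0 Q.
  pose L := rect_len1 Q + rect_len2 Q; have L0 : 0 < L by rewrite /L; lra.
  have K1 : 0 < K + 1 by lra.
  pose d := e / (4 * (K + 1) * L).
  have d0 : 0 < d by apply: divr_gt0 => //; rewrite !mulr_gt0.
  have de : 0 < d * e / (2 * (K + 1)) by apply: divr_gt0; apply: mulr_gt0.
  move/cvgrPdist_le: cb => /(_ _ de); apply: filterS => n; rewrite !sub0r !normrN ger0_norm // => bn.
  apply: (le_trans (Hn n)).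
  have cphi := smooth_cont (sphi n); have cpsi := smooth_cont spsi.
  apply: (@le_trans _ _ (bint Q (fun x => (K + 1) * (d + d^-1 * phi n x ^+ 2)))).
    apply: bint_le => [|x|x].
    - by apply: continuous_norm => x; apply: cvgM; [exact: cphi|exact: cpsi].
    - by apply: cvgMr; apply: cvgD; [exact: cvg_cst|apply: cvgMr; exact: c2].
    rewrite normrM mulrC; apply: ler_pM => //; first by rewrite (le_trans (hK x)) // lerDl.
    rewrite -(ler_pM2l d0) mulrDr mulVKf ?gt_eqF // -[phi n x ^+ 2]real_normK ?num_real //.
    have := sqr_ge0 (d - `|phi n x|); have := mulr_ge0 (ltW d0) (normr_ge0 (phi n x)); lra.
  have cc : continuous (fun x => d^-1 * phi n x ^+ 2) by move=> x; apply: cvgMr; exact: c2.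
  rewrite bintZ; last by move=> x; apply: cvgD; [exact: cvg_cst|exact: cc].
  rewrite bint_lin // bintZ // -/(b n) -/L.
  have -> : e = (K + 1) * (2 * d * L + d^-1 * (d * e / (2 * (K + 1)))).
    rewrite /d; field.
    by rewrite !gt_eqF.
  by rewrite ler_pM2l // lerD2l ler_pM2l // invr_gt0.
split; [apply: (key (@px R) fx)|apply: (key (@py R) fy)] => // n.
  have sG : smooth (fun x => phi n x * psi x) by exact: smoothM.
  apply: le_trans (rect_div Q sG).1; rewrite le_eqVlt; apply/orP; left; apply/eqP; congr `| _ |.
  rewrite -ID; [|exact: itgM|exact: itgM]; apply: eq_I => x.
  by rewrite /f /fx /cut dxM //; ring.
have sG : smooth (fun x => phi n x * psi x) by exact: smoothM.
apply: le_trans (rect_div Q sG).2; rewrite le_eqVlt; apply/orP; left; apply/eqP; congr `| _ |.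
rewrite -ID; [|exact: itgM|exact: itgM]; apply: eq_I => x.
by rewrite /f /fy /cut dyM //; ring.
Qed.

End ZeroTrace.

Section WeakSolutions.
Context {R : realType}.
Implicit Types (f g h u v w p q phi psi chi F G a : R * R -> R) (x y : R * R) (Q : rectangle R).
Local Notation RR := (measurableTypeR R * measurableTypeR R)%type.

Lemma cut0 (U : set (R * R)) : cut U (fun=> 0 : R) = fun=> 0.
Proof. by apply/funext => x; rewrite /cut mulr0. Qed.

(** The constant sequence approximates. *)
Lemma H10_smooth Q psi : smooth psi -> (forall x, bdry Q x -> psi x = 0) -> H10 Q psi.
Proof.
move=> spsi psi0; set O := open_rect Q.
have oO : open O := @open_rect_open R Q; have bO : bnd O := bnd_open_rect Q.
have [w1 w2] := wd_smooth O spsi.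
have bc f : continuous f -> bL2 (cut O f) := @bL2_cut_rect R Q f.
have c1 := smooth_cont spsi.
have c2 := smooth_cont (smooth_dx spsi). have c3 := smooth_cont (smooth_dy spsi).
split.
  apply/(SobolevP 1 psi bO); split; first exact: bc.
  case=> [|[|i]] [|[|j]] //= _; [exists psi => //; [exact: bc|exact: wd0]|exists (py psi) => //; exact: bc|exists (px psi) => //; exact: bc].
split; first exact: measurable_cst.
have n0 : n2 (fun=> 0 : R) = 0 by rewrite /n2 ip0l.
exists (fun=> psi); split => //.
  have w0 i j : wd O i j (fun=> 0) (fun=> 0) by move=> phi _; rewrite cut0 !ip0l mulr0.
  have b0 : bL2 (cut O (fun=> 0)) by rewrite cut0; exact: bL2_0.
  have := Sobolev_norm1E oO bO b0 b0 b0 (w0 1 0) (w0 0 1); rewrite cut0 n0 !addr0 sqrtr0 => E.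
  have -> : psi \- psi = fun=> 0 by apply/funext => x /=; rewrite subrr.
  by rewrite E; exact: cvg_cst.
have c : continuous (cst 0 \- psi) by move=> x; apply: cvgB; [exact: cvg_cst|exact: c1].
rewrite bnd_L2normE // bint0 ?sqrtr0; first exact: cvg_cst.
by move=> x /psi0 /= ->; rewrite subrr expr0n.
Qed.

(** Weak solutions vanishing on the boundary of the rectangle, extended by zero;
    as test functions it is enough to know the smooth ones. *)
Record dirichlet Q a u p q f : Prop := {
  dir_bu : bL2 u; dir_bp : bL2 p; dir_bq : bL2 q; dir_bf : bL2 f;
  dir_u : forall x, ~ open_rect Q x -> u x = 0;
  dir_p : forall x, ~ open_rect Q x -> p x = 0;
  dir_q : forall x, ~ open_rect Q x -> q x = 0;
  dir_f : forall x, ~ open_rect Q x -> f x = 0;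
  dir_wg : wg setT u p q;
  dir_eq : forall psi, tf psi -> (forall x, bdry Q x -> psi x = 0) ->
    ip (fun x => a x * p x) (px psi) + ip (fun x => a x * q x) (py psi) = ip f psi }.

Lemma weak_solution_dirichlet Q a f u : bm a -> L2 (open_rect Q) f -> H10 Q u -> weak_solution Q a f u ->
  let O := open_rect Q in
  dirichlet Q a (cut O u) (cut O (weakD O 1 0 u)) (cut O (weakD O 0 1 u)) (cut O f).
Proof.
move=> ma Lf Hu Hw O; have [bu bp bq _ wgu] := zero_extension Hu.
have oO : open O := @open_rect_open R Q; have bO : bnd O := bnd_open_rect Q.
have bf : bL2 (cut O f) := (L2P f bO).1 Lf.
have out h x : ~ O x -> cut O h x = 0 by exact: cut_out.
split; [exact: bu|exact: bp|exact: bq|exact: bf|exact: out|exact: out|exact: out|exact: out|exact: wgu|].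
move=> psi tpsi psi0; have spsi := tfB_smooth tpsi; have bpsi := bL2_tf tpsi.
have := Hw _ (H10_smooth spsi psi0); rewrite -/O.
have [w1 w2] := wd_smooth O spsi.
have bc h : continuous h -> bL2 (cut O h) := @bL2_cut_rect R Q h.
have b1 := bc _ (smooth_cont (smooth_dx spsi)). have b2 := bc _ (smooth_cont (smooth_dy spsi)).
have [bp' _ e1] := weakDP oO bO b1 w1. have [bq' _ e2] := weakDP oO bO b2 w2.
move: (weakD O 1 0 psi) (weakD O 0 1 psi) bp' bq' e1 e2 => p' q' bp' bq' e1 e2.
rewrite -/O in bp bq wgu.
move: (weakD O 1 0 u) (weakD O 0 1 u) bp bq wgu => p q bp bq wgu.
have bap := bmM ma bp; have baq := bmM ma bq.
have -> : ip (fun x => a x * cut O p x) (px psi) = ip (fun x => a x * cut O p x) (cut O p').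
  apply/eqP; rewrite eq_sym -subr_eq0; apply/eqP.
  transitivity (ip (fun x => a x * cut O p x) (cut O p') - ip (fun x => a x * cut O p x) (cut O (px psi))).
    congr (_ - _); apply: eq_I => x; have [Ox|nO] := pselect (O x); first by rewrite !cut_in.
    by rewrite !(cut_out _ nO) !mulr0 mul0r.
  by rewrite -ipBr // ipC ip_n2_0 //; exact: bL2B.
have -> : ip (fun x => a x * cut O q x) (py psi) = ip (fun x => a x * cut O q x) (cut O q').
  apply/eqP; rewrite eq_sym -subr_eq0; apply/eqP.
  transitivity (ip (fun x => a x * cut O q x) (cut O q') - ip (fun x => a x * cut O q x) (cut O (py psi))).
    congr (_ - _); apply: eq_I => x; have [Ox|nO] := pselect (O x); first by rewrite !cut_in.
    by rewrite !(cut_out _ nO) !mulr0 mul0r.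
  by rewrite -ipBr // ipC ip_n2_0 //; exact: bL2B.
rewrite RintegralU => E; apply/eqP; rewrite -subr_eq0 -E; apply/eqP.
rewrite -ID; [|exact: itgM|exact: itgM]; rewrite -IB; [|apply: itgD; exact: itgM|exact: itgM].
apply: eq_I => x; have [Ox|nO] := pselect (O x); first by rewrite !(cut_in _ Ox); ring.
by rewrite !(cut_out _ nO); ring.
Qed.

(** Test functions in H1 supported inside the rectangle, by mollification. *)
Lemma dirichlet_test Q a u p q f v v1 v2 (e : R) : bm a -> dirichlet Q a u p q f -> 0 < e ->
  bL2 v -> bL2 v1 -> bL2 v2 -> wg setT v v1 v2 ->
  (forall x, v x != 0 -> ball x e `<=` open_rect Q) ->
  ip (fun x => a x * p x) v1 + ip (fun x => a x * q x) v2 = ip f v.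
Proof.
move=> ma H e0 bv b1 b2 Hv vO.
have bap := bmM ma (dir_bp H); have baq := bmM ma (dir_bq H); have bf := dir_bf H.
have lim h k : bL2 h -> bL2 k -> ip h (moll k n) @[n --> \oo] --> ip h k.
  move=> bh bk; rewrite ipC; under eq_fun do rewrite ipC.
  by apply: cvgL2_ip => //; [move=> n; exact: bL2_moll|exact: moll_cvg].
have c1 : ip (fun x => a x * p x) (moll v1 n) + ip (fun x => a x * q x) (moll v2 n) @[n --> \oo] -->
    ip (fun x => a x * p x) v1 + ip (fun x => a x * q x) v2 by apply: cvgD; exact: lim.
have c2 := lim _ _ bf bv.
suff E : \forall n \near \oo, ip (fun x => a x * p x) (moll v1 n) + ip (fun x => a x * q x) (moll v2 n) = ip f (moll v n).
  have c3 : ip f (moll v n) @[n --> \oo] --> ip (fun x => a x * p x) v1 + ip (fun x => a x * q x) v2.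
    by move: c1; apply: cvg_trans; apply: near_eq_cvg; exact: E.
  by rewrite -(cvg_lim _ c3) // -(cvg_lim _ c2).
have := near_infty_natSinv_lt (PosNum e0); apply: filterS => n /= ne.
rewrite -(px_moll n bv b1 Hv) -(py_moll n bv b2 Hv); apply: (dir_eq H); first exact: tf_moll.
move=> x [_ nx]; apply: contrapT => /eqP/moll_supp[y xy vy]; apply: nx; apply: (vO _ vy).
rewrite -ball_normE /= distrC; exact: lt_trans xy ne.
Qed.

End WeakSolutions.

(** * Symmetrised solutions away from the interface *)
Section Patches.
Context {R : realType}.
Implicit Types (f g h u v w p q phi psi chi F G : R * R -> R) (x y : R * R) (Q : rectangle R).
Local Notation RR := (measurableTypeR R * measurableTypeR R)%type.

(** Membership in H2 of the plane, with a bound. *)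
Definition H2le (N : R) w := exists p q a b c, [/\ H2 w p q a b c,
  n2 w <= N, n2 p <= N, n2 q <= N & [/\ n2 a <= N, n2 b <= N & n2 c <= N]].

Lemma wg_lin B (k l : R) u p q v r s : bL2 u -> bL2 p -> bL2 q -> bL2 v -> bL2 r -> bL2 s ->
  wg B u p q -> wg B v r s ->
  wg B (fun x => k * u x + l * v x) (fun x => k * p x + l * r x) (fun x => k * q x + l * s x).
Proof.
move=> bu bp bq bv br bs H1 H2 phi tphi; have t := tfB_tf tphi; have b0 := bL2_tf t.
have b1 := bL2_tf (tfB_dx t); have b2 := bL2_tf (tfB_dy t).
by rewrite !ip_linl //; have [-> ->] := H1 _ tphi; have [-> ->] := H2 _ tphi; split; ring.
Qed.

Lemma H2le_lin (k l N M : R) w v : H2le N w -> H2le M v ->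
  H2le (2 * k ^+ 2 * N + 2 * l ^+ 2 * M) (fun x => k * w x + l * v x).
Proof.
move=> [p [q [a [b [c [[bw bp bq ba bb bc H1 H2 H3] w1 w2 w3 [w4 w5 w6]]]]]]].
move=> [p' [q' [a' [b' [c' [[bw' bp' bq' ba' bb' bc' H1' H2' H3'] w1' w2' w3' [w4' w5' w6']]]]]]].
exists (fun x => k * p x + l * p' x), (fun x => k * q x + l * q' x), (fun x => k * a x + l * a' x),
  (fun x => k * b x + l * b' x), (fun x => k * c x + l * c' x).
have bd f g : bL2 f -> bL2 g -> n2 f <= N -> n2 g <= M ->
    n2 (fun x => k * f x + l * g x) <= 2 * k ^+ 2 * N + 2 * l ^+ 2 * M.
  move=> bf bg hf hg; apply: (le_trans (n2_lin2 _ _ bf bg)).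
  by apply: lerD; apply: ler_wpM2l => //; rewrite mulr_ge0 ?sqr_ge0.
split; [|exact: bd|exact: bd|exact: bd|split; exact: bd].
by split; [exact: bL2_lin|exact: bL2_lin|exact: bL2_lin|exact: bL2_lin|exact: bL2_lin|exact: bL2_lin|
  exact: wg_lin|exact: wg_lin|exact: wg_lin].
Qed.

Lemma H2le_mono (N M : R) w : N <= M -> H2le N w -> H2le M w.
Proof.
move=> NM [p [q [a [b [c [H w1 w2 w3 [w4 w5 w6]]]]]]].
by exists p, q, a, b, c; split; [|exact: le_trans NM..|split; exact: le_trans NM].
Qed.

Variables (Q Qm : rectangle R) (ap am : R) (Omega2 : set (R * R)).
Hypotheses (HQm : closure (open_rect Qm) `<=` open_rect Q) (oO2 : open Omega2).
Hypotheses (ap0 : ap != 0) (am0 : am != 0).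

Local Notation Om := (open_rect Q).
Local Notation Omm := (open_rect Qm).
Local Notation V := (Omega2 `&` Om).
Local Notation a := (coef Qm ap am).

Definition energy u p q f := n2 (cut V u) + n2 (cut V p) + n2 (cut V q) + n2 (cut V f).

Lemma mV : measurable (V : set RR).
Proof. by apply: measurableI; apply: open2_measurable => //; exact: open_rect_open. Qed.

Lemma energy_ge0 u p q f : 0 <= energy u p q f.
Proof. by rewrite !addr_ge0 // n2_ge0. Qed.

Lemma coefE x : a x = ap + (am - ap) * ind Omm x.
Proof.
rewrite /coef; case: ifPn => [|h]; first by rewrite inE => h; rewrite (ind1 h); ring.
by rewrite ind0 ?mulr0 ?addr0 // => h'; move: h; rewrite mem_set.
Qed.

Lemma bm_wt (c d : R) : bm (fun x => c + d * ind Omm x).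
Proof.
by apply: bmD; [exact: bm_cst|apply: bmm; [exact: bm_cst|apply: bm_ind; exact: mopen_rect]].
Qed.

Lemma bm_coef : bm a.
Proof. by have := bm_wt ap (am - ap); congr bm; apply/funext => x; rewrite coefE. Qed.

(** On the support of the cut-off [theta] every solution agrees, on either side
    of the interface, with a function in H2 of the plane. *)
Definition patch (theta : R * R -> R) := exists2 C, 0 <= C &
  forall u p q f, dirichlet Q a u p q f -> exists wp wm,
  [/\ H2le (C * energy u p q f) wp, H2le (C * energy u p q f) wm,
      forall x, Om x -> ~ closure Omm x -> wp x = theta x * u x &
      forall x, Omm x -> wm x = theta x * u x].

Lemma patchD theta1 theta2 : patch theta1 -> patch theta2 -> patch (fun x => theta1 x + theta2 x).
Proof.
move=> [C C0 HC] [D D0 HD]; exists (2 * C + 2 * D); first by lra.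
move=> u p q f H; have [wp [wm [h1 h2 h3 h4]]] := HC _ _ _ _ H; have [wp' [wm' [k1 k2 k3 k4]]] := HD _ _ _ _ H.
have e0 := energy_ge0 u p q f.
have E (w v : R * R -> R) : H2le (C * energy u p q f) w -> H2le (D * energy u p q f) v ->
   H2le ((2 * C + 2 * D) * energy u p q f) (fun x => 1 * w x + 1 * v x).
  by move=> hw hv; apply: H2le_mono (H2le_lin 1 1 hw hv); rewrite expr1n; lra.
exists (fun x => 1 * wp x + 1 * wp' x), (fun x => 1 * wm x + 1 * wm' x).
split; [exact: E|exact: E|move=> x Ox nx|move=> x mx].
  by rewrite h3 // k3 // !mul1r mulrDl.
by rewrite h4 // k4 // !mul1r mulrDl.
Qed.

Lemma localisation_H2le B chi : measurable (B : set RR) -> tfB B chi -> exists2 C : R, 0 <= C &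
  forall U P P' F, poisson B U P P' F ->
  H2le (C * (n2 (cut B F) + n2 (cut B P) + n2 (cut B P') + n2 (cut B U))) (fun x => chi x * U x).
Proof.
move=> mB tchi; have [C C0 HC] := localisation mB tchi; exists C => // U P P' F /HC.
move=> [w [p [q [a' [b [c [H wE [w1 w2 w3 w4]]]]]]]].
have <- : w = fun x => chi x * U x by apply/funext.
by exists p, q, a', b, c.
Qed.

Lemma van_iso (B : set (R * R)) (s : iso) phi x : tfB B phi -> ~ B (s x) -> van (fun y => phi (s y)) x.
Proof. by move=> [_ _ vf] /vf; rewrite /van; exact: (@continuous_aff R _ _ _ _ _ x). Qed.

Lemma van_act (B O : set (R * R)) l phi x : tfB B phi -> inward O B (B `&` O) l -> O x -> ~ B x ->
  van (act l phi) x.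
Proof.
move=> tphi Hl Ox nB; elim: l Hl => [|e l IH] /=; first by move=> _; rewrite /van; apply: (@filterE _ (nbhs x)) => y.
move=> [He /IH v2]; have v1 : van (fun y => phi (e.2 y)) x.
  by apply: (van_iso tphi) => Bx; have [] := He x Ox Bx.
by move: v1 v2; rewrite /van; apply: filterS2 => y -> ->; rewrite mulr0 addr0.
Qed.

(** Away from the interface: symmetrising a solution by a list of symmetries
    extends it to a solution of the Poisson equation in all of [B]. *)
Lemma patch_symmetric (B : set (R * R)) l (k : R) chi : measurable (B : set RR) -> B `<=` Omega2 -> k != 0 ->
  inward Om B (B `&` Om) l -> (forall x, B x -> Om x -> a x = k) ->
  (forall phi, tfB B phi -> forall x, bdry Q x -> act l phi x = 0) ->
  (forall h : R * R -> R, (forall x, ~ Om x -> h x = 0) -> forall x, B x -> Om x -> act l h x = h x) ->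
  tfB B chi -> patch chi.
Proof.
move=> mB BO2 k0 Hl ak H1 H3 tchi.
have mBO : measurable (B `&` Om : set RR) by apply: measurableI => //; exact: mopen_rect.
have [C C0 HC] := localisation_H2le mB tchi.
have [D D0 HD] := n2_act_cut mB mBO Hl.
have [D' D'0 HD'] := n2_actxy_cut mB mBO Hl.
have VB h : bL2 h -> n2 (cut (B `&` Om) h) <= n2 (cut V h).
  move=> bh; rewrite -[leRHS]mul1r -(expr1n _ 2); apply: n2_le.
  - exact: bL2_cut mV bh.
  - exact: bL2_cut mBO bh.
  move=> x; rewrite mul1r; have [[Bx Ox]|nB] := pselect ((B `&` Om) x); last by rewrite cut_out // normr0.
  by rewrite !cut_in //; split => //; exact: BO2.
pose k2 := (k^-1) ^+ 2; have k20 : 0 <= k2 := sqr_ge0 _.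
exists (C * (k2 * D + 2 * D' + D)); first by have := mulr_ge0 k20 D0 => h; apply: mulr_ge0 => //; lra.
move=> u p q f H; have e0 := energy_ge0 u p q f.
have [bu bp bq bf u0 p0 q0 f0 Hwg Heq] := H.
have bap := bmM bm_coef bp; have baq := bmM bm_coef bq.
have P : poisson B (act l u) (actx l p q) (acty l p q) (fun x => k^-1 * act l f x).
  split; [exact: bL2_act|exact: bL2_actx|exact: bL2_acty|apply: bL2Z; exact: bL2_act| |].
    by move=> phi /tfB_tf; exact: wg_act.
  move=> phi tphi; have t := tfB_tf tphi; have ta := tf_act l t; have bphi := bL2_tf t.
  have bx := bL2_tf (tfB_dx ta); have by_ := bL2_tf (tfB_dy ta).
  rewrite dirichlet_act // ipZl //; last exact: bL2_act.
  rewrite ip_act // -(Heq _ ta (H1 _ tphi)) mulrDr.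
  have E h psi : bL2 h -> bL2 psi -> (forall x, ~ Om x -> h x = 0) -> (forall x, Om x -> ~ B x -> psi x = 0) ->
      ip h psi = k^-1 * ip (fun x => a x * h x) psi.
    move=> bh bpsi h0 psi0; rewrite -(ipZl _ (bmM bm_coef bh) bpsi); apply: eq_I => x.
    have [Ox|nO] := pselect (Om x); last by rewrite h0 // !mulr0 !mul0r.
    have [Bx|nB] := pselect (B x); last by rewrite psi0 // !mulr0.
    by rewrite ak // mulKf.
  congr (_ + _); apply: E => // x Ox nB; apply: van_at.
    by apply: van_dx; exact: van_act Hl Ox nB.
  by apply: van_dy; exact: van_act Hl Ox nB.
have W : H2le (C * (k2 * D + 2 * D' + D) * energy u p q f) (fun x => chi x * act l u x).
  apply: H2le_mono (HC _ _ _ _ P); rewrite -mulrA; apply: ler_wpM2l => //.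
  rewrite cut_scale n2Z -/k2; last by apply: bL2_cut => //; exact: bL2_act.
  have [x1 x2] := HD' p q bp bq p0 q0; have x3 := HD u bu u0; have x4 := HD f bf f0.
  have y1 := ler_wpM2l D'0 (lerD (VB _ bp) (VB _ bq)); have y3 := ler_wpM2l D0 (VB _ bu).
  have y4 := ler_wpM2l k20 (le_trans x4 (ler_wpM2l D0 (VB _ bf))).
  have k2D : 0 <= k2 * D by rewrite mulr_ge0.
  have G c h : 0 <= c -> 0 <= c * n2 (cut V h) by move=> c0; rewrite mulr_ge0 // n2_ge0.
  have g1 := G _ u k2D; have g2 := G _ p k2D; have g3 := G _ q k2D.
  have g4 := G _ u D'0; have g5 := G _ f D'0; have g6 := G _ p D0; have g7 := G _ q D0; have g8 := G _ f D0.
  rewrite /energy; move: y1 y3 y4 x1 x2 x3 x4 g1 g2 g3 g4 g5 g6 g7 g8.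
  rewrite mulrA; lra.
exists (fun x => chi x * act l u x), (fun x => chi x * act l u x).
have E x : Om x -> chi x * act l u x = chi x * u x.
  move=> Ox; have [Bx|nB] := pselect (B x); first by rewrite H3.
  by rewrite (tfB_out tchi nB) !mul0r.
split => // [x Ox _|x mx]; first exact: E.
by apply: E; apply: HQm; exact: subset_closure.
Qed.

End Patches.

(** * Decomposition at a side of the inner rectangle *)
Section InterfacePatch.
Context {R : realType}.
Implicit Types (f g h u v w p q phi psi chi F G : R * R -> R) (x y : R * R).
Local Notation RR := (measurableTypeR R * measurableTypeR R)%type.

Lemma iso1_p : (0 : R * R).1 + 1 * (0 : R * R).1 + 0 * (0 : R * R).2 = 0 :> R.
Proof. by rewrite /=; ring. Qed.
Lemma iso1_p' : (0 : R * R).2 + 0 * (0 : R * R).1 + 1 * (0 : R * R).2 = 0 :> R.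
Proof. by rewrite /=; ring. Qed.
Lemma iso1_ab : (1 : R) ^+ 2 + 0 ^+ 2 = 1. Proof. by ring. Qed.
Lemma iso1_bd : (0 : R) ^+ 2 + 1 ^+ 2 = 1. Proof. by ring. Qed.
Lemma iso1_ad : (0 : R) * (1 + 1) = 0. Proof. by ring. Qed.
Definition iso1 : @iso R := Iso iso1_ab iso1_bd iso1_ad iso1_p iso1_p'.

Lemma iso1E x : iso1 x = x.
Proof. by case: x => x1 x2; rewrite /iso_fun /aff /=; congr pair; ring. Qed.

Variables (Q Qm : rectangle R) (ap am : R) (Omega2 : set (R * R)).
Hypotheses (HQm : closure (open_rect Qm) `<=` open_rect Q) (oO2 : open Omega2).
Hypotheses (ap0 : ap != 0) (am0 : am != 0) (apm0 : ap + am != 0).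

Local Notation Om := (open_rect Q).
Local Notation Omm := (open_rect Qm).
Local Notation V := (Omega2 `&` Om).
Local Notation a := (coef Qm ap am).

(** The weight is constant on either side of the interface: by the divergence
    theorem on the inner rectangle, the jump contributes the boundary integral of
    [psi * phi], which is zero. *)
Lemma ip_weight (c d : R) psi phi : smooth psi -> tf phi -> (forall x, bdry Qm x -> psi x * phi x = 0) ->
  ip (fun x => (c + d * ind Omm x) * psi x) (px phi) = - ip (fun x => (c + d * ind Omm x) * px psi x) phi /\
  ip (fun x => (c + d * ind Omm x) * psi x) (py phi) = - ip (fun x => (c + d * ind Omm x) * py psi x) phi.
Proof.
move=> spsi tphi G0; have sphi := tfB_smooth tphi.
pose G x := psi x * phi x; have tG : tf G by exact: tfBMl.
have sG := tfB_smooth tG; have [d1 d2] := rect_div0 sG G0.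
have tpx := tfB_dx tphi; have tpy := tfB_dy tphi.
have mO : measurable (Omm : set RR) := mopen_rect Qm.
have key (D : (R * R -> R) -> R * R -> R) : bL2 (D G) -> I (D G) = 0 -> I (cut Omm (D G)) = 0 ->
    (forall x, D G x = D psi x * phi x + psi x * D phi x) ->
    tf (D phi) -> smooth (D psi) ->
    ip (fun x => (c + d * ind Omm x) * psi x) (D phi) = - ip (fun x => (c + d * ind Omm x) * D psi x) phi.
  move=> bD I1 I2 DG tD sD; apply/eqP; rewrite -addr_eq0; apply/eqP.
  have b1 : bL2 (fun x => psi x * D phi x) by apply: bL2_tf; exact: tfBMl.
  have b2 : bL2 (fun x => D psi x * phi x) by apply: bL2_tf; exact: tfBMl.
  have mw := bm_wt Qm c d.
  rewrite -ID; first last.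
  - have := bL2_itg (bmM mw b2); congr itg; apply/funext => x; ring.
  - have := bL2_itg (bmM mw b1); congr itg; apply/funext => x; ring.
  transitivity (c * I (D G) + d * I (cut Omm (D G))); last by rewrite I1 I2 !mulr0 addr0.
  rewrite -(IZ c (bL2_itg bD)) -(IZ d (bL2_itg (bL2_cut mO bD))) -ID.
  - by apply: eq_I => x; rewrite /cut DG; ring.
  - exact/bL2_itg/bL2Z.
  - exact/bL2_itg/bL2Z/bL2_cut.
have [i1 i2] : I (px G) = 0 /\ I (py G) = 0 by split; [exact: I_dx|exact: I_dy].
split; [apply: (key (@px R))|apply: (key (@py R))] => //.
- by apply: bL2_tf; exact: tfB_dx.
- by move=> x; rewrite dxM.
- exact: smooth_dx.
- by apply: bL2_tf; exact: tfB_dy.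
- by move=> x; rewrite dyM.
- exact: smooth_dy.
Qed.

Variables (B : set (R * R)) (sg : @iso R) (e : R).
Hypotheses (mB : measurable (B : set RR)) (BO2 : B `<=` Omega2) (e0 : 0 < e)
  (Be : forall x, B x -> ball x e `<=` Om) (Bsg : forall x, B x -> B (sg x))
  (bdsg : forall x, B x -> bdry Qm x -> sg x = x)
  (sgm : forall x, B x -> sg x <> x -> Omm (sg x) <-> ~ Omm x)
  (mL : measurable ([set x | sg x = x] : set RR)) (L0 : lebesgue2 R [set x | sg x = x] = 0%E).

Definition lanti : seq (R * @iso R) := [:: (1, iso1); (-1, sg)].
Definition lsym : seq (R * @iso R) := [:: (1, iso1); (1, sg)].

Lemma antiE h x : act lanti h x = h x - h (sg x).
Proof. by rewrite /= iso1E; ring. Qed.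
Lemma symE h x : act lsym h x = h x + h (sg x).
Proof. by rewrite /= iso1E; ring. Qed.

Lemma BOm x : B x -> Om x.
Proof. by move=> Bx; apply: (Be Bx); exact: ballxx. Qed.

Lemma nB_sg x : ~ B x -> ~ B (sg x).
Proof. by move=> nB /Bsg; rewrite isoK. Qed.

Lemma anti_bdry h x : bdry Qm x -> B x -> act lanti h x = 0.
Proof. by move=> bx Bx; rewrite antiE bdsg // subrr. Qed.

Lemma tfB_sg phi : tfB B phi -> tfB B (fun x => phi (sg x)).
Proof. by move=> t; apply: (tfB_aff (iso_det sg) _ t) => x /Bsg; rewrite -/(iso_fun sg _) isoK. Qed.

Lemma tfB_anti phi : tfB B phi -> tfB B (act lanti phi).
Proof.
move=> t; have -> : act lanti phi = fun x => phi x - phi (sg x) by apply/funext => x; rewrite antiE.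
by apply: tfBB => //; exact: tfB_sg.
Qed.

Let wt := fun x => ap^-1 + (am^-1 - ap^-1) * ind Omm x.

Lemma wtE x : wt x = (a x)^-1.
Proof.
rewrite /wt coefE; have [Ox|nO] := pselect (Omm x).
  by rewrite (ind1 Ox) !mulr1 addrC subrK [ap + _]addrC subrK.
by rewrite (ind0 nO) !mulr0 !addr0.
Qed.

Lemma a_wt x : a x * wt x = 1.
Proof. by rewrite wtE divff // /coef; case: ifP. Qed.

(** The odd part [u - u o sg] solves the Poisson equation: the test functions
    [act lanti phi / a] are admissible because [act lanti phi] vanishes on the interface. *)
Lemma poisson_anti u p q f : dirichlet Q a u p q f ->
  poisson B (act lanti u) (actx lanti p q) (acty lanti p q) (act lanti (fun x => wt x * f x)).
Proof.
move=> H; have [bu bp bq bf _ _ _ _ Hwg _] := H.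
have mw : bm wt by exact: bm_wt. have bwf := bmM mw bf.
split; [exact: bL2_act|exact: bL2_actx|exact: bL2_acty|exact: bL2_act| |].
  by move=> phi /tfB_tf; exact: wg_act.
move=> phi tphi; have t := tfB_tf tphi; have bphi := bL2_tf t.
rewrite dirichlet_act // ip_act //.
have tpsi := tfB_anti tphi; set psi := act lanti phi in tpsi *; have tp := tfB_tf tpsi.
have bpsi := bL2_tf tp; have bx := bL2_tf (tfB_dx tp); have by_ := bL2_tf (tfB_dy tp).
have Hv : wg setT (fun x => wt x * psi x) (fun x => wt x * px psi x) (fun x => wt x * py psi x).
  move=> eta teta; apply: ip_weight => //; first exact: tfB_smooth tp.
  move=> x bdx; have [Bx|nB] := pselect (B x); first by rewrite /psi anti_bdry ?mul0r.
  by rewrite (tfB_out tpsi nB) mul0r.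
have := dirichlet_test (bm_coef Qm ap am) H e0 (bmM mw bpsi) (bmM mw bx) (bmM mw by_) Hv.
have E h k : ip (fun x => a x * h x) (fun x => wt x * k x) = ip h k.
  by apply: eq_I => x; rewrite mulrACA a_wt mul1r.
rewrite !E => -> //.
  by apply: eq_I => x; ring.
move=> x vx; apply: Be; apply: contrapT => nB; move: vx; rewrite (tfB_out tpsi nB) mulr0.
by rewrite eqxx.
Qed.

Let m := (ap + am) / 2.
Let d := (ap - am) / 2.
Let s := fun x => 1 + (-2) * ind Omm x.

(** Mollifying [u] before taking its odd part gives functions vanishing on the
    interface, to which [ip_weight] applies; then pass to the limit. *)
Lemma wg_sign_anti u p q : bL2 u -> bL2 p -> bL2 q -> wg setT u p q ->
  wg B (fun x => s x * act lanti u x) (fun x => s x * actx lanti p q x) (fun x => s x * acty lanti p q x).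
Proof.
move=> bu bp bq Hwg phi tphi; have t := tfB_tf tphi; have bphi := bL2_tf t.
have bx := bL2_tf (tfB_dx t); have by_ := bL2_tf (tfB_dy t); have ms : bm s by exact: bm_wt.
have b0 : bL2 (fun=> 0 : R) by exact: bL2_0.
have shift h k : ip (fun x => s x * h x) k = ip h (fun x => s x * k x) by apply: eq_I => x; ring.
have tr U k : bL2 U -> bL2 k -> ip (fun x => s x * act lanti U x) k = ip U (act lanti (fun x => s x * k x)).
  by move=> bU bk; rewrite shift ip_act //; exact: bmM.
have trx P P' k : bL2 P -> bL2 P' -> bL2 k -> ip (fun x => s x * actx lanti P P' x) k =
    ip P (actx lanti (fun x => s x * k x) (fun=> 0)) + ip P' (acty lanti (fun x => s x * k x) (fun=> 0)).
  by move=> bP bP' bk; rewrite shift -energy_act ?ip0r ?addr0 //; exact: bmM.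
have tryy P P' k : bL2 P -> bL2 P' -> bL2 k -> ip (fun x => s x * acty lanti P P' x) k =
    ip P (actx lanti (fun=> 0) (fun x => s x * k x)) + ip P' (acty lanti (fun=> 0) (fun x => s x * k x)).
  by move=> bP bP' bk; rewrite shift -energy_act ?ip0r ?add0r //; exact: bmM.
have lim h k : bL2 h -> bL2 k -> ip (moll h n) k @[n --> \oo] --> ip h k.
  by move=> bh bk; apply: cvgL2_ip => //; [move=> n; exact: bL2_moll|exact: moll_cvg].
have E n : ip (fun x => s x * act lanti (moll u n) x) (px phi) = - ip (fun x => s x * actx lanti (moll p n) (moll q n) x) phi /\
    ip (fun x => s x * act lanti (moll u n) x) (py phi) = - ip (fun x => s x * acty lanti (moll p n) (moll q n) x) phi.
  have tu := tf_moll n bu; have sa := tfB_smooth (tf_act lanti tu).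
  have [] := @ip_weight 1 (-2) (act lanti (moll u n)) phi sa t.
    move=> x bdx; have [Bx|nB] := pselect (B x); first by rewrite anti_bdry ?mul0r.
    by rewrite (tfB_out tphi nB) mulr0.
  by rewrite px_act // py_act // (px_moll n bu bp Hwg) (py_moll n bu bq Hwg).
have uniq (x y : nat -> R) (X Y : R) : (forall n, x n = y n) -> x n @[n --> \oo] --> X -> y n @[n --> \oo] --> Y -> X = Y.
  move=> xy cx cy; have e' : x = y by apply/funext.
  by rewrite e' in cx; rewrite -(cvg_lim _ cx) // -(cvg_lim _ cy).
have sb := bmM ms bphi; have bA k := bL2_act lanti (bmM ms k).
have [X0 X1] := (bL2_actx lanti sb b0, bL2_acty lanti sb b0).
have [Y0 Y1] := (bL2_actx lanti b0 sb, bL2_acty lanti b0 sb).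
have bn n := bL2_moll n bu; have pn n := bL2_moll n bp; have qn n := bL2_moll n bq.
split.
  rewrite tr // trx //; apply: (uniq _ _ _ _ _ (lim _ _ bu (bA _ bx)) (cvgN (cvgD (lim _ _ bp X0) (lim _ _ bq X1)))).
  by move=> n; have [h _] := E n; rewrite tr // trx // in h; exact: h.
rewrite tr // tryy //; apply: (uniq _ _ _ _ _ (lim _ _ bu (bA _ by_)) (cvgN (cvgD (lim _ _ bp Y0) (lim _ _ bq Y1)))).
by move=> n; have [_ h] := E n; rewrite tr // tryy // in h; exact: h.
Qed.

Let D u x := m * act lsym u x + d * (s x * act lanti u x).

(** The even part does not solve an equation of its own, but corrected by the
    odd part, with the sign [s], it does: the flux [a grad u], symmetrised, is its gradient. *)
Lemma poisson_sym u p q f : dirichlet Q a u p q f ->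
  poisson B (D u) (fun x => m * actx lsym p q x + d * (s x * actx lanti p q x))
    (fun x => m * acty lsym p q x + d * (s x * acty lanti p q x)) (act lsym f).
Proof.
move=> H; have [bu bp bq bf _ _ _ _ Hwg Heq] := H.
have ms : bm s by exact: bm_wt.
have bap := bmM (bm_coef Qm ap am) bp; have baq := bmM (bm_coef Qm ap am) bq.
have bE := bL2_act lsym bu; have bEx := bL2_actx lsym bp bq; have bEy := bL2_acty lsym bp bq.
have bS := bmM ms (bL2_act lanti bu); have bSx := bmM ms (bL2_actx lanti bp bq).
have bSy := bmM ms (bL2_acty lanti bp bq).
split; [exact: bL2_lin|exact: bL2_lin|exact: bL2_lin|exact: bL2_act| |].
  apply: wg_lin => //; first by move=> phi /tfB_tf; exact: wg_act.
  exact: wg_sign_anti.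
move=> phi tphi; have t := tfB_tf tphi; have bphi := bL2_tf t; have ta := tf_act lsym t.
have bx := bL2_tf (tfB_dx t); have by_ := bL2_tf (tfB_dy t).
rewrite ip_act // -(Heq _ ta); last first.
  move=> x [_ nO]; have nB : ~ B x by move/BOm.
  by rewrite symE (tfB_out tphi nB) (tfB_out tphi (nB_sg nB)) addr0.
rewrite -dirichlet_act //.
have E (h k : R * R -> R) psi : bL2 h -> bL2 k -> bL2 psi -> (forall x, ~ B x -> psi x = 0) ->
    (forall x, B x -> sg x <> x -> h x = k x) -> ip h psi = ip k psi.
  move=> bh bk bpsi psi0 hk; apply/eqP; rewrite -subr_eq0 -ipBl //; apply/eqP.
  apply: (I_null mL L0); first by apply: itgM => //; exact: bL2B.
  move=> x /= nx; have [Bx|nB] := pselect (B x); first by rewrite hk // subrr mul0r.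
  by rewrite psi0 // mulr0.
have as_ x : a x = m + d * s x by rewrite coefE /m /d /s; field.
have ss x : B x -> sg x <> x -> s (sg x) = - s x.
  move=> Bx nx; have iff := sgm Bx nx; rewrite /s; have [Ox|nO] := pselect (Omm x).
    by rewrite (ind1 Ox) ind0; [ring|move/iff].
  by rewrite (ind0 nO) ind1; [ring|apply/iff].
have out_ (psi : R * R -> R) : tfB B psi -> forall x, ~ B x -> psi x = 0 by move=> tp x; exact: tfB_out.
congr (_ + _); apply: E; rewrite ?/D.
- exact: bL2_lin.
- exact: bL2_actx.
- exact: bx.
- exact/out_/tfB_dx.
- move=> x Bx nx; rewrite /= /isox !as_ ss // iso1E; ring.
- exact: bL2_lin.
- exact: bL2_acty.
- exact: by_.
- exact/out_/tfB_dy.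
- move=> x Bx nx; rewrite /= /isoy !as_ ss // iso1E; ring.
Qed.

(** [(ap + am) u] is [D u + am S] outside the inner rectangle and [D u + ap S] inside,
    where [S] is the odd part and [D u] the corrected even part of [u]; both are
    localised by [chi]. *)
Lemma patch_interface chi : tfB B chi -> patch Q Qm ap am Omega2 chi.
Proof.
move=> tchi; have [C C0 HC] := localisation_H2le mB tchi.
have mV_ : measurable (V : set RR) := mV Q oO2.
have BV x : B x -> V x by move=> Bx; split; [exact: BO2|exact: BOm].
have in1 x : Om x -> B (iso1 x) -> V x by rewrite iso1E => _; exact: BV.
have in2 x : Om x -> B (sg x) -> V x by move=> _ /Bsg; rewrite isoK; exact: BV.
have Hl (c1 c2 : R) : inward Om B V [:: (c1, iso1); (c2, sg)] by [].
have [K K0 HK] := n2_act_cut mB mV_ (Hl 1 (-1)).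
have [L L0' HL] := n2_act_cut mB mV_ (Hl 1 1).
have [K' K'0 HK'] := n2_actxy_cut mB mV_ (Hl 1 (-1)).
have [L' L'0 HL'] := n2_actxy_cut mB mV_ (Hl 1 1).
have [_ [W HW]] := bm_wt Qm ap^-1 (am^-1 - ap^-1).
have [_ [Z HZ]] := bm_wt Qm 1 (-2).
pose W2 := W ^+ 2; have W20 : 0 <= W2 := sqr_ge0 _.
pose m2 := 2 * m ^+ 2; pose d2 := 2 * (`|d| * Z) ^+ 2.
have m20 : 0 <= m2 by rewrite mulr_ge0 ?sqr_ge0.
have d20 : 0 <= d2 by rewrite mulr_ge0 ?sqr_ge0.
pose CS := C * (K * W2 + K' + K' + K).
pose CD := C * (L + (m2 * L' + d2 * K') + (m2 * L' + d2 * K') + (m2 * L + d2 * K)).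
have H2_ (c : R) : 0 <= 2 * c ^+ 2 by rewrite mulr_ge0 ?sqr_ge0.
have CS0 : 0 <= CS by rewrite mulr_ge0 // !addr_ge0 // mulr_ge0.
have CD0 : 0 <= CD by rewrite mulr_ge0 // !addr_ge0 // mulr_ge0.
pose c0 := (ap + am)^-1.
have leE u p q f : [/\ n2 (cut V u) <= energy Q Omega2 u p q f,
    n2 (cut V p) + n2 (cut V q) <= energy Q Omega2 u p q f, 0 <= energy Q Omega2 u p q f &
    n2 (cut V f) <= energy Q Omega2 u p q f].
  have k1 := n2_ge0 (cut V u); have k2 := n2_ge0 (cut V p); have k3 := n2_ge0 (cut V q); have k4 := n2_ge0 (cut V f).
  by rewrite /energy; split; lra.
have nDS E S : bL2 E -> bL2 S -> n2 (cut B (fun x => m * E x + d * (s x * S x))) <= m2 * n2 (cut B E) + d2 * n2 (cut B S).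
  move=> bE bS; have bE' := bL2_cut mB bE; have bS' := bL2_cut mB bS.
  have bsS := bmM (bm_wt Qm 1 (-2)) bS; have bsS' := bL2_cut mB bsS.
  rewrite cut_add !cut_scale; apply: (le_trans (n2D (bL2Z _ bE') (bL2Z _ bsS'))).
  rewrite n2Z // /m2 -mulrA lerD2l /d2 -mulrA ler_pM2l //.
  apply: n2_le => //; first exact: bL2Z.
  move=> x; rewrite /cut; have -> : d * (ind B x * (s x * S x)) = (d * s x) * (ind B x * S x) by ring.
  by rewrite normrM ler_wpM2r // normrM ler_wpM2l // HZ.
have NS u p q f : dirichlet Q a u p q f -> H2le (CS * energy Q Omega2 u p q f) (fun x => chi x * act lanti u x).
  move=> H; apply: H2le_mono (HC _ _ _ _ (poisson_anti H)).
  have [bu bp bq bf u0 p0 q0 f0 _ _] := H; have [le1 le2 le3 le4] := leE u p q f.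
  rewrite /CS -mulrA; apply: ler_wpM2l => //.
  have bwf := bmM (bm_wt Qm ap^-1 (am^-1 - ap^-1)) bf.
  have wf0 x : ~ Om x -> wt x * f x = 0 by move/f0 => ->; rewrite mulr0.
  have nw : n2 (cut V (fun x => wt x * f x)) <= W2 * n2 (cut V f).
    apply: n2_le; [exact: bL2_cut|exact: bL2_cut|] => x; rewrite /cut mulrCA normrM.
    by rewrite ler_wpM2r // HW.
  have x1 := HK _ bwf wf0; have x2 := HK _ bu u0; have [x3 x4] := HK' _ _ bp bq p0 q0.
  have y1 := ler_wpM2l K0 (le_trans nw (ler_wpM2l W20 le4)).
  have y2 := ler_wpM2l K0 le1; have y3 := ler_wpM2l K'0 le2.
  have -> : (K * W2 + K' + K' + K) * energy Q Omega2 u p q f = K * (W2 * energy Q Omega2 u p q f) +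
    K' * energy Q Omega2 u p q f + K' * energy Q Omega2 u p q f + K * energy Q Omega2 u p q f by ring.
  exact: lerD (lerD (lerD (le_trans x1 y1) (le_trans x3 y3)) (le_trans x4 y3)) (le_trans x2 y2).
have ND u p q f : dirichlet Q a u p q f -> H2le (CD * energy Q Omega2 u p q f) (fun x => chi x * D u x).
  move=> H; apply: H2le_mono (HC _ _ _ _ (poisson_sym H)).
  have [bu bp bq bf u0 p0 q0 f0 _ _] := H; have [le1 le2 le3 le4] := leE u p q f.
  rewrite /CD -mulrA; apply: ler_wpM2l => //.
  have bE := bL2_act lsym bu; have bEx := bL2_actx lsym bp bq; have bEy := bL2_acty lsym bp bq.
  have bS := bL2_act lanti bu; have bSx := bL2_actx lanti bp bq; have bSy := bL2_acty lanti bp bq.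
  have x1 := HL _ bf f0; have x2 := HL _ bu u0; have [x3 x4] := HL' _ _ bp bq p0 q0.
  have x5 := HK _ bu u0; have [x6 x7] := HK' _ _ bp bq p0 q0.
  have z1 := nDS _ _ bE bS; have z2 := nDS _ _ bEx bSx; have z3 := nDS _ _ bEy bSy.
  have y1 := ler_wpM2l L0' le4.
  have y2 := ler_wpM2l m20 (le_trans x2 (ler_wpM2l L0' le1)).
  have y3 := ler_wpM2l m20 (le_trans x3 (ler_wpM2l L'0 le2)).
  have y4 := ler_wpM2l m20 (le_trans x4 (ler_wpM2l L'0 le2)).
  have y5 := ler_wpM2l d20 (le_trans x5 (ler_wpM2l K0 le1)).
  have y6 := ler_wpM2l d20 (le_trans x6 (ler_wpM2l K'0 le2)).
  have y7 := ler_wpM2l d20 (le_trans x7 (ler_wpM2l K'0 le2)).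
  set en := energy Q Omega2 u p q f in y1 y2 y3 y4 y5 y6 y7 *.
  have -> : (L + (m2 * L' + d2 * K') + (m2 * L' + d2 * K') + (m2 * L + d2 * K)) * en =
    L * en + (m2 * (L' * en) + d2 * (K' * en)) + (m2 * (L' * en) + d2 * (K' * en)) + (m2 * (L * en) + d2 * (K * en)) by ring.
  exact: lerD (lerD (lerD (le_trans x1 y1) (le_trans z2 (lerD y3 y6))) (le_trans z3 (lerD y4 y7))) (le_trans z1 (lerD y2 y5)).
exists (2 * c0 ^+ 2 * CD + 2 * (c0 * am) ^+ 2 * CS + 2 * (c0 * ap) ^+ 2 * CS).
  by rewrite !addr_ge0 // mulr_ge0.
move=> u p q f H; have en := energy_ge0 Q Omega2 u p q f.
have hS := NS _ _ _ _ H; have hD := ND _ _ _ _ H.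
exists (fun x => c0 * (chi x * D u x) + (c0 * am) * (chi x * act lanti u x)),
       (fun x => c0 * (chi x * D u x) + (c0 * ap) * (chi x * act lanti u x)).
have T1 := mulr_ge0 (mulr_ge0 (H2_ (c0 * am)) CS0) en; have T2 := mulr_ge0 (mulr_ge0 (H2_ (c0 * ap)) CS0) en.
split.
- by apply: H2le_mono (H2le_lin c0 (c0 * am) hD hS); lra.
- by apply: H2le_mono (H2le_lin c0 (c0 * ap) hD hS); lra.
- move=> x Ox nx; have n2' : ~ Omm x by move/subset_closure.
  rewrite /D symE antiE /s (ind0 n2') /m /d /c0; field.
  exact: apm0.
- move=> x mx; rewrite /D symE antiE /s (ind1 mx) /m /d /c0; field.
  exact: apm0.
Qed.

End InterfacePatch.

(** * Discs, reflections and null lines *)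
Section Discs.
Context {R : realType}.
Implicit Types (f g h u v w p q phi psi chi F G : R * R -> R) (x y : R * R) (Q : rectangle R).
Local Notation RR := (measurableTypeR R * measurableTypeR R)%type.

Definition disc x0 (r : R) : set (R * R) := [set x | (x.1 - x0.1) ^+ 2 + (x.2 - x0.2) ^+ 2 < r ^+ 2].

Lemma disc_open x0 r : open (disc x0 r).
Proof.
have -> : disc x0 r = (fun x => (x.1 - x0.1) * (x.1 - x0.1) + (x.2 - x0.2) * (x.2 - x0.2)) @^-1` [set t | t < r ^+ 2].
  by apply/seteqP; split => x; rewrite /disc /= !expr2.
apply: open_comp; last exact: open_lt.
by move=> x _; apply: cvgD; apply: cvgM; apply: cvgB; try exact: cvg_cst; first [exact: cvg_fst|exact: cvg_snd].
Qed.

Lemma disc_ball x0 r x : 0 < r -> disc x0 r x -> ball x0 r x.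
Proof.
move=> r0; rewrite /disc /= => dx.
have K (a b : R) : (b - a) ^+ 2 < r ^+ 2 -> `|a - b| < r.
  by move=> h; rewrite distrC -ltr_sqr ?nnegrE ?normr_ge0 ?ltW // real_normK ?num_real.
have := sqr_ge0 (x.1 - x0.1); have := sqr_ge0 (x.2 - x0.2) => h1 h2.
rewrite -ball_normE /= prod_normE gt_max; apply/andP.
by split; apply: K; apply: le_lt_trans dx; rewrite ?lerDl ?lerDr.
Qed.

Lemma disc_sub x0 r r' : 0 < r -> r <= r' -> disc x0 r `<=` disc x0 r'.
Proof. by move=> r0 rr' x; rewrite /disc => h; apply: (lt_le_trans h); rewrite ler_sqr ?nnegrE; lra. Qed.

Lemma disc_nbhs x0 (U : set (R * R)) : open U -> U x0 -> exists2 r : R, 0 < r & disc x0 r `<=` U.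
Proof.
move=> oU Ux; have /nbhs_ballP[r /= r0 rU] : nbhs x0 U by exact: open_nbhs_nbhs.
by exists r => // x /(disc_ball r0) /rU.
Qed.

Lemma disc_rect Q x0 r x : disc x0 r x <-> (cs Q x - cs Q x0) ^+ 2 + (ct Q x - ct Q x0) ^+ 2 < r ^+ 2.
Proof. by rewrite -dist_rect. Qed.

Lemma cst_inj Q x y : cs Q x = cs Q y -> ct Q x = ct Q y -> x = y.
Proof. by move=> h1 h2; rewrite -(rect_pointE Q x) -(rect_pointE Q y) h1 h2. Qed.

(** The reflection across the line [n . x = k]. *)
Lemma reflection (n1 n2 k : R) : n1 ^+ 2 + n2 ^+ 2 = 1 -> exists s : @iso R, forall x,
  s x = (x.1 - 2 * (n1 * x.1 + n2 * x.2 - k) * n1, x.2 - 2 * (n1 * x.1 + n2 * x.2 - k) * n2).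
Proof.
move=> nn; have E2 : n2 ^+ 2 = 1 - n1 ^+ 2 by rewrite -nn; ring.
have h1 : (1 - 2 * n1 ^+ 2) ^+ 2 + (- 2 * n1 * n2) ^+ 2 = 1.
  by transitivity (1 + 4 * n1 ^+ 2 * (n1 ^+ 2 + n2 ^+ 2 - 1)); [ring|rewrite nn; ring].
have h2 : (- 2 * n1 * n2) ^+ 2 + (1 - 2 * n2 ^+ 2) ^+ 2 = 1.
  by transitivity (1 + 4 * n2 ^+ 2 * (n1 ^+ 2 + n2 ^+ 2 - 1)); [ring|rewrite nn; ring].
have h3 : (- 2 * n1 * n2) * ((1 - 2 * n1 ^+ 2) + (1 - 2 * n2 ^+ 2)) = 0.
  by transitivity (- 4 * n1 * n2 * (1 - (n1 ^+ 2 + n2 ^+ 2))); [ring|rewrite nn; ring].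
have h4 : (2 * k * n1, 2 * k * n2).1 + (1 - 2 * n1 ^+ 2) * (2 * k * n1, 2 * k * n2).1 + (- 2 * n1 * n2) * (2 * k * n1, 2 * k * n2).2 = 0.
  by rewrite /=; transitivity (4 * k * n1 * (1 - (n1 ^+ 2 + n2 ^+ 2))); [ring|rewrite nn; ring].
have h5 : (2 * k * n1, 2 * k * n2).2 + (- 2 * n1 * n2) * (2 * k * n1, 2 * k * n2).1 + (1 - 2 * n2 ^+ 2) * (2 * k * n1, 2 * k * n2).2 = 0.
  by rewrite /=; transitivity (4 * k * n2 * (1 - (n1 ^+ 2 + n2 ^+ 2))); [ring|rewrite nn; ring].
exists (Iso h1 h2 h3 h4 h5) => x; rewrite /iso_fun /aff /=; congr pair; ring.
Qed.

(** Reflections across the lines parallel to the sides, and at points, in the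
    coordinates of the rectangle. *)
Lemma reflection_cs Q (k : R) : exists s : @iso R, forall x, cs Q (s x) = 2 * k - cs Q x /\ ct Q (s x) = ct Q x.
Proof.
have ee := rect_dir_unit Q; set e := rect_dir Q in ee *; set v := rect_vertex Q.
have [s sE] := reflection (k + (e.1 * v.1 + e.2 * v.2)) ee.
exists s => x; rewrite sE /cs /ct -/e -/v /=; set A := e.1 * x.1 + e.2 * x.2 - _.
split; last by ring.
transitivity ((x.1 - v.1) * e.1 + (x.2 - v.2) * e.2 - 2 * A * (e.1 ^+ 2 + e.2 ^+ 2)); first by ring.
by rewrite ee /A; ring.
Qed.

Lemma reflection_ct Q (k : R) : exists s : @iso R, forall x, cs Q (s x) = cs Q x /\ ct Q (s x) = 2 * k - ct Q x.
Proof.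
have ee := rect_dir_unit Q; set e := rect_dir Q in ee *; set v := rect_vertex Q.
have ee' : (- e.2) ^+ 2 + e.1 ^+ 2 = 1 by rewrite -ee; ring.
have [s sE] := reflection (k + (e.1 * v.2 - e.2 * v.1)) ee'.
exists s => x; rewrite sE /cs /ct -/e -/v /=; set A := - e.2 * x.1 + e.1 * x.2 - _.
split; first by ring.
transitivity ((x.2 - v.2) * e.1 - (x.1 - v.1) * e.2 - 2 * A * (e.1 ^+ 2 + e.2 ^+ 2)); first by ring.
by rewrite ee /A; ring.
Qed.

Lemma reflection_cst Q (k l : R) : exists s : @iso R, forall x, cs Q (s x) = 2 * k - cs Q x /\ ct Q (s x) = 2 * l - ct Q x.
Proof.
have ee := rect_dir_unit Q; set c := rect_point Q k l.
have h1 : (-1 : R) ^+ 2 + 0 ^+ 2 = 1 by ring.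
have h2 : (0 : R) ^+ 2 + (-1) ^+ 2 = 1 by ring.
have h3 : (0 : R) * (-1 + -1) = 0 by ring.
have h4 : (2 * c.1, 2 * c.2).1 + -1 * (2 * c.1, 2 * c.2).1 + 0 * (2 * c.1, 2 * c.2).2 = 0 by rewrite /=; ring.
have h5 : (2 * c.1, 2 * c.2).2 + 0 * (2 * c.1, 2 * c.2).1 + -1 * (2 * c.1, 2 * c.2).2 = 0 by rewrite /=; ring.
exists (Iso h1 h2 h3 h4 h5) => x; rewrite /iso_fun /aff /= /cs /ct /c /=; set e := rect_dir Q in ee *; set v := rect_vertex Q.
split.
  transitivity (2 * k * (e.1 ^+ 2 + e.2 ^+ 2) - ((x.1 - v.1) * e.1 + (x.2 - v.2) * e.2)); first by ring.
  by rewrite ee mulr1.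
transitivity (2 * l * (e.1 ^+ 2 + e.2 ^+ 2) - ((x.2 - v.2) * e.1 - (x.1 - v.1) * e.2)); first by ring.
by rewrite ee mulr1.
Qed.

(** Rigid motions preserve the measure. *)
Lemma null_rotated Q (A : set (R * R)) : measurable (A : set RR) -> 
  lebesgue2 R [set y | A (rect_point Q y.1 y.2)] = 0%E -> lebesgue2 R A = 0%E.
Proof.
move=> mA; pose T := aff (rect_vertex Q) (rect_dir Q).1 (- (rect_dir Q).2) (rect_dir Q).2 (rect_dir Q).1.
have mT := @measurable_aff R (rect_vertex Q) (rect_dir Q).1 (- (rect_dir Q).2) (rect_dir Q).2 (rect_dir Q).1.
have E : [set y | A (rect_point Q y.1 y.2)] = T @^-1` A.
  by apply/seteqP; split => y /=; rewrite rect_pointA.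
have m1 : measurable_fun setT (fun x : RR => (ind A x)%:E).
  by apply/measurable_EFinP; exact: (bm_ind mA).1.
have ge0 x : (0 <= (ind A x)%:E)%E.
  by have [Ax|nA] := pselect (A x); [rewrite (ind1 Ax) lee_fin|rewrite (ind0 nA)].
have := integral_aff (rect_vertex Q) (rect_detA Q) m1 ge0.
have -> : (\int[lebesgue2 R]_x (ind A x)%:E = lebesgue2 R A)%E.
  by rewrite /ind integral_indic // setIT.
have mB : measurable (T @^-1` A : set RR) by rewrite -[X in measurable X]setTI; exact: mT.
have -> : (\int[lebesgue2 R]_x (ind A (T x))%:E = lebesgue2 R (T @^-1` A))%E.
  rewrite -[in RHS](setIT (T @^-1` A)).
  by rewrite -integral_indic.
by rewrite E => -> .
Qed.

Lemma null_cs Q (k : R) : measurable ([set x | cs Q x = k] : set RR) /\ lebesgue2 R [set x | cs Q x = k] = 0%E.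
Proof.
have mA : measurable ([set x | cs Q x = k] : set RR).
  have -> : [set x | cs Q x = k] = ~` (cs Q @^-1` (~` [set k])) by rewrite -[LHS]setCK.
  apply: measurableC; apply: open2_measurable; apply: open_comp; first by move=> x _; exact: continuous_cs.
  by apply: closed_openC; exact: closed_eq.
split => //; apply: (@null_rotated Q) => //.
have -> : [set y | [set x | cs Q x = k] (rect_point Q y.1 y.2)] = [set k] `*` setT.
  by apply/seteqP; split => y /=; rewrite cs_point; tauto.
by have := mu_setX (measurable_set1 k) (@measurableT _ (measurableTypeR R)); rewrite lebesgue_measure_set1 mul0e.
Qed.

Lemma null_ct Q (k : R) : measurable ([set x | ct Q x = k] : set RR) /\ lebesgue2 R [set x | ct Q x = k] = 0%E.
Proof.
have mA : measurable ([set x | ct Q x = k] : set RR).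
  have -> : [set x | ct Q x = k] = ~` (ct Q @^-1` (~` [set k])) by rewrite -[LHS]setCK.
  apply: measurableC; apply: open2_measurable; apply: open_comp; first by move=> x _; exact: continuous_ct.
  by apply: closed_openC; exact: closed_eq.
split => //; apply: (@null_rotated Q) => //.
have -> : [set y | [set x | ct Q x = k] (rect_point Q y.1 y.2)] = setT `*` [set k].
  by apply/seteqP; split => y /=; rewrite ct_point; tauto.
by have := mu_setX (@measurableT _ (measurableTypeR R)) (measurable_set1 k); rewrite lebesgue_measure_set1 mule0.
Qed.

End Discs.

(** * A patch around every point *)
Section LocalPatches.
Context {R : realType}.
Implicit Types (f g h u v w p q phi psi chi F G : R * R -> R) (x y : R * R).
Local Notation RR := (measurableTypeR R * measurableTypeR R)%type.

Variables (Q Qm : rectangle R) (ap am : R) (Omega2 : set (R * R)).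
Hypotheses (HQm : closure (open_rect Qm) `<=` open_rect Q) (oO2 : open Omega2).
Hypotheses (ap0 : ap != 0) (am0 : am != 0) (apm0 : ap + am != 0).

Local Notation Om := (open_rect Q).
Local Notation Omm := (open_rect Qm).
Local Notation locally_patched x0 := (exists2 r : R, 0 < r & forall chi, tfB (disc x0 r) chi -> patch Q Qm ap am Omega2 chi).

Lemma mdisc x0 (r : R) : measurable (disc x0 r : set RR).
Proof. by apply: open2_measurable; exact: disc_open. Qed.

Lemma patch_inside x0 : Omega2 x0 -> Omm x0 -> locally_patched x0.
Proof.
move=> h2 hm; have oU : open (Omega2 `&` Omm) by apply: openI => //; exact: open_rect_open.
have [r r0 rU] := disc_nbhs oU (conj h2 hm); exists r => // chi tchi.
have BQ x : disc x0 r x -> Om x by move=> /rU[_ /subset_closure/HQm].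
apply: (@patch_symmetric R Q Qm ap am Omega2 HQm oO2 (disc x0 r) [:: (1, iso1)] am) => //.
- exact: mdisc.
- by move=> x /rU[].
- by split=> // x Ox; rewrite iso1E.
- by move=> x /rU[_ mx] _; rewrite /coef mem_set.
- move=> phi tphi x [_ nO]; rewrite /= iso1E (tfB_out tphi) ?mulr0 ?addr0 // => /BQ; exact: nO.
- by move=> h _ x _ _; rewrite /= iso1E mul1r addr0.
Qed.

(** Both points lie on the same side of the centre [k] of the reflection. *)
Lemma reflect_away (L k s s0 : R) : 0 <= s <= L -> 0 <= s0 <= L -> (k = 0 \/ k = L) ->
  (s - s0) ^+ 2 <= (2 * k - s - s0) ^+ 2.
Proof.
move=> /andP[h1 h2] /andP[h3 h4] [->|->]; rewrite -subr_ge0.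
  have -> : (2 * 0 - s - s0) ^+ 2 - (s - s0) ^+ 2 = 4 * (s * s0) by ring.
  by rewrite mulr_ge0 // mulr_ge0.
have -> : (2 * L - s - s0) ^+ 2 - (s - s0) ^+ 2 = 4 * ((L - s) * (L - s0)) by ring.
by rewrite mulr_ge0 // mulr_ge0 ?subr_ge0.
Qed.

Lemma nearest_end (L s0 : R) : 0 < L -> 0 <= s0 <= L -> exists k, (k = 0 \/ k = L) /\ `|s0 - k| <= L / 2.
Proof.
move=> L0 /andP[h1 h2]; have [h|h] := leP s0 (L / 2).
  by exists 0; split; [left|rewrite subr0 ger0_norm].
by exists L; split; [right|rewrite distrC ger0_norm; lra].
Qed.

(** Up to the outer boundary: extend the solution by odd reflections across the
    two nearest sides, which also treats the corners. *)
Lemma patch_outer x0 : Omega2 x0 -> closure Om x0 -> ~ closure Omm x0 -> locally_patched x0.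
Proof.
move=> h2 hc hm; have oU : open (Omega2 `&` ~` closure Omm).
  by apply: openI => //; apply: closed_openC; exact: closed_closure.
have [r1 r10 rU] := disc_nbhs oU (conj h2 hm).
rewrite closure_open_rect in hc; have [c1 c2 c3 c4] := hc.
have L1 := rect_len1_gt0 Q; have L2 := rect_len2_gt0 Q.
set S := rect_len1 Q in c2 L1 *; set T := rect_len2 Q in c4 L2 *.
have hs0 : 0 <= cs Q x0 <= S by rewrite c1. have ht0 : 0 <= ct Q x0 <= T by rewrite c3.
have [k [k0 kS]] := nearest_end L1 hs0; have [l [l0 lT]] := nearest_end L2 ht0.
pose r := Num.min r1 (Num.min (S / 2) (T / 2)).
have r0 : 0 < r by rewrite !lt_min r10 !divr_gt0.
have [rr1 rS rT] : [/\ r <= r1, r <= S / 2 & r <= T / 2] by rewrite /r !ge_min !lexx !orbT.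
have [s1 E1] := reflection_cs Q k; have [s2 E2] := reflection_ct Q l; have [s3 E3] := reflection_cst Q k l.
exists r => // chi tchi.
pose l4 : seq (R * @iso R) := [:: (1, iso1); (-1, s1); (-1, s2); (1, s3)].
have DB x : disc x0 r x -> disc x0 r1 x by apply: disc_sub.
(* The disc is narrower than half of either side, so that it misses the two opposite sides. *)
have far1 x : disc x0 r x -> `|cs Q x - cs Q x0| < S / 2.
  move=> /(disc_rect Q) dx; apply: (lt_le_trans _ rS); rewrite -ltr_sqr ?nnegrE ?normr_ge0 ?ltW // real_normK ?num_real //.
  by apply: le_lt_trans dx; rewrite lerDl sqr_ge0.
have far2 x : disc x0 r x -> `|ct Q x - ct Q x0| < T / 2.
  move=> /(disc_rect Q) dx; apply: (lt_le_trans _ rT); rewrite -ltr_sqr ?nnegrE ?normr_ge0 ?ltW // real_normK ?num_real //.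
  by apply: le_lt_trans dx; rewrite lerDr sqr_ge0.
have away x s t : closed_rect Q x -> (s = cs Q x \/ s = 2 * k - cs Q x) -> (t = ct Q x \/ t = 2 * l - ct Q x) ->
   (s - cs Q x0) ^+ 2 + (t - ct Q x0) ^+ 2 < r ^+ 2 -> disc x0 r x.
  move=> [x1 x2 x3 x4] hs ht; move=> H; apply/(disc_rect Q); apply: le_lt_trans H; apply: lerD.
    by case: hs => ->; [exact: lexx|apply: (@reflect_away S) => //; rewrite x1].
  by case: ht => ->; [exact: lexx|apply: (@reflect_away T) => //; rewrite x3].
apply: (@patch_symmetric R Q Qm ap am Omega2 HQm oO2 (disc x0 r) l4 ap) => //.
- exact: mdisc.
- by move=> x /DB/rU[].
- have K (s : @iso R) x : Om x -> (cs Q (s x) = cs Q x \/ cs Q (s x) = 2 * k - cs Q x) ->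
      (ct Q (s x) = ct Q x \/ ct Q (s x) = 2 * l - ct Q x) -> disc x0 r (s x) -> (disc x0 r `&` Om) x.
    by move=> Ox hs ht /(disc_rect Q) H; split => //; apply: away H => //; exact: open_rect_closed.
  rewrite /l4 /=; split; [|split; [|split; [|split => //]]] => x Ox; apply: K => //.
  + by rewrite iso1E; left.
  + by rewrite iso1E; left.
  + by right; case: (E1 x).
  + by left; case: (E1 x).
  + by left; case: (E2 x).
  + by right; case: (E2 x).
  + by right; case: (E3 x).
  + by right; case: (E3 x).
- move=> x /DB/rU[_ nc] _; rewrite /coef memNset // => /subset_closure; exact: nc.
- move=> phi tphi x [[x1 x2 x3 x4] nO].
  have -> : act l4 phi x = phi x - phi (s1 x) - phi (s2 x) + phi (s3 x) by rewrite /= iso1E; ring.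
  have [e1 e1'] := E1 x; have [e2 e2'] := E2 x; have [e3 e3'] := E3 x.
  have [xk|xk] := eqVneq (cs Q x) k.
    have -> : s1 x = x by apply: (@cst_inj _ Q); rewrite ?e1 ?e1' // xk; ring.
    have -> : s3 x = s2 x by apply: (@cst_inj _ Q); rewrite ?e3 ?e3' ?e2 ?e2' // xk; ring.
    by ring.
  have [xl|xl] := eqVneq (ct Q x) l.
    have -> : s2 x = x by apply: (@cst_inj _ Q); rewrite ?e2 ?e2' // xl; ring.
    have -> : s3 x = s1 x by apply: (@cst_inj _ Q); rewrite ?e3 ?e3' ?e1 ?e1' // xl; ring.
    by ring.
  have Z y : S / 2 <= `|cs Q y - cs Q x0| \/ T / 2 <= `|ct Q y - ct Q x0| -> phi y = 0.
    move=> H; apply: (tfB_out tphi) => dy; have := far1 _ dy; have := far2 _ dy.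
    by case: H => H; rewrite ltNge ?H // => _; rewrite ltNge H.
  (* On the side opposite to the axis of reflection all four terms vanish. *)
  have opp (L m s s0 : R) : 0 < L -> 0 <= s0 <= L -> m = 0 \/ m = L -> s = 0 \/ s = L -> s != m -> `|s0 - m| <= L / 2 ->
      L / 2 <= `|s - s0| /\ L / 2 <= `|2 * m - s - s0|.
    move=> L0 /andP[z1 z2]; rewrite ler_norml => hm' hs' sm /andP[z3 z4].
    case: hm' hs' sm z3 z4 => -> [->|->]; rewrite ?eqxx // => _ z3 z4; split; rewrite ler_normr; apply/orP;
      first [left; lra|right; lra].
  have side : (cs Q x = 0 \/ cs Q x = S) \/ (ct Q x = 0 \/ ct Q x = T).
    apply: contrapT => H; apply: nO; apply/open_rectE.
    by split; rewrite lt_neqAle ?x1 ?x2 ?x3 ?x4 andbT; apply/eqP => E; apply: H; rewrite -?E; tauto.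
  case: side => [hs|ht].
    have [oa ob] := opp _ _ _ _ L1 hs0 k0 hs xk kS.
    rewrite (Z x) ?(Z (s1 x)) ?(Z (s2 x)) ?(Z (s3 x)) ?e1 ?e2 ?e3; try (by left).
    by ring.
  have [oa ob] := opp _ _ _ _ L2 ht0 l0 ht xl lT.
  rewrite (Z x) ?(Z (s1 x)) ?(Z (s2 x)) ?(Z (s3 x)) ?e1' ?e2' ?e3'; try (by right).
  by ring.
- move=> h h0 x _ Ox; have /open_rectE[x1 x2 x3 x4] := Ox; rewrite -/S in x2; rewrite -/T in x4.
  have -> : act l4 h x = h x - h (s1 x) - h (s2 x) + h (s3 x) by rewrite /= iso1E; ring.
  have [e1 e1'] := E1 x; have [e2 e2'] := E2 x; have [e3 e3'] := E3 x.
  rewrite (h0 (s1 x)) ?(h0 (s2 x)) ?(h0 (s3 x)); first by ring.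
  + by move=> /open_rectE[z1 z2 _ _]; rewrite e3 -/S in z1 z2; case: k0 z1 z2 => ->; lra.
  + by move=> /open_rectE[_ _ z1 z2]; rewrite e2' -/T in z1 z2; case: l0 z1 z2 => ->; lra.
  + by move=> /open_rectE[z1 z2 _ _]; rewrite e1 -/S in z1 z2; case: k0 z1 z2 => ->; lra.
Qed.

End LocalPatches.

Section SidePatches.
Context {R : realType}.
Implicit Types (f g h u v w p q phi psi chi F G : R * R -> R) (x y : R * R).
Local Notation RR := (measurableTypeR R * measurableTypeR R)%type.

Variables (Q Qm : rectangle R) (ap am : R) (Omega2 : set (R * R)).
Hypotheses (HQm : closure (open_rect Qm) `<=` open_rect Q) (oO2 : open Omega2).
Hypotheses (ap0 : ap != 0) (am0 : am != 0) (apm0 : ap + am != 0).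

Local Notation Om := (open_rect Q).
Local Notation Omm := (open_rect Qm).
Local Notation locally_patched x0 := (exists2 r : R, 0 < r & forall chi, tfB (disc x0 r) chi -> patch Q Qm ap am Omega2 chi).

(** Interior points of the sides of the inner rectangle. The coordinates [c1],
    [c2] are those of the rectangle, in the order which makes [c1 = k] the side. *)
Lemma patch_side (c1 c2 : R * R -> R) (S T k : R) (sg : @iso R) x0 :
  (forall x, Omm x <-> [/\ 0 < c1 x, c1 x < S, 0 < c2 x & c2 x < T]) ->
  (forall x, closed_rect Qm x -> 0 <= c1 x /\ c1 x <= S) ->
  (forall x y, (x.1 - y.1) ^+ 2 + (x.2 - y.2) ^+ 2 = (c1 x - c1 y) ^+ 2 + (c2 x - c2 y) ^+ 2) ->
  (forall x, c1 (sg x) = 2 * k - c1 x /\ c2 (sg x) = c2 x) ->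
  (forall x, c1 x = k -> sg x = x) ->
  0 < S -> k = 0 \/ k = S -> c1 x0 = k -> 0 < c2 x0 < T ->
  measurable ([set x | c1 x = k] : set RR) -> lebesgue2 R [set x | c1 x = k] = 0%E ->
  Omega2 x0 -> Om x0 -> locally_patched x0.
Proof.
move=> HO HC HD Hsg Hfix S0 kS ck /andP[t0 tT] mk nk O2 Ox0.
have [r1 r10 h1] := disc_nbhs oO2 O2.
have /nbhs_ballP[e /= e0 he] : nbhs x0 Om by apply: open_nbhs_nbhs; split => //; exact: open_rect_open.
have e20 : 0 < e / 2 by rewrite divr_gt0.
pose r := Num.min r1 (Num.min (e / 2) (Num.min S (Num.min (c2 x0) (T - c2 x0)))).
have r0 : 0 < r by rewrite !lt_min r10 e20 S0 t0 subr_gt0.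
have [rr1 re rS rt rT] : [/\ r <= r1, r <= e / 2, r <= S, r <= c2 x0 & r <= T - c2 x0].
  by rewrite /r !ge_min !lexx !orbT.
exists r => // chi tchi.
have dE x : disc x0 r x <-> (c1 x - k) ^+ 2 + (c2 x - c2 x0) ^+ 2 < r ^+ 2 by rewrite /disc /= HD ck.
have n1 x : disc x0 r x -> `|c1 x - k| < r.
  move=> /dE dx; rewrite -ltr_sqr ?nnegrE ?normr_ge0 ?ltW // real_normK ?num_real //.
  by apply: le_lt_trans dx; rewrite lerDl sqr_ge0.
have n2' x : disc x0 r x -> 0 < c2 x /\ c2 x < T.
  move=> /dE dx; have : `|c2 x - c2 x0| < r.
    rewrite -ltr_sqr ?nnegrE ?normr_ge0 ?ltW // real_normK ?num_real //.
    by apply: le_lt_trans dx; rewrite lerDr sqr_ge0.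
  by rewrite ltr_norml => /andP[? ?]; split; lra.
have fixE : [set x | sg x = x] = [set x | c1 x = k].
  apply/seteqP; split => x /=; last exact: Hfix.
  by move=> E; have [h _] := Hsg x; rewrite E in h; lra.
have Bsg x : disc x0 r x -> disc x0 r (sg x).
  by move=> /dE dx; apply/dE; have [-> ->] := Hsg x; have -> : 2 * k - c1 x - k = - (c1 x - k) by [ring]; rewrite sqrrN.
apply: (@patch_interface R Q Qm ap am Omega2 oO2 ap0 am0 apm0 (disc x0 r) sg (e / 2)) => //.
- by apply: open2_measurable; exact: disc_open.
- by move=> x dx; apply: h1; exact: (disc_sub r0 rr1 dx).
- move=> x dx y xy; apply: he; have xx := disc_ball e20 (disc_sub r0 re dx).
  by rewrite [e]splitr; exact: ball_triangle xx xy.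
- move=> x dx [cx nx]; apply: Hfix; have [z1 z2] := HC _ cx; have [z3 z4] := n2' _ dx.
  have := n1 _ dx; rewrite ltr_norml => /andP[z5 z6].
  have : ~ (0 < c1 x /\ c1 x < S) by move=> [? ?]; apply: nx; apply/HO.
  move=> nn; case: kS nn z5 z6 => -> nn z5 z6.
    by apply/eqP; rewrite eq_le z1 andbT leNgt; apply/negP => ?; apply: nn; split => //; lra.
  by apply/eqP; rewrite eq_le z2 /= leNgt; apply/negP => ?; apply: nn; split => //; lra.
- move=> x dx fx; have [g1 g2] := Hsg x; have [z3 z4] := n2' _ dx.
  have xk : c1 x != k by apply/eqP => /Hfix.
  have := n1 _ dx; rewrite ltr_norml => /andP[z5 z6].
  have E1 : Omm x <-> 0 < c1 x /\ c1 x < S by split=> [/HO[]|[? ?]] //; apply/HO.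
  have E2 : Omm (sg x) <-> 0 < 2 * k - c1 x /\ 2 * k - c1 x < S.
    by rewrite -g1; split=> [/HO[]|[? ?]] //; apply/HO; rewrite g2.
  rewrite E1 E2; case: kS xk z5 z6 => ->; rewrite neq_lt => /orP[] ck2 z5 z6; split;
    first [move=> [? ?] [? ?]; lra|move=> nn; first [split; lra|exfalso; apply: nn; split; lra]].
- by rewrite fixE.
- by rewrite fixE.
Qed.

Lemma patch_edge x0 : Omega2 x0 -> closure Omm x0 -> ~ Omm x0 -> ~ corners Qm x0 -> locally_patched x0.
Proof.
move=> O2 hc no nc; have Ox := HQm hc; rewrite closure_open_rect in hc; have [c1 c2 c3 c4] := hc.
have L1 := rect_len1_gt0 Qm; have L2 := rect_len2_gt0 Qm.
have side : (cs Qm x0 = 0 \/ cs Qm x0 = rect_len1 Qm) \/ (ct Qm x0 = 0 \/ ct Qm x0 = rect_len2 Qm).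
  apply: contrapT => H; apply: no; apply/open_rectE.
  by split; rewrite lt_neqAle ?c1 ?c2 ?c3 ?c4 andbT; apply/eqP => E; apply: H; rewrite -?E; tauto.
have ncor : ~ ((cs Qm x0 = 0 \/ cs Qm x0 = rect_len1 Qm) /\ (ct Qm x0 = 0 \/ ct Qm x0 = rect_len2 Qm)).
  move=> [hs ht]; apply: nc; exists (cs Qm x0); first by case: hs => ->; [left|right].
  exists (ct Qm x0); first by case: ht => ->; [left|right].
  exact: rect_pointE.
case: side => [hs|ht].
  have tt : 0 < ct Qm x0 < rect_len2 Qm.
    by rewrite !lt_neqAle c3 c4 !andbT; apply/andP; split; apply/eqP => E; apply: ncor; split => //; [left|right].
  have [sg Hsg] := reflection_cs Qm (cs Qm x0); have [m0 n0] := null_cs Qm (cs Qm x0).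
  apply: (@patch_side (cs Qm) (ct Qm) (rect_len1 Qm) (rect_len2 Qm) (cs Qm x0) sg) => //.
  - exact: open_rectE.
  - by move=> x [].
  - exact: dist_rect.
  - by move=> x E; have [h1 h2] := Hsg x; apply: (@cst_inj _ Qm); rewrite ?h1 ?h2 // E; ring.
have tt : 0 < cs Qm x0 < rect_len1 Qm.
  by rewrite !lt_neqAle c1 c2 !andbT; apply/andP; split; apply/eqP => E; apply: ncor; split => //; [left|right].
have [sg Hsg] := reflection_ct Qm (ct Qm x0); have [m0 n0] := null_ct Qm (ct Qm x0).
apply: (@patch_side (ct Qm) (cs Qm) (rect_len2 Qm) (rect_len1 Qm) (ct Qm x0) sg) => //.
- by move=> x; split=> [/open_rectE[]|[? ? ? ?]] //; apply/open_rectE.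
- by move=> x [].
- by move=> x y; rewrite (dist_rect Qm) addrC.
- by move=> x; have [? ?] := Hsg x.
- by move=> x E; have [h1 h2] := Hsg x; apply: (@cst_inj _ Qm); rewrite ?h1 ?h2 // E; ring.
Qed.

Lemma patch_everywhere x0 : Omega2 x0 -> closure Om x0 -> ~ corners Qm x0 -> locally_patched x0.
Proof.
move=> O2 hc nc; have [hm|hm] := pselect (closure Omm x0); last exact: patch_outer.
by have [om|om] := pselect (Omm x0); [exact: patch_inside|exact: patch_edge].
Qed.

End SidePatches.

(** * Partition into patches and conclusion *)
Section Gluing.
Context {R : realType}.
Implicit Types (f g h u v w p q phi psi chi F G : R * R -> R) (x y : R * R).
Local Notation RR := (measurableTypeR R * measurableTypeR R)%type.

(** The convolution of the indicator of a ball with a mollifier of half its radius. *)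
Lemma plateau x0 (r : R) : 0 < r -> exists2 b : R * R -> R, tfB (disc x0 r) b & forall x, ball x0 (r / 8) x -> b x = 1.
Proof.
have abac (a b c : R * R) : a - b - (a - c) = c - b by rewrite opprB addrC subrKA.
move=> r0; pose d := r / 8; have d0 : 0 < d by rewrite divr_gt0.
pose A := [set x : R * R | ball x0 (2 * d) x].
have mA : measurable (A : set RR) by apply: open2_measurable; exact: ball_open.
have bA : bL2 (ind A).
  apply: bL2_ind => //; exists (`|x0| + 2 * d) => x; rewrite /A /= -ball_normE /= => h.
  rewrite -[x](subrK x0) addrC (le_trans (ler_normD _ _)) // lerD2l ltW //.
  by rewrite distrC.
have tb : tf (conv (ind A) (mol d)) by apply: tf_conv => //; exact: tf_mol.
exists (conv (ind A) (mol d)).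
  split; [exact: tfB_smooth tb|by case: tb|] => x ndx.
  have far : 3 * d < `|x0 - x|.
    rewrite ltNge; apply/negP => h; apply: ndx; rewrite /disc /=.
    have : `|(x0 - x).1| <= 3 * d /\ `|(x0 - x).2| <= 3 * d.
      by move: h; rewrite prod_normE ge_max => /andP[].
    rewrite /= !ler_norml => -[/andP[a1 a2] /andP[a3 a4]].
    have E : (3 * d) ^+ 2 + (3 * d) ^+ 2 < r ^+ 2.
      rewrite -subr_gt0; have -> : r ^+ 2 - ((3 * d) ^+ 2 + (3 * d) ^+ 2) = 46 * (d * d) by rewrite /d; field.
      by rewrite mulr_gt0 // mulr_gt0.
    apply: le_lt_trans E; apply: lerD; rewrite -subr_ge0.
      have -> : (3 * d) ^+ 2 - (x.1 - x0.1) ^+ 2 = (3 * d - (x0.1 - x.1)) * (3 * d + (x0.1 - x.1)) by ring.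
      by rewrite mulr_ge0 //; lra.
    have -> : (3 * d) ^+ 2 - (x.2 - x0.2) ^+ 2 = (3 * d - (x0.2 - x.2)) * (3 * d + (x0.2 - x.2)) by ring.
    by rewrite mulr_ge0 //; lra.
  have : (fun y : R * R => `|x0 - y|) y @[y --> x] --> `|x0 - x|.
    by apply: cvg_norm; apply: cvgB; [exact: cvg_cst|exact: cvg_id].
  move=> /cvgr_gt /(_ _ far); apply: filterS => y fy; apply: contrapT => /eqP.
  move=> /(conv_supp (@mol_out _ d))[z yz /eqP nz]; apply: nz.
  rewrite ind0 // /A /= -ball_normE /= => h; move: fy; rewrite ltNge => /negP; apply.
  rewrite -[x0 - y](subrK (x0 - z)) (le_trans (ler_normD _ _)) //.
  by rewrite abac distrC; move: yz h; lra.
move=> x; rewrite -ball_normE /= -/d => h; rewrite -(I_mol_sub x d0); apply: eq_I => y.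
have [xy|xy] := leP d `|x - y|; first by rewrite mol_out // mulr0.
rewrite ind1 ?mul1r // /A /= -ball_normE /= -[x0 - y](subrK (x0 - x)).
by rewrite abac (le_lt_trans (ler_normD _ _)) //; lra.
Qed.

Lemma compact_bnd (K : set (R * R)) : closed K -> bnd K -> compact K.
Proof.
move=> cK [M hM]; apply: (@subclosed_compact _ K (`[- M, M] `*` `[- M, M])) => //.
  by apply: compact_setX; exact: segment_compact.
by move=> x /hM; rewrite prod_normE ge_max !ler_norml => /andP[h1 h2]; split; rewrite /= in_itv.
Qed.

(** The function is built one point at a time: if [f] has the property and [b] is a
    plateau supported near the next point, so has [f + (1 - f) b], which equals one
    where [f] or [b] does. *)
Lemma local_to_global (K : set (R * R)) (P : (R * R -> R) -> Prop) : compact K ->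
  P (fun=> 0) -> (forall f g, P f -> P g -> P (fun x => f x + g x)) ->
  (forall x0, K x0 -> exists2 r : R, 0 < r & forall chi, tfB (disc x0 r) chi -> P chi) ->
  exists2 theta, P theta & forall x, K x -> theta x = 1.
Proof.
move=> cK P0 PD loc.
(* Sets to which the region where a cut-off equals one can always be extended;
   if [K] were not one of them, the sets whose complement in [K] is would form a
   proper filter without a cluster point in [K]. *)
pose good (A : set (R * R)) := forall f, smooth f -> P f -> exists g, [/\ smooth g, P g,
  forall x, f x = 1 -> g x = 1 & forall x, A x -> g x = 1].
have goodS (A B : set (R * R)) : A `<=` B -> good B -> good A.
  by move=> AB gB f sf Pf; have [g [? ? ? H]] := gB f sf Pf; exists g; split => // x /AB; exact: H.
suff [theta [_ Pt _ Ht]] : exists g, [/\ smooth g, P g, forall x, (fun=> 0 : R) x = 1 -> g x = 1 & forall x, K x -> g x = 1].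
  by exists theta.
suff gK : good K by apply: gK => //; exact: smooth_cst.
apply: contrapT => nK; pose F : set_system (R * R) := [set S | good (K `\` S)].
have FF : ProperFilter F.
  split; first by rewrite /F /= setD0.
  split.
  - by rewrite /F /= => f sf Pf; exists f; split => // x [_]; case.
  - move=> A B gA gB f sf Pf; have [g [sg Pg fg gg]] := gA f sf Pf; have [h [sh Ph gh hh]] := gB g sg Pg.
    exists h; split => // [x /fg /gh //|x [Kx nAB]].
    have [Ax|nA] := pselect (A x); last by apply: gh; exact: gg.
    by apply: hh; split => // Bx; exact: nAB.
  - by move=> A B AB; apply: goodS => x [Kx nB]; split => // /AB.
have FK : F K by move=> f sf Pf; exists f; split => // x [].
have [x0 [Kx0 clx]] := cK F FF FK; have [r r0 Hr] := loc _ Kx0; have [b tb b1] := plateau x0 r0.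
have gB : F (~` ball x0 (r / 8)).
  move=> f sf Pf; exists (fun x => f x + (1 - f x) * b x).
  have s1 : smooth (fun x => 1 - f x) by apply: smoothB => //; exact: smooth_cst.
  have tc : tfB (disc x0 r) (fun x => (1 - f x) * b x) by exact: tfBMl.
  split; [by apply: smoothD => //; exact: tfB_smooth tc|by apply: PD => //; exact: Hr| |].
    by move=> x ->; rewrite subrr mul0r addr0.
  by move=> x [_ /contrapT bx]; rewrite b1 //; ring.
have nb : nbhs x0 (ball x0 (r / 8)) by apply: nbhsx_ballx; rewrite divr_gt0.
by have [y [ny yb]] := clx _ _ gB nb; apply: ny.
Qed.

Lemma n2_cut_le (U : set (R * R)) f : measurable (U : set RR) -> bL2 f -> n2 (cut U f) <= n2 f.
Proof.
move=> mU bf; rewrite -[leRHS]mul1r -(expr1n _ 2); apply: n2_le => //; first exact: bL2_cut.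
move=> x; rewrite mul1r; have [Ux|nU] := pselect (U x); first by rewrite cut_in.
by rewrite cut_out // normr0.
Qed.

(** [Sobolev_norm 2] is the square root of a sum of six terms. *)
Lemma H2_restrict (U : set (R * R)) u w (N : R) : open U -> bnd U -> H2le N w -> (forall x, U x -> w x = u x) ->
  Sobolev 2 U u /\ (Sobolev_norm 2 U u <= (Num.sqrt (6 * N))%:E)%E.
Proof.
move=> oU bU [p [q [a [b [c [[bw bp bq ba bb bc H1 H2 H3] w1 w2 w3 [w4 w5 w6]]]]]]] wu.
have mU : measurable (U : set RR) by exact: open2_measurable.
have E : cut U u = cut U w.
  apply/funext => x; have [Ux|nU] := pselect (U x); first by rewrite !cut_in ?wu.
  by rewrite !cut_out.
have bc' h : bL2 h -> bL2 (cut U h) := @bL2_cut R U h mU.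
have bcu : bL2 (cut U u) by rewrite E; exact: bc'.
have d1 i j h phi : tfB U phi -> ip (cut U h) (der i j phi) = ip h (der i j phi).
  by move=> t; apply: ip_cut; exact: tfB_der.
have s2 (t : R) : (-1) ^+ (1 + 1) * t = - - t by ring.
have s1 (t : R) : (-1) ^+ (1 + 0) * t = - t by ring.
have wdx : wd U 1 0 u p.
  by move=> phi t; rewrite E d1 // ip_cut // s1; case: (H1 _ (tfB_tf t)).
have wdy : wd U 0 1 u q.
  by move=> phi t; rewrite E d1 // ip_cut // s1; case: (H1 _ (tfB_tf t)).
have wda : wd U 2 0 u a.
  move=> phi t; rewrite E d1 // ip_cut // s2 /der /=.
  have [-> _] := H1 _ (tfB_tf (tfB_dx t)); by have [-> _] := H2 _ (tfB_tf t).
have wdb : wd U 1 1 u b.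
  move=> phi t; rewrite E d1 // ip_cut // s2 /der /=.
  have [-> _] := H1 _ (tfB_tf (tfB_dy t)); by have [_ ->] := H2 _ (tfB_tf t).
have wdc : wd U 0 2 u c.
  move=> phi t; rewrite E d1 // ip_cut // s2 /der /=.
  have [_ ->] := H1 _ (tfB_tf (tfB_dy t)); by have [_ ->] := H3 _ (tfB_tf t).
have [S ->] := Sobolev_norm2E oU bU bcu (bc' _ bp) (bc' _ bq) (bc' _ ba) (bc' _ bb) (bc' _ bc) wdx wdy wda wdb wdc.
split => //; rewrite lee_fin ler_wsqrtr // E.
have L h : bL2 h -> n2 h <= N -> n2 (cut U h) <= N by move=> bh; apply: le_trans; exact: n2_cut_le.
have := L _ bw w1; have := L _ bp w2; have := L _ bq w3; have := L _ ba w4; have := L _ bb w5; have := L _ bc w6.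
lra.
Qed.

Lemma sqrtD_le (s t : R) : 0 <= s -> 0 <= t -> Num.sqrt (s + t) <= Num.sqrt s + Num.sqrt t.
Proof.
move=> s0 t0; rewrite -ler_sqr ?nnegrE ?addr_ge0 ?sqrtr_ge0 // sqrrD !sqr_sqrtr ?addr_ge0 //.
by rewrite lerD2r lerDl mulrn_wge0 // mulr_ge0 ?sqrtr_ge0.
Qed.

Lemma wd_sub (U V : set (R * R)) i j u g : V `<=` U -> wd U i j u g -> wd V i j u g.
Proof.
move=> VU H phi t; have t' := tfBS VU t.
by have := H _ t'; rewrite !ip_cut //; exact: tfB_der.
Qed.

End Gluing.

Theorem mainTheorem1 (R : realType) (Q Qm : rectangle R)
    (HQm : closure (open_rect Qm) `<=` open_rect Q)
    (ap am : R) (Hsign : am * ap < 0) (Hcontrast : ap / am <> -1)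
    (Omega1 Omega2 : set (R * R))
    (Omega1_open : open Omega1)
    (Hcorners : closure Omega1 `&` corners Qm = set0)
    (Omega2_open : open Omega2)
    (H12 : closure Omega1 `<=` Omega2) :
  let Omega := open_rect Q in
  let Omegam := open_rect Qm in
  let Omegap := Omega `\` closure Omegam in
  let Omega1m := Omegam `&` Omega1 in
  let Omega1p := Omegap `&` Omega1 in
  exists C : R, forall f u : R * R -> R,
    L2 Omega f -> H10 Q u -> weak_solution Q (coef Qm ap am) f u ->
    let bound := (C%:E * (L2norm (Omega2 `&` Omega) f +
                          Sobolev_norm 1 (Omega2 `&` Omega) u))%E in
    [/\ Sobolev 2 Omega1m u, Sobolev 2 Omega1p u,
        (Sobolev_norm 2 Omega1m u <= bound)%E &
        (Sobolev_norm 2 Omega1p u <= bound)%E].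
Proof.
move=> Om Omm Omp O1m O1p.
have am0 : am != 0 by apply/eqP => h; move: Hsign; rewrite h mul0r ltxx.
have ap0 : ap != 0 by apply/eqP => h; move: Hsign; rewrite h mulr0 ltxx.
have apm0 : ap + am != 0.
  apply/eqP => h; apply: Hcontrast; have -> : ap = - am by lra.
  by rewrite mulNr divff.
pose K := closure Omega1 `&` closed_rect Q.
have cK : compact K.
  apply: compact_bnd; first by apply: closedI; [exact: closed_closure|exact: closed_rect_closed].
  by have [M hM] := bnd_closed_rect Q; exists M => x [_ /hM].
have p0 : patch Q Qm ap am Omega2 (fun=> 0).
  exists 0 => // u p q f _; exists (fun=> 0), (fun=> 0); rewrite mul0r.
  have b0 : bL2 (fun=> 0 : R) by exact: bL2_0.
  have z : n2 (fun=> 0 : R) = 0 by rewrite /n2 ip0l.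
  have w0 : wg setT (fun=> 0 : R) (fun=> 0) (fun=> 0) by move=> phi _; rewrite !ip0l oppr0.
  have H0 : H2le 0 (fun=> 0 : R) by exists (fun=> 0), (fun=> 0), (fun=> 0), (fun=> 0), (fun=> 0); rewrite z; split; [by split|exact: lexx|exact: lexx|exact: lexx|by split; exact: lexx].
  by split => // x; rewrite mul0r.
have [theta [C C0 HC] theta1] : exists2 theta, patch Q Qm ap am Omega2 theta & forall x, K x -> theta x = 1.
  apply: (local_to_global cK p0) => [f g|x [x1 x2]]; first exact: patchD.
  apply: patch_everywhere => //; first exact: H12.
    by rewrite closure_open_rect.
  by move=> cx; have : (closure Omega1 `&` corners Qm) x by []; rewrite Hcorners.
exists (Num.sqrt (6 * C)) => f u Lf Hu Hw bound.
have [p [q [HD bu bp bq [wp1 wq1]]]] : exists p q, [/\ dirichlet Q (coef Qm ap am) (cut Om u) (cut Om p) (cut Om q) (cut Om f),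
    bL2 (cut Om u), bL2 (cut Om p), bL2 (cut Om q) & wd Om 1 0 u p /\ wd Om 0 1 u q].
  exists (weakD Om 1 0 u), (weakD Om 0 1 u); have [b1 b2 b3 b4 _] := zero_extension Hu.
  split; [exact: weak_solution_dirichlet (bm_coef Qm ap am) Lf Hu Hw|exact: b1|exact: b2|exact: b3|exact: b4].
have [wp [wm [Hp Hm Ep Em]]] := HC _ _ _ _ HD.
have oO : open Om := @open_rect_open R Q; have bO : bnd Om := bnd_open_rect Q.
have bf : bL2 (cut Om f) := (L2P f bO).1 Lf.
pose V := Omega2 `&` Om; have VO : V `<=` Om by move=> x [].
have oV : open V by exact: openI.
have bV : bnd V by have [M hM] := bO; exists M => x /VO/hM.
have mV' : measurable (V : set (measurableTypeR R * measurableTypeR R)) by exact: open2_measurable.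
have cV h : cut V (cut Om h) = cut V h by apply/funext => x; exact: cut_cut.
have bcV h : bL2 (cut Om h) -> bL2 (cut V h) by move=> /(bL2_cut mV'); rewrite cV.
have SV := Sobolev_norm1E oV bV (bcV _ bu) (bcV _ bp) (bcV _ bq) (wd_sub VO wp1) (wd_sub VO wq1).
have FV := L2normE (bcV _ bf).
have bdE : bound = (Num.sqrt (6 * C) * (Num.sqrt (n2 (cut V f)) + Num.sqrt (n2 (cut V u) +
    n2 (cut V p) + n2 (cut V q))))%:E.
  by rewrite /bound -/V SV FV.
have en : energy Q Omega2 (cut Om u) (cut Om p) (cut Om q) (cut Om f) =
    n2 (cut V f) + (n2 (cut V u) + n2 (cut V p) + n2 (cut V q)).
  rewrite /energy -/Om -/V !cV; exact: addrC.
have sub : ((Num.sqrt (6 * (C * energy Q Omega2 (cut Om u) (cut Om p) (cut Om q) (cut Om f))))%:E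
    <= bound)%E.
  rewrite bdE en lee_fin mulrA sqrtrM ?mulr_ge0 // ler_wpM2l ?sqrtr_ge0 //.
  by apply: sqrtD_le; rewrite ?addr_ge0 // n2_ge0.
have one x : Omega1 x -> Om x -> theta x = 1.
  by move=> o1 ox; apply: theta1; split; [exact: subset_closure|exact: open_rect_closed].
have bsub (U : set (R * R)) : U `<=` Om -> bnd U by have [M hM] := bO => UO; exists M => x /UO/hM.
have oO1m : open O1m by apply: openI => //; exact: open_rect_open.
have oO1p : open O1p.
  apply: openI => //; apply: openI; first exact: oO.
  by apply: closed_openC; exact: closed_closure.
have mO x : Omm x -> Om x by move=> mx; apply: HQm; exact: subset_closure.
have Wm x : O1m x -> wm x = u x.
  by move=> [mx o1]; have ox := mO _ mx; rewrite Em // one // mul1r cut_in.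
have Wp x : O1p x -> wp x = u x.
  by move=> [[ox nx] o1]; rewrite Ep // one // mul1r cut_in.
have [S1 B1] := H2_restrict oO1m (bsub O1m (fun x h => mO x h.1)) Hm Wm.
have [S2 B2] := H2_restrict oO1p (bsub O1p (fun x h => h.1.1)) Hp Wp.
by split; [exact: S1|exact: S2|exact: le_trans B1 sub|exact: le_trans B2 sub].
Qed.
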